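(* There is a universal constant $c>0$ such that the following holds. Let $m=m(d)$ be positive integers with $m \le c\,d^2$, and let $v_1,\dots,v_m \sim \mathcal N(0,I_d)$ be drawn independently. Then with probability at least $1-o_d(1)$ there exists an ellipsoid in $\mathbb R^d$ passing through every $v_i$, i.e. there exists a symmetric positive semidefinite matrix $\Lambda\in\mathbb R^{d\times d}$ such that $v_i^{\top}\Lambda v_i = 1$ for every $1\le i\le m$.
   Context: $o_d(1)$ denotes a quantity tending to $0$ as $d\to\infty$. By convention, ''there is an ellipsoid passing through $v_1,\dots,v_m$'' means that there is a positive semidefinite $\Lambda\in\mathbb R^{d\times d}$ with $v_i^{\top}\Lambda v_i=1$ for all $i$. *)

(* Defs.v *)
From HB Require Import structures.
From mathcomp Require Import all_boot all_order all_algebra.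
From mathcomp Require Import all_classical all_reals all_analysis.

Set Implicit Arguments.
Unset Strict Implicit.
Unset Printing Implicit Defensive.

Import Order.TTheory GRing.Theory Num.Theory.
Import numFieldNormedType.Exports.

Local Open Scope classical_set_scope.
Local Open Scope ring_scope.

Definition mutually_independent {d1 d2 : measure_display}
    {T1 : measurableType d1} {T2 : measurableType d2} {R : realType}
    (P : probability T1 R) (I : finType) (X : I -> T1 -> T2) : Prop :=
  forall (J : {set I}) (A : I -> set T2), (forall i, measurable (A i)) ->
    P (\bigcap_(i in [set` J]) (X i @^-1` A i)) =
    (\prod_(i in J) P (X i @^-1` A i))%E.

(* The law N(0, I_d), i.e. the coordinates are i.i.d. N(0, 1).  Note that the
   second parameter of [normal_prob] is the standard deviation. *)
Definition standard_gaussian {disp : measure_display} {T : measurableType disp}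
    {R : realType} (P : probability T R) (d : nat)
    (V : {RV P >-> d.-tuple R}) : Prop :=
  mutually_independent P (fun (k : 'I_d) (w : T) => tnth (V w) k) /\
  forall (k : 'I_d) (A : set R), measurable A ->
    P [set w | A (tnth (V w) k)] = normal_prob 0 1 A.

Definition tuple_cV {R : realType} {d : nat} (x : d.-tuple R) : 'cV[R]_d :=
  \col_k tnth x k.

Definition psdmx {R : realType} {d : nat} (L : 'M[R]_d) : Prop :=
  L^T = L /\ forall x : 'cV[R]_d, 0 <= (x^T *m L *m x) 0 0.

Definition ellipsoid_through {R : realType} {d m : nat}
    (v : 'I_m -> 'cV[R]_d) : Prop :=
  exists L : 'M[R]_d,
    psdmx L /\ forall i : 'I_m, ((v i)^T *m L *m v i) 0 0 = 1.

(* Main.v *)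
(* Group the coordinates into W + 1 blocks of size 2n, each split in two halves,
   so that v_i restricts on block k to a pair (a_i, b_i) of vectors of R^n.  Take
   the identity plus, on each block, an off-diagonal perturbation (M_k, M_k^T):
   it is psd as soon as M_k has operator norm at most 1, and the ellipsoid passes
   through v_i if a_i^T M_k b_i is half the average over the OTHER blocks of
   2n - |a_i|^2 - |b_i|^2.  This target g is independent of the block k.

   M_k = sum_i q_i a_i b_i^T solves the equations when q = G^-1 g with
   G_ij = <a_i, a_j> <b_i, b_j>, and x^T M_k y is then a combination of centred
   chi-square variables with coefficients G^-1 (<x, a_i> <y, b_i>)_i that do not
   depend on them.  When G >= (n/36)^2 these coefficients have norm O(1/n), so for
   W a large constant a Bernstein bound survives a union bound over a net of pairs
   (x, y).

   G >= (n/36)^2 says |sum_i q_i a_i b_i^T|_F >= n/36 for unit vectors q.  If half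
   of the mass of q lies on entries with q_i^2 <= 1/n, this is a small-ball
   estimate and a union bound over a fine grid.  Otherwise restrict q to its large
   entries, of which there are at most n: either the restriction is still flat
   enough for a small-ball estimate over a coarser grid, or it is so sparse that
   the diagonal of G dominates; the discarded entries cannot cancel it, since they
   are independent of it.

   Integrals are computed by resampling one coordinate at a time, and every
   exceptional event is bounded by the expectation of a test function. *)
Require Import Defs.
From mathcomp Require Import all_boot all_order all_algebra.
From mathcomp Require Import all_classical all_reals all_analysis.
From mathcomp Require Import measurable_realfun unstable ring lra.
Import Order.TTheory GRing.Theory Num.Theory.
Import numFieldNormedType.Exports.
Local Open Scope classical_set_scope.
Local Open Scope ring_scope.
Set Implicit Arguments.
Unset Strict Implicit.
Unset Printing Implicit Defensive.

(** * Gaussian integrals and resampling *)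

(** The small-ball estimate is a bound on the Laplace transform [E exp (- la |M q|^2)] of
    [M q = sum_i q_i a_i b_i^T]. Given the [a_i], the columns of this matrix are independent
    Gaussians with a common covariance, so integrating the [b_i] gives the [n]-th power of an
    inverse square root of a determinant; the [a_i] are then integrated row by row, each row gaining
    in proportion to the trace still present. One grid cannot serve all [q]: [la] must stay below
    the inverse of [n max q_i^2], and the failure probability [exp (- c la n^2)] loses against the
    entropy of [m] coordinates as soon as [q] has large entries. Vectors with at most [n] nonzero
    entries have entropy of order [n ln n] only, which leaves room for a smaller [la]. The other
    obstacle is that squares of Gaussian bilinear forms have no exponential moments. Sums of such
    squares are therefore taken of [min (Y^2, tau |Y|)], with [tau] placed where deterministic
    bounds on lengths and inner products make the truncation inactive. *)

Section density.
Local Open Scope ereal_scope.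
Context d (T : measurableType d) (R : realType).
Variables (mu nu : {measure set T -> \bar R}) (p : T -> R).
Hypotheses (mp : measurable_fun setT p) (p0 : forall x, (0 <= p x)%R).
Hypothesis nuE : forall A, measurable A -> nu A = \int[mu]_(x in A) (p x)%:E.
Import HBNNSimple.

Let integral_density_nnsfun (f : {nnsfun T >-> R}) :
  \int[nu]_x (f x)%:E = \int[mu]_x ((f x)%:E * (p x)%:E).
Proof.
under [LHS]eq_integral do rewrite fimfunE -fsumEFin//.
rewrite ge0_integral_fsum//; last 2 first.
  - by move=> r; exact/measurable_EFinP/measurableT_comp.
  - by move=> n x _; rewrite EFinM nnfun_muleindic_ge0.
under [RHS]eq_integral.
  move=> x _; rewrite fimfunE -fsumEFin// muleC ge0_mule_fsumr; last first.
    by move=> r; rewrite EFinM nnfun_muleindic_ge0.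
  over.
rewrite ge0_integral_fsum//; last 2 first.
  - move=> r; apply: emeasurable_funM; first exact/measurable_EFinP.
    by apply/measurable_EFinP/measurable_funM.
  - by move=> n x _; apply: mule_ge0; [rewrite lee_fin|rewrite EFinM nnfun_muleindic_ge0].
apply: eq_fsbigr => r _.
have [r0|r0] := boolP (0 <= r)%R; last first.
  have f0 x : \1_(f @^-1` [set r]) x = 0%R :> R.
    by rewrite indicE memNset//= => fx; move: r0; rewrite -fx fun_ge0.
  rewrite [LHS]integral0_eq ?[RHS]integral0_eq// => x _.
    by rewrite f0 mulr0 mule0.
  by rewrite f0 mulr0.
rewrite (@integralZl_indic_nnsfun _ _ _ _ setT)//= integral_indic//= setIT nuE//.
rewrite integral_mkcond/= -ge0_integralZl//; last 2 first.
- apply/(measurable_restrictT _ _).1; last exact/measurable_EFinP/measurable_funTS.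
  by rewrite -[_ @^-1` _]setTI; exact: (measurable_funP f).
- by move=> x _; rewrite patchE; case: ifP; rewrite lee_fin.
apply: eq_integral => x _; rewrite patchE indicE.
by case: ifP => xE; rewrite !(mulr0, mulr1, mule0)// muleC.
Qed.

Lemma ge0_integral_density (f : T -> \bar R) :
  measurable_fun setT f -> (forall x, 0 <= f x) ->
  \int[nu]_x f x = \int[mu]_x (f x * (p x)%:E).
Proof.
move=> mf f0; pose f_ := nnsfun_approx measurableT mf.
transitivity (lim (\int[nu]_x (f_ n x)%:E @[n --> \oo])).
  rewrite -monotone_convergence//=.
  - apply: eq_integral => x _; apply/esym/cvg_lim => //=.
    exact: cvg_nnsfun_approx.
  - by move=> n; exact/measurable_EFinP.
  - by move=> n x _; rewrite lee_fin.
  - by move=> x _ a b ab; rewrite lee_fin; exact/lefP/nd_nnsfun_approx.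
under eq_fun do rewrite integral_density_nnsfun.
rewrite -monotone_convergence//=.
- apply: eq_integral => x _; apply/cvg_lim => //.
  by apply: cvgeZr => //; exact: cvg_nnsfun_approx.
- by move=> n; apply: emeasurable_funM; exact/measurable_EFinP.
- by move=> n x _; rewrite -EFinM lee_fin mulr_ge0.
- move=> x _ a b ab; rewrite -!EFinM lee_fin ler_wpM2r//.
  exact/lefP/nd_nnsfun_approx.
Qed.
End density.

Section gauss.
Context {R : realType}.
Notation gamma := (normal_prob (0 : R) 1).

Lemma normal_pdf01E (x : R) :
  normal_pdf 0 1 x = normal_peak 1 * expR (- (x ^+ 2 / 2)).
Proof.
by rewrite normal_pdfE ?oner_eq0// /normal_fun subr0 expr1n mulNr.
Qed.

Lemma ge0_integral_gauss (f : R -> \bar R) :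
  measurable_fun setT f -> (forall x, 0 <= f x)%E ->
  (\int[gamma]_x f x = \int[lebesgue_measure]_x (f x * (normal_pdf 0 1 x)%:E))%E.
Proof.
move=> mf f0; apply: ge0_integral_density => //.
- exact: measurable_normal_pdf.
- exact: normal_pdf_ge0.
Qed.

Lemma gauss_integral_quad (al be c : R) : 0 < 1 + 2 * al ->
  (\int[gamma]_x (expR (- al * x ^+ 2 + be * x + c))%:E =
   ((Num.sqrt (1 + 2 * al))^-1 * expR (be ^+ 2 / (2 * (1 + 2 * al)) + c))%:E)%E.
Proof.
move=> al0; set s := Num.sqrt (1 + 2 * al).
have s0 : 0 < s by rewrite sqrtr_gt0.
have s2 : s ^+ 2 = 1 + 2 * al by rewrite sqr_sqrtr// ltW.
rewrite ge0_integral_gauss; last 2 first.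
- apply/measurable_EFinP; apply: measurableT_comp => //.
  apply: measurable_funD => //; apply: measurable_funD => //.
  by apply: measurable_funM => //; exact: measurable_funX.
- by move=> x; rewrite lee_fin expR_ge0.
pose C := s^-1 * expR (be ^+ 2 / (2 * (1 + 2 * al)) + c).
(* Completing the square: the integrand times the density is [C] times the normal density of mean
   [be / s ^+ 2] and standard deviation [s^-1]. *)
have E x : ((expR (- al * x ^+ 2 + be * x + c))%:E * (normal_pdf 0 1 x)%:E =
  C%:E * (normal_pdf (be / s ^+ 2) s^-1 x)%:E)%E.
  rewrite -!EFinM; congr (_%:E).
  rewrite normal_pdf01E normal_pdfE ?invr_eq0 ?gt_eqF// /normal_fun /C.
  have -> : normal_peak s^-1 = s * normal_peak 1.
    rewrite /normal_peak expr1n mul1r -mulrnAr sqrtrM ?sqr_ge0// sqrtr_sqr.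
    by rewrite ger0_norm ?invr_ge0 1?ltW// invfM invrK.
  rewrite mulrCA -expRD.
  rewrite [RHS](_ : _ = (s^-1 * s) * (normal_peak 1 * (expR (be ^+ 2 / (2 * (1 + 2 * al)) + c)
    * expR (- (x - be / s ^+ 2) ^+ 2 / (s^-1 ^+ 2 *+ 2))))); last by ring.
  rewrite mulVf ?gt_eqF// mul1r -expRD; congr (_ * expR _).
  rewrite -s2.
  have -> : al = (s ^+ 2 - 1) / 2 by rewrite s2; field.
  field; by rewrite gt_eqF.
under eq_integral do rewrite E.
rewrite ge0_integralZl//.
- by rewrite integral_normal_pdf mule1.
- by apply/measurable_EFinP; exact: measurable_normal_pdf.
- by move=> x _; rewrite lee_fin normal_pdf_ge0.
- by rewrite lee_fin mulr_ge0 ?invr_ge0 ?expR_ge0 ?ltW.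
Qed.

End gauss.

Definition gauss (R : realType) : probability (measurableTypeR R) R :=
  [the probability _ _ of @normal_prob R 0 1].

(** Boxes are stable under intersection and generate the product sigma-algebra, so the law of an
    array is determined by the product formula of [gaussian_array]. *)
Definition boxes (I : finType) (R : realType) : set (set (I -> R)) :=
  [set B | exists2 A : I -> set R, (forall i, measurable (A i)) &
    B = [set x | forall i, A i (x i)]].

Definition points (I : finType) (R : realType) := g_sigma_algebraType (@boxes I R).

Definition setc (I : finType) (R : realType) (x : I -> R) (k : I) (t : R) : I -> R :=
  fun i => if i == k then t else x i.

Lemma setI_closed_boxes (I : finType) (R : realType) : setI_closed (@boxes I R).
Proof.
move=> _ _ [A mA ->] [B mB ->]; exists (fun i => A i `&` B i).
  by move=> i; exact: measurableI.
by apply/seteqP; split=> x /= => [[a b] i|h]; split=> // i; case: (h i).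
Qed.

Lemma measurable_coord (I : finType) (R : realType) (i : I) :
  measurable_fun [set: points I R] (fun x => x i).
Proof.
move=> _ B mB; rewrite setTI; apply: sub_sigma_algebra.
exists (fun j => if j == i then B else setT).
  by move=> j; case: ifP.
apply/seteqP; split=> x /=.
  by move=> h j; case: eqP => // ->.
by move=> /(_ i); rewrite eqxx.
Qed.

Lemma measurable_forall_fin d (T : measurableType d) (I : finType) (A : I -> set T) :
  (forall i, measurable (A i)) -> measurable [set w | forall i, A i w].
Proof.
move=> mA; rewrite (_ : [set w | _] = \bigcap_(i in [set: I]) A i).
  by apply: fin_bigcap_measurable => // i _.
by apply/seteqP; split=> x /= h i //; exact: h.
Qed.

Lemma measurable_points d (T : measurableType d) (I : finType) (R : realType)
    (f : T -> points I R) :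
  (forall i, measurable_fun setT (fun w => f w i)) -> measurable_fun setT f.
Proof.
move=> mf; apply: (@measurability _ _ T (points I R) setT f (@boxes I R)) => //.
move=> _ [_ [A mA ->] <-].
rewrite setTI; apply: measurable_forall_fin => i.
by rewrite -[X in measurable X]setTI; exact: mf.
Qed.

Definition gaussian_array d (T : measurableType d) (R : realType)
    (P : probability T R) (I : finType) (X : T -> points I R) : Prop :=
  (forall i, measurable_fun setT (fun w => X w i)) /\
  (forall A : I -> set R, (forall i, measurable (A i)) ->
    P [set w | forall i, A i (X w i)] = (\prod_i gauss R (A i))%E).

Definition expect d (T : measurableType d) (R : realType) (P : probability T R)
    (I : finType) (X : T -> points I R) (f : points I R -> R) : \bar R :=
  (\int[P]_w (f (X w))%:E)%E.

Section resampling.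
Context d (T : measurableType d) (R : realType) (P : probability T R).
Context (I : finType).
Notation gamma := (gauss R).
Variable X : T -> points I R.
Hypothesis HX : gaussian_array P X.
Let mX := HX.1.
Let lawX := HX.2.

Let mXT : measurable_fun setT X. Proof. exact: measurable_points. Qed.

Let phi k (p : T * measurableTypeR R) : points I R := setc (X p.1) k p.2.

Let mphi k : measurable_fun setT (phi k).
Proof.
apply: measurable_points => i; rewrite /phi /setc; case: (i == k).
  by move=> *; exact: measurable_snd.
exact: (measurableT_comp (f := fun w => X w i) (mX i) measurable_fst).
Qed.

(** Redrawing one coordinate from the Gaussian law leaves the law of the array unchanged: the two
    laws agree on boxes. Tonelli's theorem then splits off the fresh coordinate; this takes the
    place of conditioning throughout. *)
Lemma resample k (f : points I R -> \bar R) :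
  measurable_fun setT f -> (forall x, 0 <= f x)%E ->
  (\int[P]_w f (X w) = \int[P]_w \int[gamma]_t f (setc (X w) k t))%E.
Proof.
move=> mf f0.
pose nu : {measure set _ -> \bar R} := (P \x gamma)%E.
pose m1 := measure_function_pushforward__canonical__measure_function_Measure P mXT.
pose m2 := measure_function_pushforward__canonical__measure_function_Measure nu (mphi k).
have E A : measurable A -> m1 A = m2 A.
  apply: (@measure_unique _ R (points I R) (@boxes I R) (fun=> setT) erefl _ _ _ m1 m2).
  - exact: setI_closed_boxes.
  - by move=> _; exists (fun=> setT) => //; apply/seteqP; split.
  - by rewrite bigcup_const.
  - move=> _ [B mB ->]; rewrite /= /pushforward.
    (* [B'] drops the constraint on coordinate [k], which is carried by the fresh factor instead. *)
    pose B' i := if i == k then setT else B i.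
    have mB' i : measurable (B' i) by rewrite /B'; case: ifP.
    rewrite [RHS](_ : _ = nu ([set w | forall i, B' i (X w i)] `*` B k)); last first.
      congr (nu _); apply/seteqP; split=> -[w t] /=; rewrite /phi /setc/=.
        move=> h; split; last by have := h k; rewrite eqxx.
        by move=> i; have := h i; rewrite /B'; case: eqP.
      by move=> [h1 h2] i; have := h1 i; rewrite /B'; case: eqP => // ->.
    have mS : measurable [set w | forall i, B' i (X w i)].
      apply: measurable_forall_fin => i.
      rewrite -[X in measurable X]setTI; exact: mX.
    rewrite [RHS](_ : _ = P [set w | forall i, B' i (X w i)] * gamma (B k))%E; last first.
      exact: (product_measure1E P gamma mS (mB k)).
    apply: (etrans (lawX mB)).
    rewrite [RHS](_ : _ = (\prod_i gamma (B' i) * gamma (B k))%E); last first.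
      by congr (_ * _)%E; exact: (lawX mB').
    rewrite (bigD1 k)//= [in RHS](bigD1 k)//= {1}/B' eqxx probability_setT mul1e muleC.
    congr (_ * _)%E; apply: eq_bigr => i /negbTE ik; rewrite /B' ik; reflexivity.
  - by move=> _; rewrite /= /pushforward preimage_setT probability_setT ltry.
transitivity (\int[m1]_x f x)%E.
  by rewrite (ge0_integral_pushforward mXT).
rewrite (eq_measure_integral m2); last by move=> A mA _; exact: E.
rewrite (_ : \int[m2]_x f x = \int[nu]_x (f \o phi k) x)%E; last first.
  exact: (ge0_integral_pushforward (mphi k) nu measurableT mf).
by rewrite fubini_tonelli1//=; apply: measurableT_comp.
Qed.

Lemma resample_le k (f g : points I R -> R) :
  measurable_fun setT f -> (forall x, 0 <= f x) ->
  measurable_fun setT g ->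
  (forall x, (\int[gamma]_t (f (setc x k t))%:E <= (g x)%:E)%E) ->
  (expect P X f <= expect P X g)%E.
Proof.
move=> mf f0 mg h.
rewrite /expect (@resample k (fun x => (f x)%:E)); last 2 first.
- exact/measurable_EFinP.
- by move=> x; rewrite lee_fin.
apply: ge0_le_integral => //.
- by move=> w _; apply: integral_ge0 => t _; rewrite lee_fin.
- apply: (measurable_fun_fubini_tonelli_F (fun p => (f (phi k p))%:E)) => //.
    by apply/measurable_EFinP; exact: measurableT_comp (mphi k).
  by move=> p; rewrite lee_fin.
- by apply/measurable_EFinP; exact: measurableT_comp.
Qed.

End resampling.

Section forms.
Context {R : realType}.

Definition bform n (Q : 'M[R]_n) (x y : 'cV[R]_n) : R := (x^T *m Q *m y) 0 0.

Lemma bformE n (Q : 'M[R]_n) x y :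
  bform Q x y = \sum_i \sum_j x i 0 * Q i j * y j 0.
Proof.
rewrite /bform mxE exchange_big/=; apply: eq_bigr => j _.
by rewrite mxE mulr_suml; apply: eq_bigr => i _; rewrite mxE.
Qed.

Lemma bformDl n (Q : 'M[R]_n) x y z : bform Q (x + y) z = bform Q x z + bform Q y z.
Proof. by rewrite /bform linearD/= !mulmxDl mxE. Qed.

Lemma bformDr n (Q : 'M[R]_n) x y z : bform Q x (y + z) = bform Q x y + bform Q x z.
Proof. by rewrite /bform mulmxDr mxE. Qed.

Lemma bformZl n (Q : 'M[R]_n) a x y : bform Q (a *: x) y = a * bform Q x y.
Proof. by rewrite /bform linearZ/= -!scalemxAl mxE. Qed.

Lemma bformZr n (Q : 'M[R]_n) a x y : bform Q x (a *: y) = a * bform Q x y.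
Proof. by rewrite /bform -scalemxAr mxE. Qed.

Lemma bformZ n (Q : 'M[R]_n) a x y : bform (a *: Q) x y = a * bform Q x y.
Proof. by rewrite /bform -scalemxAr -scalemxAl mxE. Qed.

Lemma bformB n (Q Q' : 'M[R]_n) x y : bform (Q - Q') x y = bform Q x y - bform Q' x y.
Proof. by rewrite /bform mulmxBr mulmxBl mxE [in X in _ + X]mxE. Qed.

Lemma bformC n (Q : 'M[R]_n) x y : Q^T = Q -> bform Q x y = bform Q y x.
Proof.
move=> Qs; rewrite /bform -[in LHS](trmxK (x^T *m Q *m y)) [in LHS]mxE.
by rewrite !trmx_mul trmxK Qs mulmxA.
Qed.

(* The form obtained from [Q] by integrating [exp (- Q (t w + y))] against the
   Gaussian law of [t]. *)
Definition gupdate n (Q : 'M[R]_n) (w : 'cV[R]_n) : 'M[R]_n :=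
  Q - (2 / (1 + 2 * bform Q w w)) *: (Q *m w *m (w^T *m Q)).

Lemma bform_gupdate n (Q : 'M[R]_n) w x y :
  bform (gupdate Q w) x y =
  bform Q x y - 2 / (1 + 2 * bform Q w w) * (bform Q x w * bform Q w y).
Proof.
rewrite /gupdate bformB bformZ; congr (_ - _ * _).
rewrite /bform -!mulmxA (mulmxA Q) (mulmxA x^T) (mulmxA w^T).
by rewrite [in LHS]mxE big_ord1 !mulmxA.
Qed.

Lemma gupdate_sym n (Q : 'M[R]_n) w : Q^T = Q -> (gupdate Q w)^T = gupdate Q w.
Proof.
move=> Qs; rewrite /gupdate linearB/= linearZ/= Qs; congr (_ - _ *: _).
by rewrite !trmx_mul trmxK Qs mulmxA.
Qed.

(** This is [det (1 + 2 W^T Q W)^(-1/2)] for the matrix [W] with columns [w j], written as the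
    product of the one-dimensional normalisations met when the variables are integrated out in the
    order of [s]. *)
Fixpoint gdet n (J : Type) (Q : 'M[R]_n) (w : J -> 'cV[R]_n) (s : seq J) : R :=
  if s is j :: s' then
    (Num.sqrt (1 + 2 * bform Q (w j) (w j)))^-1 * gdet (gupdate Q (w j)) w s'
  else 1.

(** Convergence of the successive one-dimensional integrals: automatic for a semidefinite form, a
    genuine condition for the opposite of one. *)
Fixpoint gpos n (J : Type) (Q : 'M[R]_n) (w : J -> 'cV[R]_n) (s : seq J) : bool :=
  if s is j :: s' then
    (0 < 1 + 2 * bform Q (w j) (w j)) && gpos (gupdate Q (w j)) w s'
  else true.

Lemma gdet_ge0 n (J : Type) (Q : 'M[R]_n) (w : J -> 'cV[R]_n) s : 0 <= gdet Q w s.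
Proof.
by elim: s Q => //= j s IH Q; rewrite mulr_ge0 ?invr_ge0 ?sqrtr_ge0.
Qed.

Lemma eq_in_gdet n (J : eqType) (Q : 'M[R]_n) (w w' : J -> 'cV[R]_n) (s : seq J) :
  {in s, w =1 w'} -> gdet Q w s = gdet Q w' s.
Proof.
elim: s Q => //= j s IH Q ww'; rewrite ww' ?mem_head// IH// => k ks.
by rewrite ww'// inE ks orbT.
Qed.

End forms.

(** * Entrywise measurability of matrix-valued maps *)

Section mxmeasurable.
Context d (T : measurableType d) (R : realType).

Definition mxmeasurable p q (M : T -> 'M[R]_(p, q)) :=
  forall i j, measurable_fun setT (fun x => M x i j).

Lemma mxmeasurable_cst p q (M : 'M[R]_(p, q)) : mxmeasurable (fun=> M).
Proof. by move=> i j; exact: measurable_cst. Qed.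

Lemma mxmeasurableM p q r (M : T -> 'M[R]_(p, q)) (N : T -> 'M[R]_(q, r)) :
  mxmeasurable M -> mxmeasurable N -> mxmeasurable (fun x => M x *m N x).
Proof.
move=> mM mN i j; under eq_fun do rewrite mxE.
by apply: measurable_sum => k; exact: measurable_funM.
Qed.

Lemma mxmeasurableD p q (M N : T -> 'M[R]_(p, q)) :
  mxmeasurable M -> mxmeasurable N -> mxmeasurable (fun x => M x + N x).
Proof.
by move=> mM mN i j; under eq_fun do rewrite mxE; exact: measurable_funD.
Qed.

Lemma mxmeasurableZ p q (a : T -> R) (M : T -> 'M[R]_(p, q)) : measurable_fun setT a ->
  mxmeasurable M -> mxmeasurable (fun x => a x *: M x).
Proof.
by move=> ma mM i j; under eq_fun do rewrite mxE; exact: measurable_funM.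
Qed.

Lemma mxmeasurableN p q (M : T -> 'M[R]_(p, q)) :
  mxmeasurable M -> mxmeasurable (fun x => - M x).
Proof.
by move=> mM i j; under eq_fun do rewrite mxE; exact: measurable_funN.
Qed.

Lemma mxmeasurable_tr p q (M : T -> 'M[R]_(p, q)) :
  mxmeasurable M -> mxmeasurable (fun x => (M x)^T).
Proof. by move=> mM i j; under eq_fun do rewrite mxE; exact: mM. Qed.

Lemma mxmeasurable_sum p q (J : Type) (s : seq J) (M : J -> T -> 'M[R]_(p, q)) :
  (forall j, mxmeasurable (M j)) -> mxmeasurable (fun x => \sum_(j <- s) M j x).
Proof.
by move=> mM i j; under eq_fun do rewrite summxE; apply: measurable_sum => k; exact: mM.
Qed.

Lemma measurable_bform n (Q : T -> 'M[R]_n) x y :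
  mxmeasurable Q -> mxmeasurable x -> mxmeasurable y ->
  measurable_fun setT (fun w => bform (Q w) (x w) (y w)).
Proof.
move=> mQ mx my.
exact: (mxmeasurableM (mxmeasurableM (mxmeasurable_tr mx) mQ) my 0 0).
Qed.

Lemma measurable_inv (f : T -> R) :
  measurable_fun setT f -> measurable_fun setT (fun x => (f x)^-1).
Proof.
(* The inverse is [f x] times a real power of its square; at a zero of [f] both sides vanish, as
   [0^-1 = 0]. *)
move=> mf; rewrite (_ : (fun _ => _) = fun x => f x * (f x ^+ 2) `^ (-1)).
  apply: measurable_funM => //.
  apply: (measurableT_comp (f := fun y => y `^ (-1))); first exact: measurable_powR.
  exact: measurable_funX.
apply/funext => x; have [->|fx0] := eqVneq (f x) 0; first by rewrite invr0 mul0r.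
by rewrite powR_inv1 ?sqr_ge0// expr2 invfM mulrA divff// mul1r.
Qed.

Lemma measurable_sqrt (f : T -> R) :
  measurable_fun setT f -> measurable_fun setT (fun x => Num.sqrt (f x)).
Proof.
move=> mf; apply: (measurableT_comp (f := @Num.sqrt R)) => //.
apply: continuous_measurable_fun => x; exact: sqrt_continuous.
Qed.

Lemma mxmeasurable_gupdate n (Q : T -> 'M[R]_n) w :
  mxmeasurable Q -> mxmeasurable w -> mxmeasurable (fun x => gupdate (Q x) (w x)).
Proof.
move=> mQ mw; apply: mxmeasurableD => //; apply: mxmeasurableN.
apply: mxmeasurableZ.
  apply: measurable_funM => //; apply: measurable_inv.
  by apply: measurable_funD => //; apply: measurable_funM => //; exact: measurable_bform.
apply: mxmeasurableM; first exact: mxmeasurableM.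
by apply: mxmeasurableM => //; exact: mxmeasurable_tr.
Qed.

Lemma measurable_gdet n (J : Type) (Q : T -> 'M[R]_n) (w : J -> T -> 'cV[R]_n) s :
  mxmeasurable Q -> (forall j, mxmeasurable (w j)) ->
  measurable_fun setT (fun x => gdet (Q x) (w^~ x) s).
Proof.
move=> + mw; elim: s Q => [|j s IH] Q mQ /=; first exact: measurable_cst.
apply: measurable_funM.
  apply: measurable_inv; apply: measurable_sqrt.
  by apply: measurable_funD => //; apply: measurable_funM => //; exact: measurable_bform.
exact: (IH (fun x => gupdate (Q x) (w j x)) (mxmeasurable_gupdate mQ (mw j))).
Qed.

End mxmeasurable.

Section elimination.
Context d (T : measurableType d) (R : realType) (P : probability T R).
Context (I : finType).
Variable X : T -> points I R.
Hypothesis HX : gaussian_array P X.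
Local Notation E f := (expect P X f%R).

(** Independence in functional form: what ignores coordinate [k] can be pulled out of the integral
    over that coordinate. *)
Definition free_of (A : Type) (f : points I R -> A) (k : I) :=
  forall x t, f (setc x k t) = f x.

Lemma measurable_points_fun (f : points I R -> R) :
  measurable_fun setT f -> measurable_fun setT (f \o X).
Proof. move=> mf; apply: measurableT_comp => //; by apply: measurable_points; exact: HX.1. Qed.

Lemma expect_le (f g : points I R -> R) :
  measurable_fun setT f -> (forall x, 0 <= f x) -> measurable_fun setT g ->
  (forall x, f x <= g x) -> (E f <= E g)%E.
Proof.
move=> mf f0 mg fg; apply: ge0_le_integral => //.
- by move=> w _; rewrite lee_fin.
- by apply/measurable_EFinP; exact: measurable_points_fun.
- by apply/measurable_EFinP; exact: measurable_points_fun.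
- by move=> w _; rewrite lee_fin.
Qed.

Lemma measurable_setc (f : points I R -> R) x k : measurable_fun setT f ->
  measurable_fun [set: measurableTypeR R] (fun t => f (setc x k t)).
Proof.
move=> mf; apply: (measurableT_comp (f := f) (g := fun t : measurableTypeR R => setc x k t)) => //.
apply: measurable_points => i; rewrite /setc; case: (i == k).
  exact: measurable_id.
exact: measurable_cst.
Qed.

(** When coordinate [c j] is redrawn, only the factor [phi j] feels it, and its integral is
    dominated by [psi j]. Replaced factors join [h], which is why every [psi j] has to ignore all
    the eliminated coordinates. *)
Lemma elim_prod (J : eqType) (s : seq J) (c : J -> I) (phi psi : J -> points I R -> R)
    (h : points I R -> R) :
  uniq (map c s) ->
  measurable_fun setT h -> (forall x, 0 <= h x) ->
  (forall j, measurable_fun setT (phi j)) -> (forall j x, 0 <= phi j x) ->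
  (forall j, measurable_fun setT (psi j)) -> (forall j x, 0 <= psi j x) ->
  (forall j, j \in s -> free_of h (c j)) ->
  (forall j j', j \in s -> j' \in s -> free_of (psi j) (c j')) ->
  (forall j j', j \in s -> j' \in s -> j != j' -> free_of (phi j) (c j')) ->
  (forall j x, j \in s ->
    \int[gauss R]_t (phi j (setc x (c j) t))%:E <= (psi j x)%:E)%E ->
  (E (fun x => h x * \prod_(j <- s) phi j x) <= E (fun x => h x * \prod_(j <- s) psi j x))%E.
Proof.
move=> us mh h0 mphi phi0 mpsi psi0.
have mprod (F : J -> points I R -> R) s' : (forall j, measurable_fun setT (F j)) ->
    measurable_fun setT (fun x => \prod_(j <- s') F j x).
  by move=> mF; exact: measurable_prod.
elim: s h us mh h0 => [|j s IH] h /=.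
  move=> _ mh h0 *; apply: expect_le => //.
  - by apply: measurable_funM => //; exact: mprod.
  - by move=> x; rewrite big_nil mulr1.
  - by apply: measurable_funM => //; exact: mprod.
  - by move=> x; rewrite !big_nil.
move=> /andP[js us] mh h0 hfree psifree phifree phipsi.
apply: (@le_trans _ _ (E (fun x => (h x * psi j x) * \prod_(j <- s) phi j x))).
  apply: (resample_le HX (k := c j)) => //.
  - by apply: measurable_funM => //; exact: mprod.
  - by move=> x; rewrite mulr_ge0// prodr_ge0.
  - by apply: measurable_funM; [exact: measurable_funM|exact: mprod].
  move=> x.
  have E1 t : (h (setc x (c j) t) * \prod_(j0 <- j :: s) phi j0 (setc x (c j) t))%:E =
     ((h x * \prod_(j <- s) phi j x)%:E * (phi j (setc x (c j) t))%:E)%E.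
    rewrite -EFinM; congr (_%:E); rewrite big_cons hfree ?mem_head//.
    rewrite mulrCA mulrC; congr (_ * _ * _).
    apply: eq_big_seq => j' j's; apply: phifree; rewrite ?mem_head// ?inE ?j's ?orbT//.
    by apply: contraNneq js => <-; exact: map_f.
  under eq_integral do rewrite E1.
  rewrite ge0_integralZl//.
  - rewrite [in leRHS]mulrAC [leRHS]EFinM; apply: lee_wpmul2l.
      by rewrite lee_fin mulr_ge0// prodr_ge0.
    by apply: phipsi; rewrite mem_head.
  - by apply/measurable_EFinP; exact: measurable_setc.
  - by move=> t _; rewrite lee_fin.
  - by rewrite lee_fin mulr_ge0// prodr_ge0.
apply: (le_trans (IH (fun x => h x * psi j x) us _ _ _ _ _ _)).
- exact: measurable_funM.
- by move=> x; rewrite mulr_ge0.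
- move=> j' j's x t; rewrite hfree ?inE ?j's ?orbT// psifree ?mem_head//.
  by rewrite inE j's orbT.
- by move=> *; apply: psifree; rewrite inE; apply/orP; right.
- by move=> *; apply: phifree => //; rewrite inE; apply/orP; right.
- by move=> *; apply: phipsi; rewrite inE; apply/orP; right.
apply: expect_le.
- by apply: measurable_funM; [exact: measurable_funM|exact: mprod].
- by move=> x; rewrite mulr_ge0 ?prodr_ge0// mulr_ge0.
- by apply: measurable_funM => //; exact: mprod.
- by move=> x; rewrite big_cons mulrA.
Qed.

End elimination.

(** * Exponential quadratic functionals *)

Section gaussian_elimination.
Context d (T : measurableType d) (R : realType) (P : probability T R).
Context (I : finType).
Variable X : T -> points I R.
Hypothesis HX : gaussian_array P X.
Local Notation E f := (expect P X f%R).

Lemma integral_gauss_quad (al be c : R) : 0 < 1 + 2 * al ->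
  (\int[gauss R]_x (expR (- al * x ^+ 2 + be * x + c))%:E =
   ((Num.sqrt (1 + 2 * al))^-1 * expR (be ^+ 2 / (2 * (1 + 2 * al)) + c))%:E)%E.
Proof. exact: gauss_integral_quad. Qed.

Lemma measurable_expR_comp d' (T' : measurableType d') (f : T' -> R) :
  measurable_fun setT f -> measurable_fun setT (fun x => expR (f x)).
Proof. by move=> mf; apply: (measurableT_comp (f := @expR R)). Qed.

Lemma mxmeasurable_lincomb n (J : Type) (s : seq J) (c : J -> I)
    (w : J -> points I R -> 'cV[R]_n) :
  (forall j, mxmeasurable (w j)) ->
  mxmeasurable (fun x : points I R => \sum_(j <- s) x (c j) *: w j x).
Proof.
move=> mw; apply: mxmeasurable_sum => j; apply: mxmeasurableZ => //.
exact: measurable_coord.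
Qed.

(** Each resampling completes the square in one coordinate, turns [Q] into its [gupdate] and leaves
    one factor of [gdet]. Both [Q] and [w] may be random through the coordinates that are not
    integrated. *)
Lemma elim_quad n (J : eqType) (s : seq J) (c : J -> I) (h : points I R -> R)
    (Q : points I R -> 'M[R]_n) (w : J -> points I R -> 'cV[R]_n) :
  uniq (map c s) ->
  measurable_fun setT h -> (forall x, 0 <= h x) ->
  mxmeasurable Q -> (forall x, (Q x)^T = Q x) -> (forall j, mxmeasurable (w j)) ->
  (forall j, j \in s -> free_of h (c j)) ->
  (forall j, j \in s -> free_of Q (c j)) ->
  (forall j j', j \in s -> j' \in s -> free_of (w j) (c j')) ->
  (forall x, gpos (Q x) (w^~ x) s) ->
  (E (fun x => h x * expR (- bform (Q x) (\sum_(j <- s) x (c j) *: w j x)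
                                         (\sum_(j <- s) x (c j) *: w j x)))
   <= E (fun x => h x * gdet (Q x) (w^~ x) s))%E.
Proof.
move=> us mh h0 mQ Qs mw.
elim: s h Q us mh h0 mQ Qs => [|j s IH] h Q /=.
  move=> _ mh h0 mQ *; apply: expect_le => //.
  - apply: measurable_funM => //; apply: measurable_expR_comp; apply: measurable_funN.
    by apply: measurable_bform => //; exact: mxmeasurable_lincomb.
  - by move=> x; rewrite mulr_ge0// expR_ge0.
  - by apply: measurable_funM => //; exact: measurable_cst.
  - by move=> x; rewrite !big_nil /bform mulmx0 mxE oppr0 expR0.
move=> /andP[js us] mh h0 mQ Qs hf Qf wf pos.
pose y (x : points I R) := \sum_(j <- s) x (c j) *: w j x.
have my : mxmeasurable y by exact: mxmeasurable_lincomb.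
pose q x := bform (Q x) (w j x) (w j x).
have mq : measurable_fun setT q by exact: measurable_bform.
pose h' x := h x * (Num.sqrt (1 + 2 * q x))^-1.
pose Q' x := gupdate (Q x) (w j x).
have mh' : measurable_fun setT h'.
  apply: measurable_funM => //; apply: measurable_inv; apply: measurable_sqrt.
  by apply: measurable_funD => //; exact: measurable_funM.
have mQ' : mxmeasurable Q' by exact: mxmeasurable_gupdate.
have yfree x t : y (setc x (c j) t) = y x.
  apply: eq_big_seq => j' j's; rewrite wf ?inE ?j's ?eqxx ?orbT//.
  congr (_ *: _); rewrite /setc; case: eqP => // e.
  by rewrite -e map_f in js.
apply: (@le_trans _ _ (E (fun x => h' x * expR (- bform (Q' x) (y x) (y x))))).
  apply: (resample_le HX (k := c j)).
  - apply: measurable_funM => //; apply: measurable_expR_comp; apply: measurable_funN.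
    by apply: measurable_bform => //; exact: mxmeasurable_lincomb.
  - by move=> x; rewrite mulr_ge0// expR_ge0.
  - apply: measurable_funM => //; apply: measurable_expR_comp; apply: measurable_funN.
    exact: measurable_bform.
  move=> x.
  have := pos x => /= /andP[q0 _].
  pose b := bform (Q x) (y x) (w j x).
  pose al := q x; pose be := - (2 * b); pose cc := - bform (Q x) (y x) (y x).
  have E1 t : (h (setc x (c j) t) * expR (- bform (Q (setc x (c j) t))
     (\sum_(j1 <- j :: s) setc x (c j) t (c j1) *: w j1 (setc x (c j) t))
     (\sum_(j1 <- j :: s) setc x (c j) t (c j1) *: w j1 (setc x (c j) t))))%:E =
     ((h x)%:E * (expR (- al * t ^+ 2 + be * t + cc))%:E)%E.
    rewrite -EFinM; congr (_%:E); rewrite hf ?mem_head// Qf ?mem_head//.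
    rewrite big_cons -/(y _) yfree wf ?mem_head// {1 2}/setc eqxx.
    congr (_ * expR _).
    rewrite !bformDl !bformDr !bformZl !bformZr (bformC (w j x) (y x))// -/b -/(q x) /al /be /cc.
    ring.
  under eq_integral do rewrite E1.
  rewrite ge0_integralZl//.
  - rewrite integral_gauss_quad// -EFinM lee_fin /h' mulrA.
    rewrite ler_wpM2l ?mulr_ge0 ?invr_ge0 ?sqrtr_ge0// ler_expR.
    rewrite /Q' bform_gupdate (bformC (w j x) (y x))// -/(q x) -/b /be /cc -/al.
    rewrite le_eqVlt; apply/orP; left; apply/eqP.
    field; rewrite gt_eqF//.
  - apply/measurable_EFinP; apply: measurable_expR_comp.
    apply: measurable_funD => //; apply: measurable_funD => //.
    by apply: measurable_funM => //; exact: measurable_funX.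
  - by rewrite lee_fin.
apply: (le_trans (IH h' Q' us _ _ _ _ _ _ _ _)) => //.
- by move=> x; rewrite mulr_ge0// invr_ge0 sqrtr_ge0.
- by move=> x; apply: gupdate_sym.
- move=> k ks x t; rewrite /h' /q hf ?inE ?ks ?orbT// Qf ?inE ?ks ?orbT//.
  by rewrite wf ?mem_head// inE ks orbT.
- move=> k ks x t; rewrite /Q' Qf ?inE ?ks ?orbT//.
  by rewrite wf ?mem_head// inE ks orbT.
- by move=> k k' ks ks'; apply: wf; rewrite inE ?ks ?ks' orbT.
- by move=> x; have := pos x => /= /andP[].
apply: expect_le => //.
- by apply: measurable_funM => //; apply: measurable_gdet.
- by move=> x; rewrite mulr_ge0 ?gdet_ge0// mulr_ge0// invr_ge0 sqrtr_ge0.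
- apply: measurable_funM => //; apply: measurable_funM => //; last exact: measurable_gdet.
  apply: measurable_inv; apply: measurable_sqrt.
  by apply: measurable_funD => //; exact: measurable_funM.
- by move=> x; rewrite mulrA.
Qed.

(** The copies use disjoint coordinates but share [Q] and [w], so each contributes the same
    determinant. The intended copies are the columns of a random matrix. *)
Lemma elim_quad_copies n (L J : eqType) (ls : seq L) (s : seq J) (c : L -> J -> I)
    (h : points I R -> R)
    (Q : points I R -> 'M[R]_n) (w : J -> points I R -> 'cV[R]_n) :
  uniq ls -> uniq s ->
  (forall l l' j j', l \in ls -> l' \in ls -> j \in s -> j' \in s ->
     c l j = c l' j' -> l = l' /\ j = j') ->
  measurable_fun setT h -> (forall x, 0 <= h x) ->
  mxmeasurable Q -> (forall x, (Q x)^T = Q x) -> (forall j, mxmeasurable (w j)) ->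
  (forall l j, l \in ls -> j \in s -> free_of h (c l j)) ->
  (forall l j, l \in ls -> j \in s -> free_of Q (c l j)) ->
  (forall l j j', l \in ls -> j \in s -> j' \in s -> free_of (w j) (c l j')) ->
  (forall x, gpos (Q x) (w^~ x) s) ->
  (E (fun x => h x * \prod_(l <- ls)
        expR (- bform (Q x) (\sum_(j <- s) x (c l j) *: w j x)
                            (\sum_(j <- s) x (c l j) *: w j x)))
   <= E (fun x => h x * gdet (Q x) (w^~ x) s ^+ size ls))%E.
Proof.
move=> uls us cinj mh h0 mQ Qs mw + Qf wf pos.
have mD : measurable_fun setT (fun x => gdet (Q x) (w^~ x) s) by exact: measurable_gdet.
pose Y l (x : points I R) := \sum_(j <- s) x (c l j) *: w j x.
pose F l (x : points I R) := expR (- bform (Q x) (Y l x) (Y l x)).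
have mF l : measurable_fun setT (F l).
  apply: measurable_expR_comp; apply: measurable_funN.
  by apply: measurable_bform => //; exact: mxmeasurable_lincomb.
have mP ls' : measurable_fun setT (fun x => \prod_(l <- ls') F l x).
  exact: measurable_prod.
elim: ls uls cinj h mh h0 Qf wf => [|l ls IH] /=.
  move=> _ _ h mh h0 *; apply: expect_le => //.
  - by apply: measurable_funM => //; exact: mP [::].
  - by move=> x; rewrite big_nil mulr1.
  - by apply: measurable_funM => //; exact: measurable_cst.
  - by move=> x; rewrite big_nil expr0.
move=> /andP[lls uls] cinj h mh h0 Qf wf hf.
have inl l' : l' \in ls -> l' \in l :: ls by rewrite inE => ->; rewrite orbT.
have Ff l' j : l' \in ls -> j \in s -> free_of (F l') (c l j).
  move=> l's js x t; rewrite /F Qf ?mem_head//.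
  suff -> : Y l' (setc x (c l j) t) = Y l' x by [].
  apply: eq_big_seq => j' j's; rewrite wf ?mem_head//; congr (_ *: _).
  rewrite /setc; case: eqP => // /cinj; rewrite mem_head inl// => /(_ isT isT j's js)[e _].
  by rewrite -e l's in lls.
apply: (@le_trans _ _ (E (fun x => (h x * \prod_(l <- ls) F l x) * gdet (Q x) (w^~ x) s))).
  apply: le_trans (elim_quad (c := c l) _ _ _ mQ Qs mw _ _ _ pos).
  - apply: expect_le => //.
    + by apply: measurable_funM => //; exact: mP (l :: ls).
    + by move=> x; rewrite mulr_ge0// prodr_ge0// => *; exact: expR_ge0.
    + exact: (measurable_funM (measurable_funM mh (mP ls)) (mF l)).
    + by move=> x; rewrite big_cons mulrCA mulrC.
  - rewrite map_inj_in_uniq// => j j' js js' /cinj; rewrite mem_head.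
    by move=> /(_ isT isT js js')[].
  - exact: measurable_funM.
  - by move=> x; rewrite mulr_ge0// prodr_ge0// => *; exact: expR_ge0.
  - move=> j js x t; rewrite hf ?mem_head//; congr (_ * _).
    by apply: eq_big_seq => l' l's; rewrite Ff.
  - by move=> j js; apply: Qf; rewrite ?mem_head.
  - by move=> j j' js j's; apply: wf; rewrite ?mem_head.
apply: le_trans (le_trans (IH uls _ (fun x => h x * gdet (Q x) (w^~ x) s) _ _ _ _ _) _).
- apply: expect_le => //.
  + exact: (measurable_funM (measurable_funM mh (mP ls)) mD).
  + move=> x; rewrite mulr_ge0 ?gdet_ge0// mulr_ge0// prodr_ge0// => *; exact: expR_ge0.
  + exact: (measurable_funM (measurable_funM mh mD) (mP ls)).
  + by move=> x; rewrite mulrAC.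
- by move=> l1 l2 j1 j2 /inl l1s /inl l2s; exact: cinj.
- exact: measurable_funM.
- by move=> x; rewrite mulr_ge0 ?gdet_ge0.
- by move=> l' j /inl l's; exact: Qf.
- by move=> l' j j' /inl l's; exact: wf.
- move=> l' j /inl l's js x t; rewrite hf// Qf//; congr (_ * _).
  by apply: eq_in_gdet => j' j's; rewrite wf.
apply: expect_le => //.
- by apply: measurable_funM; [exact: measurable_funM|exact: measurable_funX].
- by move=> x; rewrite mulr_ge0 ?exprn_ge0 ?gdet_ge0// mulr_ge0// gdet_ge0.
- by apply: measurable_funM => //; exact: measurable_funX.
- by move=> x; rewrite exprS mulrA.
Qed.

End gaussian_elimination.

(** * Semidefinite forms and bounds on Gaussian determinants *)

Section psd_forms.
Context {R : realType}.

Definition nrm2 n (x : 'cV[R]_n) : R := \sum_k x k 0 ^+ 2.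

Lemma nrm2E n (x : 'cV[R]_n) : nrm2 x = (x^T *m x) 0 0.
Proof. by rewrite mxE; apply: eq_bigr => k _; rewrite mxE expr2. Qed.

Lemma nrm2_ge0 n (x : 'cV[R]_n) : 0 <= nrm2 x.
Proof. by apply: sumr_ge0 => k _; exact: sqr_ge0. Qed.

Definition psd_le n (la : R) (Q : 'M[R]_n) :=
  [/\ Q^T = Q, forall x, 0 <= bform Q x x & forall x, bform Q x x <= la * nrm2 x].

Lemma psd_cauchy n (Q : 'M[R]_n) : Q^T = Q -> (forall x, 0 <= bform Q x x) ->
  forall x y, bform Q x y ^+ 2 <= bform Q x x * bform Q y y.
Proof.
move=> Qs Q0 x y.
set a := bform Q x x; set b := bform Q x y; set c := bform Q y y.
have H t : 0 <= a + 2 * t * b + t ^+ 2 * c.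
  have := Q0 (x + t *: y).
  rewrite bformDl !bformDr !bformZl !bformZr (bformC y x)// -/a -/b -/c.
  by rewrite (_ : _ + _ = a + 2 * t * b + t ^+ 2 * c)//; ring.
have a0 : 0 <= a by exact: Q0.
have := Q0 y; rewrite -/c le_eqVlt => /orP[/eqP c0|c0].
  have [->|b0] := eqVneq b 0; first by rewrite expr0n -c0 mulr0.
  (* For [c = 0] the polynomial in [t] is affine, and it takes the value -1 at this point. *)
  have := H (- (a + 1) / (2 * b)).
  rewrite -c0 mulr0 addr0 (_ : _ + _ = - 1); last by field.
  by rewrite oppr_ge0 ler10.
have := H (- b / c); rewrite (_ : _ + _ = (a * c - b ^+ 2) / c); last by field; rewrite gt_eqF.
by rewrite pmulr_lge0 ?invr_gt0// subr_ge0.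
Qed.

Lemma psd_le_ge0 n la (Q : 'M[R]_n) x : psd_le la Q -> 0 <= bform Q x x.
Proof. by case. Qed.

(** By Cauchy-Schwarz the rank-one correction is at most [2 q / (1 + 2 q)] times the value at [x],
    where [q] is the value at [w]; being nonnegative, it can only lower the form. *)
Lemma psd_gupdate n la (Q : 'M[R]_n) w : psd_le la Q -> psd_le la (gupdate Q w).
Proof.
case=> Qs Q0 Qla; have q0 := Q0 w.
have d0 : 0 < 1 + 2 * bform Q w w by lra.
split=> [|x|x]; first exact: gupdate_sym.
- rewrite bform_gupdate (bformC w x)// -expr2 subr_ge0 mulrAC ler_pdivrMr//.
  have := psd_cauchy Qs Q0 x w; have := Q0 x; nra.
- rewrite bform_gupdate (bformC w x)// -expr2; apply: le_trans (Qla x).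
  by rewrite gerBl mulr_ge0 ?sqr_ge0// divr_ge0// ltW.
Qed.

Lemma gpos_psd n la J (Q : 'M[R]_n) (w : J -> 'cV[R]_n) s :
  psd_le la Q -> gpos Q w s.
Proof.
elim: s Q => //= j s IH Q Qp; rewrite IH ?andbT; last exact: psd_gupdate.
by have := psd_le_ge0 (w j) Qp; lra.
Qed.

Lemma bform_mulmx n (Q : 'M[R]_n) x : Q^T = Q -> bform Q x (Q *m x) = nrm2 (Q *m x).
Proof. by move=> Qs; rewrite nrm2E /bform trmx_mul Qs. Qed.

(** In operator terms [Q^2 <= la Q]: Cauchy-Schwarz for the form at [x] and [Q x], divided by
    [|Q x|^2]. *)
Lemma nrm2_mulmx_le n la (Q : 'M[R]_n) x : psd_le la Q ->
  nrm2 (Q *m x) <= la * bform Q x x.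
Proof.
move=> [Qs Q0 Qla]; have := psd_cauchy Qs Q0 x (Q *m x).
have := Qla (Q *m x); have := Q0 x; rewrite bform_mulmx//.
have := nrm2_ge0 (Q *m x); rewrite le_eqVlt => /orP[/eqP <-|n0] h1 h2 h3.
  have [->|/eqP b0] := eqVneq (bform Q x x) 0; first by rewrite mulr0.
  rewrite mulr_ge0//.
  have := Qla x; have := nrm2_ge0 x; nra.
rewrite -(ler_pM2l n0) -expr2 (le_trans h3)//.
rewrite mulrC [leRHS]mulrCA (mulrA la); rewrite [leRHS]mulrC.
by rewrite mulrC ler_wpM2l.
Qed.

(** After squaring, this is [1 - u <= exp (- u)] at [u = 2 x / (1 + 2 x)], since
    [1 - u = 1 / (1 + 2 x)]. *)
Lemma inv_sqrt_le (x : R) : 0 <= x -> (Num.sqrt (1 + 2 * x))^-1 <= expR (- (x / (1 + 2 * x))).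
Proof.
move=> x0; have d0 : 0 < 1 + 2 * x by lra.
rewrite -(ler_pXn2r (n := 2))// ?nnegrE ?expR_ge0 ?invr_ge0 ?sqrtr_ge0//.
rewrite exprVn sqr_sqrtr; last exact: ltW.
rewrite -expRM_natl.
apply: le_trans (expR_ge1Dx _).
by rewrite le_eqVlt; apply/orP; left; apply/eqP; field; rewrite gt_eqF.
Qed.

Definition ebase n (k : 'I_n) : 'cV[R]_n := delta_mx k 0.

Lemma mulmx_ebase n p (Q : 'M[R]_(p, n)) k i : (Q *m ebase k) i 0 = Q i k.
Proof. by rewrite -colE mxE. Qed.

Lemma bform_ebaser n (Q : 'M[R]_n) x k : bform Q x (ebase k) = (x^T *m Q) 0 k.
Proof. by rewrite /bform mulmx_ebase. Qed.

Lemma bform_ebase n (Q : 'M[R]_n) i k : bform Q (ebase i) (ebase k) = Q i k.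
Proof. by rewrite bform_ebaser /ebase trmx_delta -rowE mxE. Qed.

Lemma nrm2_ebase n (k : 'I_n) : nrm2 (ebase k) = 1.
Proof.
rewrite /nrm2 (bigD1 k)//= big1 => [|i ik]; rewrite !mxE ?eqxx ?andbT ?(negbTE ik)//=.
  by rewrite expr1n addr0.
by rewrite expr0n.
Qed.

Lemma gupdate_ebase n (Q : 'M[R]_n) k i : Q^T = Q ->
  gupdate Q (ebase k) i i = Q i i - 2 / (1 + 2 * Q k k) * Q i k ^+ 2.
Proof.
move=> Qs; rewrite -bform_ebase bform_gupdate !bform_ebase expr2.
by rewrite [_ k i](_ : _ = Q i k)// -[in LHS]Qs mxE.
Qed.

(** Put [c = 1 + 2 la]. Eliminating a pivot [p] gains [p / c] in the exponent and lowers the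
    remaining trace by at most [2 la p]; the balance [p / c - 2 la p / c^2] is exactly [p / c^2]. *)
Lemma gdet_ebase_le n la (Q : 'M[R]_n) s : 0 <= la -> psd_le la Q -> uniq s ->
  gdet Q (@ebase n) s <= expR (- ((\sum_(k <- s) Q k k) / (1 + 2 * la) ^+ 2)).
Proof.
move=> la0; elim: s Q => [|k s IH] Q Qp /=.
  by rewrite big_nil mul0r oppr0 expR0.
move=> /andP[ks us].
have [Qs Q0 Qla] := Qp.
set c := 1 + 2 * la; have c0 : 0 < c by rewrite /c; lra.
rewrite bform_ebase; set p := Q k k.
have p0 : 0 <= p by rewrite /p -bform_ebase.
have pla : p <= la by rewrite /p -bform_ebase; have := Qla (ebase k); rewrite nrm2_ebase mulr1.
have d0 : 0 < 1 + 2 * p by lra.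
apply: (@le_trans _ _ (expR (- (p / (1 + 2 * p))) * expR (- ((\sum_(i <- s) gupdate Q (ebase k) i i) / c ^+ 2)))).
  apply: ler_pM => //; rewrite ?invr_ge0 ?sqrtr_ge0 ?gdet_ge0//.
    exact: inv_sqrt_le.
  by apply: IH => //; exact: psd_gupdate.
rewrite -expRD ler_expR -opprD lerN2 big_cons -/p.
have H1 : \sum_(i <- s) Q i k ^+ 2 <= la * p.
  have := nrm2_mulmx_le (ebase k) Qp; rewrite bform_ebase -/p; apply: le_trans.
  rewrite /nrm2; under [leRHS]eq_bigr do rewrite mulmx_ebase.
  rewrite big_uniq//= [leRHS](bigID (mem s))/= lerDl.
  by apply: sumr_ge0 => i _; exact: sqr_ge0.
have H2 : \sum_(i <- s) Q i i - 2 * (la * p) <= \sum_(i <- s) gupdate Q (ebase k) i i.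
  rewrite [leRHS](eq_bigr (fun i => Q i i - 2 / (1 + 2 * p) * Q i k ^+ 2)); last first.
    by move=> i _; rewrite gupdate_ebase.
  rewrite sumrB lerD2l lerN2 -mulr_sumr.
  apply: ler_pM => //; first by rewrite divr_ge0// ltW.
    by apply: sumr_ge0 => i _; exact: sqr_ge0.
  by rewrite ler_pdivrMr//; lra.
have H3 : p / c <= p / (1 + 2 * p).
  by rewrite ler_wpM2l// lef_pV2 ?posrE// /c; lra.
apply: (@le_trans _ _ (p / c + (\sum_(i <- s) Q i i - 2 * (la * p)) / c ^+ 2)); last first.
  by apply: lerD => //; rewrite ler_wpM2r// invr_ge0 sqr_ge0.
rewrite le_eqVlt; apply/orP; left; apply/eqP; rewrite /c; field.
by rewrite gt_eqF// -/c.
Qed.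

(** Governs [E exp (Q g)] for a standard Gaussian [g]. Eliminating a pivot [p] inflates the
    remaining trace [S] to at most [S / (1 - 2 p)], and [(1 - 2 p) (1 - 2 S / (1 - 2 p)) = 1 - 2 (p
    + S)]. *)
Lemma gdet_neg_ebase n (Q : 'M[R]_n) s : Q^T = Q -> (forall x, 0 <= bform Q x x) ->
  uniq s -> \sum_(k <- s) Q k k < 2^-1 ->
  gpos (- Q) (@ebase n) s /\
  gdet (- Q) (@ebase n) s <= (Num.sqrt (1 - 2 * \sum_(k <- s) Q k k))^-1.
Proof.
elim: s Q => [|k s IH] Q Qs Q0 /=.
  by move=> _ _; rewrite big_nil mulr0 subr0 sqrtr1 invr1.
move=> /andP[ks us]; rewrite big_cons; set p := Q k k; set S := \sum_(_ <- _) _ => pS.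
have p0 : 0 <= p by rewrite /p -bform_ebase.
have Qii i : 0 <= Q i i by rewrite -bform_ebase.
have S0 : 0 <= S by apply: sumr_ge0.
have bE : bform (- Q) (ebase k) (ebase k) = - p by rewrite bform_ebase mxE.
have d0 : 0 < 1 - 2 * p by lra.
pose Q' := - gupdate (- Q) (ebase k).
have NQs : (- Q)^T = - Q by rewrite linearN/= Qs.
have Q's : Q'^T = Q' by rewrite /Q' linearN/= gupdate_sym.
have bN x y : bform (- Q) x y = - bform Q x y.
  by rewrite -scaleN1r bformZ mulN1r.
have Q'E x : bform Q' x x = bform Q x x + 2 / (1 - 2 * p) * bform Q x (ebase k) ^+ 2.
  rewrite /Q' -scaleN1r bformZ bform_gupdate bE !bN (bformC (ebase k))//.
  by rewrite expr2; field; rewrite gt_eqF.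
have Q'0 x : 0 <= bform Q' x x.
  by rewrite Q'E addr_ge0// mulr_ge0 ?sqr_ge0// divr_ge0// ltW.
pose S' := \sum_(i <- s) Q' i i.
have S'S : S' <= S / (1 - 2 * p).
  rewrite /S' /S mulr_suml; apply: ler_sum => i _.
  rewrite -[leLHS]bform_ebase Q'E !bform_ebase.
  have := psd_cauchy Qs Q0 (ebase i) (ebase k); rewrite !bform_ebase -/p => h.
  rewrite -(ler_pM2r d0) divfK ?gt_eqF// mulrDl mulrAC divfK ?gt_eqF//.
  by have := Qii i; nra.
have S'2 : S' < 2^-1.
  by apply: le_lt_trans S'S _; rewrite ltr_pdivrMr//; lra.
have [IH1 IH2] := IH Q' Q's Q'0 us S'2.
rewrite /Q' opprK in IH1 IH2.
rewrite bE mulrN IH1 d0; split=> //.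
apply: (@le_trans _ _ ((Num.sqrt (1 - 2 * p))^-1 * (Num.sqrt (1 - 2 * S'))^-1)).
  by rewrite ler_wpM2l// invr_ge0 sqrtr_ge0.
rewrite -invfM -sqrtrM; last exact: ltW.
have e0 : 0 < 1 - 2 * (p + S) by lra.
rewrite lef_pV2 ?posrE ?sqrtr_gt0// ?ler_sqrt//.
  by move: S'S; rewrite ler_pdivlMr//; nra.
- by apply: mulr_ge0; [exact: ltW|lra].
- by apply: mulr_gt0 => //; lra.
Qed.

(** The trace lost is [2 |Q w|^2 / (1 + 2 q)] with [q] the value of the form at [w], and
    [|Q w|^2 <= la q]. *)
Lemma mxtrace_gupdate n la (Q : 'M[R]_n) w : psd_le la Q ->
  \tr Q - 2 * la * bform Q w w <= \tr (gupdate Q w).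
Proof.
move=> Qp; have [Qs Q0 Qla] := Qp.
rewrite /gupdate linearB/= lerD2l lerN2 linearZ/= mxtrace_mulC.
have -> : \tr (w^T *m Q *m (Q *m w)) = nrm2 (Q *m w).
  by rewrite nrm2E trmx_mul Qs /mxtrace big_ord1.
move: (nrm2_ge0 (Q *m w)) (nrm2_mulmx_le w Qp) (Q0 w).
set q := bform Q w w; set N := nrm2 _ => n0 h q0.
apply: (@le_trans _ _ (2 * N)); last by lra.
by rewrite ler_wpM2r// ler_pdivrMr; lra.
Qed.

End psd_forms.

Section expectation.
Context d (T : measurableType d) (R : realType) (P : probability T R).
Context (I : finType).
Variable X : T -> points I R.
Hypothesis HX : gaussian_array P X.
Local Notation E f := (expect P X f%R).

Lemma expectD (f g : points I R -> R) :
  measurable_fun setT f -> (forall x, 0 <= f x) ->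
  measurable_fun setT g -> (forall x, 0 <= g x) ->
  (E (fun x => f x + g x)%R = E f + E g)%E.
Proof.
move=> mf f0 mg g0; rewrite /expect -ge0_integralD//.
- by move=> w _; rewrite lee_fin.
- by apply/measurable_EFinP; exact: (measurable_points_fun HX).
- by move=> w _; rewrite lee_fin.
- by apply/measurable_EFinP; exact: (measurable_points_fun HX).
Qed.

Lemma expectZ (c : R) (f : points I R -> R) : 0 <= c ->
  measurable_fun setT f -> (forall x, 0 <= f x) ->
  (E (fun x => c * f x)%R = c%:E * E f)%E.
Proof.
move=> c0 mf f0; rewrite /expect -ge0_integralZl//.
- by apply/measurable_EFinP; exact: (measurable_points_fun HX).
- by move=> w _; rewrite lee_fin.
Qed.

Lemma expect_cst (c : R) : E (fun=> c) = c%:E.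
Proof. by rewrite /expect integral_cst//= probability_setT mule1. Qed.

(** The integral is [exp w / sqrt (1 + 2 w)]. After squaring,
    [exp (4 w^2 - 2 w) >= (1 + 2 w^2 - w)^2] leaves a polynomial inequality that holds for small
    [w]. *)
Lemma integral_gauss_chi (w : R) : `|w| <= 8^-1 ->
  (\int[gauss R]_t (expR (w * (1 - t ^+ 2)))%:E <= (expR (2 * w ^+ 2))%:E)%E.
Proof.
rewrite ler_norml => /andP[w1 w2].
have e t : w * (1 - t ^+ 2) = - w * t ^+ 2 + 0 * t + w by ring.
under eq_integral do rewrite e.
rewrite integral_gauss_quad; last by lra.
rewrite lee_fin expr0n/= mul0r add0r.
have d0 : 0 < 1 + 2 * w by lra.
rewrite [leLHS]mulrC ler_pdivrMr ?sqrtr_gt0//.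
rewrite -(ler_pXn2r (n := 2))// ?nnegrE ?expR_ge0 ?mulr_ge0 ?expR_ge0 ?sqrtr_ge0//.
rewrite exprMn sqr_sqrtr ?(ltW d0)// -!expRM_natl.
rewrite (_ : 2 * (2 * w ^+ 2) = 2%:R * w + (4 * w ^+ 2 - 2 * w)); last by ring.
rewrite expRD -mulrA ler_pMr ?expR_gt0//.
rewrite (_ : 4 * w ^+ 2 - 2 * w = 2%:R * (2 * w ^+ 2 - w)); last by ring.
rewrite expRM_natl.
have u1 := expR_ge1Dx (2 * w ^+ 2 - w).
have u0 : 0 <= 1 + (2 * w ^+ 2 - w) by nra.
apply: (@le_trans _ _ ((1 + (2 * w ^+ 2 - w)) ^+ 2 * (1 + 2 * w))); last first.
  by rewrite ler_wpM2r ?(ltW d0)// ler_pXn2r// nnegrE// ltW// expR_gt0.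
rewrite -subr_ge0 (_ : _ - 1 = w ^+ 2 * (1 + 6 * w - 4 * w ^+ 2 + 8 * w ^+ 3)); last by ring.
rewrite mulr_ge0 ?sqr_ge0//.
have : -(8^-1) <= 4 * w ^+ 2 * (2 * w - 1) by nra.
by rewrite !exprS expr0; lra.
Qed.

Lemma elim_chi (J : eqType) (s : seq J) (c : J -> I) (h : points I R -> R)
    (w : J -> points I R -> R) :
  uniq s -> {in s &, injective c} ->
  measurable_fun setT h -> (forall x, 0 <= h x) ->
  (forall j, measurable_fun setT (w j)) ->
  (forall j x, `|w j x| <= 8^-1) ->
  (forall j, j \in s -> free_of h (c j)) ->
  (forall j j', j \in s -> j' \in s -> free_of (w j) (c j')) ->
  (E (fun x => h x * \prod_(j <- s) expR (w j x * (1 - x (c j) ^+ 2))) <=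
   E (fun x => h x * \prod_(j <- s) expR (2 * w j x ^+ 2)))%E.
Proof.
move=> us cinj mh h0 mw w8 hf wf.
apply: (@elim_prod _ _ _ _ _ _ HX _ s c (fun j x => expR (w j x * (1 - x (c j) ^+ 2)))
  (fun j x => expR (2 * w j x ^+ 2)) h _ mh h0).
- by rewrite map_inj_in_uniq.
- move=> j; apply: measurable_expR_comp; apply: measurable_funM => //.
  by apply: measurable_funB => //; apply: measurable_funX; exact: measurable_coord.
- by move=> j x; exact: expR_ge0.
- move=> j; apply: measurable_expR_comp; apply: measurable_funM => //.
  exact: measurable_funX.
- by move=> j x; exact: expR_ge0.
- exact: hf.
- by move=> j j' js j's x t; rewrite wf.
- move=> j j' js j's jj' x t; rewrite wf//; congr (expR (_ * (1 - _ ^+ 2))).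
  rewrite /setc; case: eqP => // e.
  by move: jj'; rewrite (cinj _ _ js j's e) eqxx.
- move=> j x js; apply: le_trans (integral_gauss_chi (w8 j x)).
  rewrite le_eqVlt; apply/orP; left; apply/eqP; apply: eq_integral => t _.
  by rewrite wf// /setc eqxx.
Qed.

Lemma elim_lin (J : eqType) (s : seq J) (c : J -> I) (h : points I R -> R)
    (w : J -> points I R -> R) :
  uniq s -> {in s &, injective c} ->
  measurable_fun setT h -> (forall x, 0 <= h x) ->
  (forall j, measurable_fun setT (w j)) ->
  (forall j, j \in s -> free_of h (c j)) ->
  (forall j j', j \in s -> j' \in s -> free_of (w j) (c j')) ->
  (E (fun x => h x * \prod_(j <- s) expR (w j x * x (c j))) <=
   E (fun x => h x * \prod_(j <- s) expR (w j x ^+ 2 / 2)))%E.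
Proof.
move=> us cinj mh h0 mw hf wf.
apply: (@elim_prod _ _ _ _ _ _ HX _ s c (fun j x => expR (w j x * x (c j)))
  (fun j x => expR (w j x ^+ 2 / 2)) h _ mh h0).
- by rewrite map_inj_in_uniq.
- move=> j; apply: measurable_expR_comp; apply: measurable_funM => //.
  exact: measurable_coord.
- by move=> j x; exact: expR_ge0.
- move=> j; apply: measurable_expR_comp; apply: measurable_funM => //.
  exact: measurable_funX.
- by move=> j x; exact: expR_ge0.
- exact: hf.
- by move=> j j' js j's x t; rewrite wf.
- move=> j j' js j's jj' x t; rewrite wf//; congr (expR (_ * _)).
  rewrite /setc; case: eqP => // e.
  by move: jj'; rewrite (cinj _ _ js j's e) eqxx.
- move=> j x js.
  have e t : w j (setc x (c j) t) * setc x (c j) t (c j) = - 0 * t ^+ 2 + w j x * t + 0.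
    by rewrite wf// /setc eqxx; ring.
  under eq_integral do rewrite e.
  rewrite integral_gauss_quad; last by lra.
  by rewrite mulr0 addr0 sqrtr1 invr1 mul1r addr0 mulr1.
Qed.

End expectation.

(** * Small-ball and tail estimates *)

Section gram_lower_tail.
Context d (T : measurableType d) (R : realType) (P : probability T R).
Context (I : finType).
Variable X : T -> points I R.
Hypothesis HX : gaussian_array P X.
Local Notation E f := (expect P X f%R).
Variables (m n : nat).

Definition gvec (ia : 'I_m -> 'I_n -> I) i (x : points I R) : 'cV[R]_n :=
  \col_k x (ia i k).

Lemma gvecE ia i x : gvec ia i x = \sum_(k <- enum 'I_n) x (ia i k) *: ebase k.
Proof.
apply/colP => j; rewrite big_enum/= summxE mxE (bigD1 j)//= big1 ?addr0.
  by rewrite !mxE !eqxx mulr1.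
by move=> k kj; rewrite !mxE eq_sym (negbTE kj) mulr0.
Qed.

Lemma gvec_free ia i c : (forall k, ia i k != c) -> free_of (gvec ia i) c.
Proof.
move=> h x t; apply/colP => k; rewrite !mxE /setc.
by rewrite (negbTE (h k)).
Qed.

Lemma mxmeasurable_gvec ia i : mxmeasurable (gvec ia i).
Proof.
move=> k l; rewrite (_ : (fun x => _) = fun x : points I R => x (ia i k)).
  exact: measurable_coord.
by apply/funext => x; rewrite mxE.
Qed.

Variables ia ib : 'I_m -> 'I_n -> I.
Hypothesis ia_inj : forall i i' k k', ia i k = ia i' k' -> i = i' /\ k = k'.
Hypothesis ib_inj : forall i i' k k', ib i k = ib i' k' -> i = i' /\ k = k'.
Hypothesis ia_ib : forall i i' k k', ia i k != ib i' k'.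

Lemma ia_neq i i' k k' : i' != i -> ia i k != ia i' k'.
Proof. by apply: contraNneq => /ia_inj[->]. Qed.

(** An indicator multiplied into the integrand rather than an event conditioned upon: it involves a
    single row, so rows can still be integrated one at a time. *)
Definition shortv i (x : points I R) : R :=
  if nrm2 (gvec ia i x) <= 2 * n%:R then 1 else 0.

Lemma shortv_ge0 i x : 0 <= shortv i x.
Proof. by rewrite /shortv; case: ifP. Qed.

Lemma measurable_nrm2 p d' (T' : measurableType d') (f : T' -> 'cV[R]_p) :
  mxmeasurable f -> measurable_fun setT (fun x => nrm2 (f x)).
Proof. by move=> mf; apply: measurable_sum => k; apply: measurable_funX; exact: mf. Qed.

Lemma measurable_shortv i : measurable_fun setT (shortv i).
Proof.
apply: measurable_fun_ifT => //; apply: measurable_fun_ler => //.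
by apply: measurable_nrm2; exact: mxmeasurable_gvec.
Qed.

Lemma shortv_free i i' k : i != i' -> free_of (shortv i) (ia i' k).
Proof.
move=> ii' x t; rewrite /shortv gvec_free// => k'.
by apply: ia_neq; rewrite eq_sym.
Qed.

Variables (q : 'I_m -> R) (la be2 : R) (U : {set 'I_m}).
Hypothesis la0 : 0 < la.
Hypothesis Ube : forall i, i \in U -> q i ^+ 2 <= be2.
Hypothesis labe : la * be2 * n%:R <= 1.

Let w i (x : points I R) : 'cV[R]_n := q i *: gvec ia i x.

Let mw i : mxmeasurable (w i).
Proof. by apply: mxmeasurableZ => //; exact: mxmeasurable_gvec. Qed.

(** Let [Y] be [q i ^+ 2] times the form at row [i]. Shortness and [labe] give [Y <= 2], so the
    denominator [1 + 2 Y] in [inv_sqrt_le] is at most 5. The [n]-th power stands for the [n]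
    columns. *)
Lemma inv_sqrt_gdet_le (Q : 'M[R]_n) x i : psd_le la Q -> i \in U ->
  (Num.sqrt (1 + 2 * bform Q (w i x) (w i x)))^-1 ^+ n * shortv i x <=
  expR (- bform ((n%:R * q i ^+ 2 / 5) *: Q) (gvec ia i x) (gvec ia i x)).
Proof.
move=> Qp iU; rewrite /shortv; case: ifP => [sh|_]; last by rewrite mulr0 expR_ge0.
rewrite mulr1 /w bformZl bformZr bformZ.
set B := bform Q _ _.
have B0 : 0 <= B by exact: psd_le_ge0 Qp.
have q0 : 0 <= q i ^+ 2 by exact: sqr_ge0.
have BX : B <= la * (2 * n%:R).
  case: Qp => _ _ Qla; apply: le_trans (Qla _) _.
  by rewrite ler_wpM2l// ltW.
have X2 : q i ^+ 2 * B <= 2.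
  have : q i ^+ 2 * B <= be2 * (la * (2 * n%:R)).
    by apply: ler_pM => //; exact: Ube.
  by move: labe; lra.
have -> : q i * (q i * B) = q i ^+ 2 * B by ring.
set Y := q i ^+ 2 * B in X2 *.
have Y0 : 0 <= Y by exact: mulr_ge0.
apply: (@le_trans _ _ (expR (- (Y / (1 + 2 * Y))) ^+ n)).
  rewrite lerXn2r ?nnegrE ?invr_ge0 ?sqrtr_ge0 ?expR_ge0//.
  exact: inv_sqrt_le.
rewrite -expRM_natl ler_expR mulrN lerN2.
rewrite (_ : _ * B = n%:R * (Y / 5)); last by rewrite /Y; ring.
rewrite ler_wpM2l// ler_wpM2l// lef_pV2 ?posrE; lra.
Qed.

(** Peels the rows off the determinant: the tail is integrated first with row [i] frozen, then row
    [i]. The trace hypothesis is a budget: updating by a short row costs at most [4 la^2 n q_i^2],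
    so a trace of [la n / 2] is always left. Rows outside [U] are bounded by 1. *)
Lemma elim_rows s (h : points I R -> R) (Q : points I R -> 'M[R]_n) :
  uniq s -> measurable_fun setT h -> (forall x, 0 <= h x) ->
  mxmeasurable Q -> (forall x, psd_le la (Q x)) ->
  (forall i k, i \in s -> free_of h (ia i k)) ->
  (forall i k, i \in s -> free_of Q (ia i k)) ->
  (forall x, 0 < h x ->
    la * n%:R / 2 + 4 * la ^+ 2 * n%:R * \sum_(i <- s) q i ^+ 2 <= \tr (Q x)) ->
  (E (fun x => h x * (\prod_(i <- s) shortv i x) * gdet (Q x) (w^~ x) s ^+ n) <=
   E (fun x => expR (- (la * n%:R ^+ 2 / 20 * \sum_(i <- s | i \in U) q i ^+ 2)) * h x))%E.
Proof.
have la00 : 0 <= la by exact: ltW.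
have mprod s' : measurable_fun setT (fun x => \prod_(i <- s') shortv i x).
  by apply: measurable_prod => i _; exact: measurable_shortv.
elim: s h Q => [|i s IH] h Q /=.
  move=> _ mh h0 *; apply: (expect_le HX).
  - apply: measurable_funM; last by apply: measurable_funX; exact: measurable_cst.
    by apply: measurable_funM => //; exact: mprod.
  - by move=> x; rewrite big_nil mulr1 expr1n mulr1.
  - exact: measurable_funM.
  - by move=> x; rewrite !big_nil mulr0 oppr0 expR0 expr1n !mulr1 mul1r.
move=> /andP[nis us] mh h0 mQ Qp hf Qf htr.
have ins j : j \in s -> j \in i :: s by rewrite inE => ->; rewrite orbT.
have Qs x : (Q x)^T = Q x by case: (Qp x).
pose q2 x := bform (Q x) (w i x) (w i x).
have mq2 : measurable_fun setT q2 by exact: measurable_bform.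
pose r x := (Num.sqrt (1 + 2 * q2 x))^-1.
have mr : measurable_fun setT r.
  apply: measurable_inv; apply: measurable_sqrt.
  by apply: measurable_funD => //; exact: measurable_funM.
have r0 x : 0 <= r x by rewrite invr_ge0 sqrtr_ge0.
have q20 x : 0 <= q2 x by exact: psd_le_ge0 (Qp x).
have r1 x : r x <= 1.
  rewrite invf_le1 ?sqrtr_gt0; last by have := q20 x; lra.
  by rewrite -[leLHS]sqrtr1 ler_sqrt; have := q20 x; lra.
pose h' x := h x * (r x ^+ n * shortv i x).
have mh' : measurable_fun setT h'.
  apply: measurable_funM => //; apply: measurable_funM; last exact: measurable_shortv.
  exact: measurable_funX.
have h'0 x : 0 <= h' x by rewrite !mulr_ge0 ?exprn_ge0 ?shortv_ge0.
pose Q' x := gupdate (Q x) (w i x).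
have mQ' : mxmeasurable Q' by apply: mxmeasurable_gupdate.
have wif j k : j \in s -> free_of (w i) (ia j k).
  move=> js x t; rewrite /w gvec_free// => k'; apply: ia_neq.
  by apply: contraNneq nis => <-.
set C := expR (- (la * n%:R ^+ 2 / 20 * \sum_(i <- s | i \in U) q i ^+ 2)).
apply: (@le_trans _ _ (E (fun x => C * h' x))).
  apply: le_trans (IH h' Q' us mh' h'0 mQ' _ _ _ _).
  - apply: (expect_le HX).
    + apply: measurable_funM; first by apply: measurable_funM => //; exact: mprod.
      apply: measurable_funX; apply: measurable_funM => //; exact: measurable_gdet.
    + move=> x; rewrite !mulr_ge0 ?prodr_ge0 ?exprn_ge0// => [? _|]; first exact: shortv_ge0.
      by rewrite mulr_ge0 ?gdet_ge0//; exact: r0.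
    + apply: measurable_funM; first by apply: measurable_funM => //; exact: mprod.
      by apply: measurable_funX; exact: measurable_gdet.
    + move=> x; rewrite big_cons exprMn -/(q2 x) -/(r x) /h' -/(Q' x).
      by rewrite le_eqVlt; apply/orP; left; apply/eqP; ring.
  - by move=> x; exact: psd_gupdate.
  - move=> j k js x t; rewrite /h' /r /q2 hf ?ins// Qf ?ins// wif//.
    by rewrite shortv_free//; apply: contraNneq nis => ->.
  - by move=> j k js x t; rewrite /Q' Qf ?ins// wif.
  - move=> x; rewrite /h' => hx.
    have hx0 : 0 < h x.
      by rewrite lt_def h0 andbT; apply: contraTneq hx => ->; rewrite mul0r ltxx.
    have sx : nrm2 (gvec ia i x) <= 2 * n%:R.
      by move: hx; rewrite /shortv; case: ifP => //; rewrite !mulr0 ltxx.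
    have := htr x hx0; rewrite big_cons.
    have := mxtrace_gupdate (w i x) (Qp x).
    have [_ _ /(_ (w i x))] := Qp x.
    rewrite -/(Q' x) -/(q2 x) /w.
    have -> : nrm2 (q i *: gvec ia i x) = q i ^+ 2 * nrm2 (gvec ia i x).
      by rewrite /nrm2 mulr_sumr; apply: eq_bigr => k _; rewrite !mxE exprMn.
    set N := nrm2 _ in sx *; set S := \sum_(j <- s) _; set t := \tr (Q x); set t' := \tr (Q' x).
    move=> h1 h2 h3.
    have h4 : q2 x <= la * (q i ^+ 2 * (2 * n%:R)).
      by apply: le_trans h1 _; rewrite ler_wpM2l// ler_wpM2l// sqr_ge0.
    have h5 : 2 * la * q2 x <= 2 * la * (la * (q i ^+ 2 * (2 * n%:R))).
      by rewrite ler_wpM2l// mulr_ge0.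
    by move: h2 h3 h5; rewrite expr2; lra.
rewrite big_cons; case: ifPn => iU; last first.
  apply: (expect_le HX).
  - exact: measurable_funM.
  - by move=> x; rewrite mulr_ge0 ?expR_ge0.
  - exact: measurable_funM.
  - move=> x; rewrite ler_wpM2l ?expR_ge0// /h' ler_piMr//.
    rewrite mulr_ile1 ?exprn_ge0 ?shortv_ge0 ?exprn_ile1//.
    by rewrite /shortv; case: ifP.
(* Row [i] now faces the form [th Q], of norm at most 1/5 by [labe]. As [(1 + 2/5)^2 <= 2], its
   integral is at most [exp (- th tr Q / 2)], and [tr Q >= la n / 2] gives the exponent
   [la n^2 q_i^2 / 20]. *)
pose th := n%:R * q i ^+ 2 / 5.
have th0 : 0 <= th by rewrite divr_ge0// mulr_ge0// sqr_ge0.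
have thla : th * la <= 5^-1.
  have : q i ^+ 2 * (la * n%:R) <= be2 * (la * n%:R).
    by rewrite ler_wpM2r ?mulr_ge0//; exact: Ube.
  by move: labe; rewrite /th; lra.
have Qtp x : psd_le 5^-1 (th *: Q x).
  have [_ Q0 Qla] := Qp x; split=> [|y|y].
  - by rewrite linearZ/= Qs.
  - by rewrite bformZ mulr_ge0.
  - rewrite bformZ; apply: (@le_trans _ _ (th * (la * nrm2 y))).
      by rewrite ler_wpM2l.
    by rewrite mulrA ler_wpM2r// nrm2_ge0.
apply: (@le_trans _ _ (E (fun x => C * h x * expR (- bform (th *: Q x)
     (\sum_(k <- enum 'I_n) x (ia i k) *: ebase k) (\sum_(k <- enum 'I_n) x (ia i k) *: ebase k))))).
  apply: (expect_le HX).
  - exact: measurable_funM.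
  - by move=> x; rewrite mulr_ge0 ?expR_ge0.
  - apply: measurable_funM; first exact: measurable_funM.
    apply: measurable_expR_comp; apply: measurable_funN.
    have me : mxmeasurable (fun x : points I R => \sum_(k <- enum 'I_n) x (ia i k) *: @ebase R _ k).
      by apply: mxmeasurable_lincomb => k; exact: mxmeasurable_cst.
    by apply: measurable_bform => //; exact: mxmeasurableZ.
  - move=> x; rewrite /h' -(gvecE ia i x) mulrA ler_wpM2l ?mulr_ge0 ?expR_ge0//.
    exact: inv_sqrt_gdet_le.
apply: le_trans (elim_quad HX (c := ia i) (w := fun k _ => ebase k) _ _ _ _ _ _ _ _ _ _) _.
- by rewrite map_inj_in_uniq ?enum_uniq// => k k' _ _ /ia_inj[].
- exact: measurable_funM.
- by move=> x; rewrite mulr_ge0 ?expR_ge0.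
- exact: mxmeasurableZ.
- by move=> x; rewrite linearZ/= Qs.
- by move=> k; exact: mxmeasurable_cst.
- by move=> k _ x t; rewrite hf ?mem_head.
- by move=> k _ x t; rewrite Qf ?mem_head.
- by [].
- by move=> x; exact: gpos_psd (Qtp x).
apply: (expect_le HX).
- apply: measurable_funM; first exact: measurable_funM.
  apply: measurable_gdet; first exact: mxmeasurableZ.
  by move=> k; exact: mxmeasurable_cst.
- by move=> x; rewrite mulr_ge0 ?gdet_ge0// mulr_ge0 ?expR_ge0.
- exact: measurable_funM.
move=> x; have := h0 x; rewrite le_eqVlt => /orP[/eqP <-|hx].
  by rewrite !mulr0 mul0r.
rewrite mulrAC ler_wpM2r//.
have := gdet_ebase_le _ (Qtp x) (enum_uniq 'I_n); rewrite -[in 5^-1]/(5^-1).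
move=> /(_ ltac:(lra)) hg.
apply: le_trans (ler_wpM2l (expR_ge0 _) hg) _.
rewrite -expRD ler_expR -opprD lerN2 mulrDr [leRHS]addrC lerD2r.
rewrite big_enum/= -/(\tr _) linearZ/=.
have := htr x hx; rewrite big_cons.
have S0 : 0 <= \sum_(j <- s) q j ^+ 2 by apply: sumr_ge0 => j _; exact: sqr_ge0.
set S := \sum_(j <- s) _ in S0 *; set t := \tr _ => ht.
have t1 : la * n%:R / 2 <= t.
  apply: le_trans ht; rewrite lerDl mulr_ge0 ?addr_ge0 ?sqr_ge0//.
  by rewrite !mulr_ge0 ?sqr_ge0.
have : th * (la * n%:R / 2) <= th * t by rewrite ler_wpM2l.
have tt0 : 0 <= th * t by rewrite mulr_ge0// (le_trans _ t1)// divr_ge0// mulr_ge0.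
rewrite /th.
set z := _ * t in tt0 *.
move=> hz; apply: (@le_trans _ _ (z / 2)); first by move: hz; lra.
by rewrite ler_wpM2l// lef_pV2 ?posrE; lra.
Qed.

(** Column [l] of [sum_i q_i a_i b_i^T] is a combination of the [q_i a_i] with Gaussian coefficients
    [b_il]: integrating these with [elim_quad_copies] produces the determinant that [elim_rows]
    bounds, and [160 = 20 * 8]. *)
Lemma gram_lower_tail : la <= 24^-1 -> \sum_i q i ^+ 2 <= 3 ->
  8^-1 <= \sum_(i in U) q i ^+ 2 ->
  (E (fun x => (\prod_(i <- enum 'I_m) shortv i x) *
      expR (- (la * \sum_l nrm2 (\sum_i (q i * x (ib i l)) *: gvec ia i x))))
   <= (expR (- (la * n%:R ^+ 2 / 160)))%:E)%E.
Proof.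
move=> la24 q3 qU.
have la00 : 0 <= la by exact: ltW.
have mprod : measurable_fun setT (fun x => \prod_(i <- enum 'I_m) shortv i x).
  by apply: measurable_prod => i _; exact: measurable_shortv.
have bla y : bform (la%:M : 'M[R]_n) y y = la * nrm2 y.
  by rewrite /bform mul_mx_scalar -scalemxAl mxE nrm2E.
have lap : psd_le la (la%:M : 'M[R]_n).
  split=> [|y|y]; first by rewrite tr_scalar_mx.
  - by rewrite bla mulr_ge0// nrm2_ge0.
  - by rewrite bla.
have sumE x l : \sum_i (q i * x (ib i l)) *: gvec ia i x =
    \sum_(i <- enum 'I_m) x (ib i l) *: w i x.
  by rewrite big_enum/=; apply: eq_bigr => i _; rewrite /w scalerA mulrC.
apply: (@le_trans _ _ (E (fun x => (\prod_(i <- enum 'I_m) shortv i x) *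
   gdet (la%:M) (w^~ x) (enum 'I_m) ^+ n))).
  have hinj (l l' : 'I_n) (j j' : 'I_m) : l \in enum 'I_n -> l' \in enum 'I_n ->
    j \in enum 'I_m -> j' \in enum 'I_m -> ib j l = ib j' l' -> l = l' /\ j = j'.
    by move=> _ _ _ _ /ib_inj[].
  have h0 x : 0 <= \prod_(i <- enum 'I_m) shortv i x.
    by rewrite prodr_ge0// => ? _; exact: shortv_ge0.
  have hf (l : 'I_n) (j : 'I_m) : l \in enum 'I_n -> j \in enum 'I_m ->
    free_of (fun x => \prod_(i <- enum 'I_m) shortv i x) (ib j l).
    move=> _ _ x t; apply: eq_bigr => i _; rewrite /shortv gvec_free// => k.
  have wf (l : 'I_n) (j j' : 'I_m) : l \in enum 'I_n -> j \in enum 'I_m ->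
    j' \in enum 'I_m -> free_of (w j) (ib j' l).
    by move=> _ _ _ x t; rewrite /w gvec_free.
  have := elim_quad_copies HX (L := 'I_n) (ls := enum 'I_n) (s := enum 'I_m)
    (c := fun l i => ib i l) (h := fun x => \prod_(i <- enum 'I_m) shortv i x)
    (Q := fun=> la%:M) (w := w) (enum_uniq _) (enum_uniq _) hinj mprod h0
    (mxmeasurable_cst _) (fun=> tr_scalar_mx _ _) mw hf (fun _ _ _ _ _ _ => erefl)
    wf (fun x => gpos_psd _ _ lap).
  rewrite size_enum_ord => H; apply: le_trans H.
  - apply: (expect_le HX).
    + apply: measurable_funM => //; apply: measurable_expR_comp; apply: measurable_funN.
      apply: measurable_funM => //; apply: measurable_sum => l; apply: measurable_nrm2.
      apply: mxmeasurable_sum => i; apply: mxmeasurableZ; last exact: mxmeasurable_gvec.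
      by apply: measurable_funM => //; exact: measurable_coord.
    + move=> x; rewrite mulr_ge0 ?expR_ge0// prodr_ge0// => *; exact: shortv_ge0.
    + apply: measurable_funM => //; apply: measurable_prod => l _.
      apply: measurable_expR_comp; apply: measurable_funN.
      by apply: measurable_bform; [exact: mxmeasurable_cst|exact: mxmeasurable_lincomb..].
    + move=> x; rewrite ler_wpM2l ?prodr_ge0// => [? _|]; first exact: shortv_ge0.
      rewrite -expR_sum ler_expR big_enum/= sumrN lerN2 mulr_sumr.
      rewrite le_eqVlt; apply/orP; left; apply/eqP; apply: eq_bigr => l _.
      by rewrite bla sumE.
have := elim_rows (h := fun=> 1) (Q := fun=> la%:M) (enum_uniq 'I_m) _ _ _ (fun=> lap) _ _ _.
move=> H; apply: le_trans (le_trans (H _ _ _ _ _ _) _).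
- apply: (expect_le HX).
  + apply: measurable_funM => //; apply: measurable_funX.
    by apply: measurable_gdet => //; exact: mxmeasurable_cst.
  + move=> x; rewrite mulr_ge0 ?exprn_ge0 ?gdet_ge0// prodr_ge0// => *; exact: shortv_ge0.
  + apply: measurable_funM; first by apply: measurable_funM => //; exact: measurable_cst.
    by apply: measurable_funX; apply: measurable_gdet => //; exact: mxmeasurable_cst.
  + by move=> x; rewrite mul1r.
- exact: measurable_cst.
- by [].
- exact: mxmeasurable_cst.
- by [].
- by [].
(* The initial trace [la n] covers the whole budget because [12 la <= 1/2]. *)
- move=> x _; clear H; rewrite mxtrace_scalar big_enum/= -mulr_natr.
  set S := \sum_i _ in q3 *.
  have n0 : 0 <= n%:R :> R by [].
  have : la ^+ 2 * n%:R * S <= la * n%:R * (24^-1 * 3).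
    rewrite expr2 -!mulrA ler_wpM2l// mulrCA ler_wpM2l// ler_pM//.
    by apply: sumr_ge0 => j _; exact: sqr_ge0.
  by rewrite -[4 * _ * _ * _]mulrA -[4 * _ * _]mulrA; lra.
rewrite (_ : (fun x => _) = fun=> expR (- (la * n%:R ^+ 2 / 20 *
  \sum_(i <- enum 'I_m | i \in U) q i ^+ 2))); last by apply/funext => x; rewrite mulr1.
rewrite expect_cst lee_fin ler_expR lerN2 big_enum_cond/=.
have -> : la * n%:R ^+ 2 / 160 = la * n%:R ^+ 2 / 20 * 8^-1 by field.
rewrite ler_wpM2l// divr_ge0// mulr_ge0// sqr_ge0.
Qed.

End gram_lower_tail.

(** * Exponential moments of truncated squares of bilinear forms *)

Section bilinear_tails.
Context d (T : measurableType d) (R : realType) (P : probability T R).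
Context (I : finType).
Variable X : T -> points I R.
Hypothesis HX : gaussian_array P X.
Local Notation E f := (expect P X f%R).
Variables (m n : nat).

Definition fro2 p q (N : 'M[R]_(p, q)) : R := \sum_k \sum_l N k l ^+ 2.

Lemma fro2_ge0 p q (N : 'M[R]_(p, q)) : 0 <= fro2 N.
Proof. by apply: sumr_ge0 => k _; apply: sumr_ge0 => l _; exact: sqr_ge0. Qed.

Lemma bformNl k (Q : 'M[R]_k) x y : bform (- Q) x y = - bform Q x y.
Proof. by rewrite -scaleN1r bformZ mulN1r. Qed.

Lemma expR_ge_sqr (z : R) : 0 <= z -> z ^+ 2 <= expR z.
Proof.
move=> z0; rewrite (_ : expR z = expR (z / 4) ^+ 4); last first.
  by rewrite -expRM_natl; congr expR; field.
have h : z <= expR (z / 4) ^+ 2.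
  apply: (@le_trans _ _ ((1 + z / 4) ^+ 2)).
    by have := sqr_ge0 (1 - z / 4); lra.
  rewrite ler_pXn2r ?nnegrE ?expR_ge0 ?expR_ge1Dx//; lra.
rewrite (_ : 4 = 2 * 2)%N// exprM ler_pXn2r// nnegrE sqr_ge0//.
Qed.

(** The exponent [z] is at most [|Y| / 8] and at most [Y^2 / (8 tau)]. The second bound, used in
    [exp z <= 1 + z exp z], keeps the factor [1 / tau]; then [Y^2] is absorbed by [exp (3 |Y| / 8)],
    for a total of [exp (|Y| / 2)]. *)
Lemma expR_min_le (tau Y : R) : 0 < tau ->
  expR (Num.min (Y ^+ 2) (tau * `|Y|) / (8 * tau)) <=
  1 + 15 / (8 * tau) * (expR (2^-1 * Y) + expR (2^-1 * - Y)).
Proof.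
move=> tau0; set mn := Num.min _ _.
have mn0 : 0 <= mn by rewrite le_min sqr_ge0 mulr_ge0// ltW.
have mn1 : mn <= Y ^+ 2 by rewrite ge_min lexx.
have mn2 : mn <= tau * `|Y| by rewrite ge_min lexx orbT.
have t80 : 0 < 8 * tau by lra.
set z := mn / (8 * tau).
have z0 : 0 <= z by rewrite divr_ge0// ltW.
have zY : z <= `|Y| / 8.
  by rewrite /z ler_pdivrMr//; move: mn2; lra.
have ez : expR z <= 1 + z * expR z.
  have := expR_ge1Dx (- z); rewrite expRN => h.
  have e0 := expR_gt0 z.
  have : (1 - z) * expR z <= 1 by rewrite -ler_pdivlMr// mul1r.
  lra.
apply: (le_trans ez); rewrite lerD2l.
have eY : expR (2^-1 * `|Y|) <= expR (2^-1 * Y) + expR (2^-1 * - Y).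
  have [Y0|Y0] := leP 0 Y.
    by rewrite ger0_norm// lerDl expR_ge0.
  by rewrite ltr0_norm// lerDr expR_ge0.
apply: (@le_trans _ _ (15 / (8 * tau) * expR (2^-1 * `|Y|))); last first.
  by rewrite ler_wpM2l// divr_ge0// ltW.
rewrite (_ : 2^-1 * `|Y| = `|Y| / 8 + 3 / 8 * `|Y|); last by field.
rewrite expRD.
have h1 : expR z <= expR (`|Y| / 8) by rewrite ler_expR.
have h2 : mn <= 15 * expR (3 / 8 * `|Y|).
  apply: (le_trans mn1); have := @expR_ge_sqr (3 / 8 * `|Y|).
  rewrite mulr_ge0// => /(_ isT).
  rewrite exprMn real_normK ?num_real//; have := sqr_ge0 Y; lra.
rewrite /z mulrAC [leRHS](_ : _ = (15 * expR (3 / 8 * `|Y|) * expR (`|Y| / 8)) / (8 * tau)); last by field; rewrite gt_eqF.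
rewrite ler_wpM2r ?invr_ge0 ?(ltW t80)//.
by apply: ler_pM => //; rewrite expR_ge0.
Qed.

Variables ia ib : 'I_m -> 'I_n -> I.
Hypothesis ia_inj : forall i i' k k', ia i k = ia i' k' -> i = i' /\ k = k'.
Hypothesis ib_inj : forall i i' k k', ib i k = ib i' k' -> i = i' /\ k = k'.
Hypothesis ia_ib : forall i i' k k', ia i k != ib i' k'.

(** Integrating [b_i] gives [exp (|N^T a_i|^2 / 8)], a form in [a_i] of trace at most 1/8;
    [gdet_neg_ebase] then bounds its integral by [(1 - 1/4)^(-1/2) <= 2]. *)
Lemma expect_bilinear i (h : points I R -> R) (N : points I R -> 'M[R]_n) :
  measurable_fun setT h -> (forall x, 0 <= h x) ->
  mxmeasurable N -> (forall x, fro2 (N x) <= 1) ->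
  (forall k, free_of h (ia i k)) -> (forall k, free_of h (ib i k)) ->
  (forall k, free_of N (ia i k)) -> (forall k, free_of N (ib i k)) ->
  (E (fun x => h x * expR (2^-1 * bform (N x) (gvec ia i x) (gvec ib i x))) <=
   E (fun x => 2 * h x))%E.
Proof.
move=> mh h0 mN N1 hfa hfb Nfa Nfb.
pose w (l : 'I_n) (x : points I R) := 2^-1 * ((N x)^T *m gvec ia i x) l 0.
have mNa : mxmeasurable (fun x => (N x)^T *m gvec ia i x).
  by apply: mxmeasurableM; [exact: mxmeasurable_tr|exact: mxmeasurable_gvec].
have mw l : measurable_fun setT (w l) by apply: measurable_funM => //; exact: mNa.
pose Q x := - (8^-1 *: (N x *m (N x)^T)).
have mQ : mxmeasurable Q.
  apply: mxmeasurableN; apply: mxmeasurableZ => //.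
  by apply: mxmeasurableM => //; exact: mxmeasurable_tr.
have bilE x : 2^-1 * bform (N x) (gvec ia i x) (gvec ib i x) =
    \sum_(l <- enum 'I_n) w l x * x (ib i l).
  rewrite big_enum/= /bform mxE mulr_sumr; apply: eq_bigr => l _.
  rewrite /w mulrA; congr (_ * _ * _); last by rewrite mxE.
  by rewrite -[in LHS](trmxK (_ *m N x)) [in LHS]mxE trmx_mul trmxK.
have NNE x a : bform (N x *m (N x)^T) a a = nrm2 ((N x)^T *m a).
  by rewrite nrm2E /bform trmx_mul trmxK !mulmxA.
apply: (@le_trans _ _ (E (fun x => h x * \prod_(l <- enum 'I_n) expR (w l x * x (ib i l))))).
  apply: (expect_le HX).
  - apply: measurable_funM => //; apply: measurable_expR_comp.
    apply: measurable_funM => //; apply: measurable_bform => //; exact: mxmeasurable_gvec.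
  - by move=> x; rewrite mulr_ge0// expR_ge0.
  - apply: measurable_funM => //; apply: measurable_prod => l _.
    apply: measurable_expR_comp; apply: measurable_funM => //; exact: measurable_coord.
  - by move=> x; rewrite bilE expR_sum.
apply: (le_trans (elim_lin HX (c := ib i) (enum_uniq _) _ mh h0 mw _ _)).
- by move=> l l' _ _ /ib_inj[].
- by move=> l _; exact: hfb.
- move=> l l' _ _ x t; rewrite /w Nfb gvec_free//.
apply: (@le_trans _ _ (E (fun x => h x * expR (- bform (Q x)
     (\sum_(k <- enum 'I_n) x (ia i k) *: ebase k) (\sum_(k <- enum 'I_n) x (ia i k) *: ebase k))))).
  apply: (expect_le HX).
  - apply: measurable_funM => //; apply: measurable_prod => l _.
    apply: measurable_expR_comp; apply: measurable_funM => //.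
    exact: measurable_funX.
  - by move=> x; rewrite mulr_ge0// prodr_ge0// => *; exact: expR_ge0.
  - apply: measurable_funM => //.
    apply: measurable_expR_comp; apply: measurable_funN.
    have me : mxmeasurable (fun x : points I R => \sum_(k <- enum 'I_n) x (ia i k) *: @ebase R _ k).
      by apply: mxmeasurable_lincomb => k; exact: mxmeasurable_cst.
    exact: measurable_bform.
  - move=> x; rewrite -(gvecE ia i x) /Q bformNl opprK bformZ NNE -expR_sum big_enum/=.
    rewrite ler_wpM2l// ler_expR /nrm2 mulr_sumr le_eqVlt; apply/orP; left.
    by apply/eqP; apply: eq_bigr => l _; rewrite /w; field.
have QQ x : (8^-1 *: (N x *m (N x)^T))^T = 8^-1 *: (N x *m (N x)^T).
  by rewrite linearZ/= trmx_mul trmxK.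
have Q0 x a : 0 <= bform (8^-1 *: (N x *m (N x)^T)) a a.
  by rewrite bformZ NNE mulr_ge0// nrm2_ge0.
have trQ x : \sum_(k <- enum 'I_n) (8^-1 *: (N x *m (N x)^T)) k k <= 8^-1.
  rewrite big_enum/=.
  rewrite (eq_bigr (fun k => 8^-1 * \sum_l N x k l ^+ 2)); last first.
    by move=> k _; rewrite !mxE; congr (_ * _); apply: eq_bigr => l _; rewrite mxE expr2.
  by rewrite -mulr_sumr ler_piMr//; exact: N1.
have trQ2 x : \sum_(k <- enum 'I_n) (8^-1 *: (N x *m (N x)^T)) k k < 2^-1.
  by apply: le_lt_trans (trQ x) _; rewrite ltf_pV2 ?posrE//; lra.
have HG x := gdet_neg_ebase (QQ x) (Q0 x) (enum_uniq 'I_n) (trQ2 x).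
have Qf k : free_of Q (ia i k) by move=> x t; rewrite /Q Nfa.
apply: (le_trans (elim_quad HX (c := ia i) (w := fun k _ => ebase k) _ mh h0 mQ _ _ _ _ _ _)).
- by rewrite map_inj_in_uniq ?enum_uniq// => k k' _ _ /ia_inj[].
- by move=> x; rewrite /Q linearN/= QQ.
- by move=> k; exact: mxmeasurable_cst.
- by move=> k _; exact: hfa.
- by move=> k _; exact: Qf.
- by [].
- by move=> x; case: (HG x).
apply: (expect_le HX).
- apply: measurable_funM => //; apply: measurable_gdet => // k.
  exact: mxmeasurable_cst.
- by move=> x; rewrite mulr_ge0 ?gdet_ge0.
- exact: measurable_funM.
move=> x; rewrite mulrC ler_wpM2r//.
have [_ hg] := HG x; apply: (le_trans hg).
have tq := trQ x; set S := \sum_(k <- _) _ in tq *.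
rewrite -[leRHS]invrK lef_pV2 ?posrE ?sqrtr_gt0 ?invr_gt0//; last by lra.
rewrite -(ler_pXn2r (n := 2))// ?nnegrE ?sqrtr_ge0 ?invr_ge0//.
rewrite sqr_sqrtr; last by lra.
rewrite expr2; lra.
Qed.

(** [N] ignores the rows of [s], so it is frozen while a row is integrated; [expect_bilinear] for
    [N] and for [- N] contributes [2 + 2], whence [1 + 4 th]. *)
Lemma expect_cosh_prod (th : R) (s : seq 'I_m) (h : points I R -> R)
    (N : points I R -> 'M[R]_n) : 0 <= th -> uniq s ->
  measurable_fun setT h -> (forall x, 0 <= h x) ->
  mxmeasurable N -> (forall x, fro2 (N x) <= 1) ->
  (forall i k, i \in s -> free_of h (ia i k)) ->
  (forall i k, i \in s -> free_of h (ib i k)) ->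
  (forall i k, i \in s -> free_of N (ia i k)) ->
  (forall i k, i \in s -> free_of N (ib i k)) ->
  (E (fun x => h x * \prod_(i <- s) (1 + th *
      (expR (2^-1 * bform (N x) (gvec ia i x) (gvec ib i x)) +
       expR (2^-1 * - bform (N x) (gvec ia i x) (gvec ib i x))))) <=
   E (fun x => (1 + 4 * th) ^+ size s * h x))%E.
Proof.
move=> th0 + + + mN N1.
pose Y i x := bform (N x) (gvec ia i x) (gvec ib i x).
pose F i (x : points I R) := 1 + th * (expR (2^-1 * Y i x) + expR (2^-1 * - Y i x)).
have mY i : measurable_fun setT (Y i).
  by apply: measurable_bform => //; exact: mxmeasurable_gvec.
have mF i : measurable_fun setT (F i).
  apply: measurable_funD => //; apply: measurable_funM => //.
  by apply: measurable_funD; apply: measurable_expR_comp; apply: measurable_funM => //;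
    exact: measurable_funN.
have F0 i x : 0 <= F i x by rewrite addr_ge0// mulr_ge0// addr_ge0 ?expR_ge0.
have mP s' : measurable_fun setT (fun x => \prod_(i <- s') F i x).
  by apply: measurable_prod => i _; exact: mF.
have P0 (s' : seq 'I_m) x : 0 <= \prod_(i <- s') F i x by rewrite prodr_ge0.
elim: s h => [|i s IH] h /=.
  move=> _ mh h0 *; apply: (expect_le HX).
  - by apply: measurable_funM => //; exact: mP.
  - by move=> x; rewrite mulr_ge0//; exact: P0.
  - exact: measurable_funM.
  - by move=> x; rewrite big_nil mulr1 expr0 mul1r.
move=> /andP[nis us] mh h0 hfa hfb Nfa Nfb.
have ins j : j \in s -> j \in i :: s by rewrite inE => ->; rewrite orbT.
have ij j : j \in s -> i != j by move=> js; apply: contraNneq nis => ->.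
have Pfa j k : j \in s -> forall x t, F j (setc x (ia i k) t) = F j x.
  move=> js x t; rewrite /F /Y Nfa ?mem_head// !gvec_free//.
    by move=> k'; rewrite eq_sym; exact: ia_ib.
  move=> k'; apply/negP => /eqP/ia_inj[ji _].
  by have := ij _ js; rewrite ji eqxx.
have Pfb j k : j \in s -> forall x t, F j (setc x (ib i k) t) = F j x.
  move=> js x t; rewrite /F /Y Nfb ?mem_head// !gvec_free//.
  move=> k'; apply/negP => /eqP/ib_inj[ji _].
  by have := ij _ js; rewrite ji eqxx.
pose h1 x := h x * \prod_(j <- s) F j x.
have mh1 : measurable_fun setT h1 by apply: measurable_funM => //; exact: mP.
have h10 x : 0 <= h1 x by rewrite mulr_ge0//; exact: P0.
have h1a k : free_of h1 (ia i k).
  move=> x t; rewrite /h1 hfa ?mem_head//; congr (_ * _).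
  by apply: eq_big_seq => j js; exact: Pfa.
have h1b k : free_of h1 (ib i k).
  move=> x t; rewrite /h1 hfb ?mem_head//; congr (_ * _).
  by apply: eq_big_seq => j js; exact: Pfb.
pose g1 x := h1 x * expR (2^-1 * Y i x).
pose g2 x := h1 x * expR (2^-1 * - Y i x).
have mg1 : measurable_fun setT g1.
  by apply: measurable_funM => //; apply: measurable_expR_comp; exact: measurable_funM.
have mg2 : measurable_fun setT g2.
  apply: measurable_funM => //; apply: measurable_expR_comp; apply: measurable_funM => //.
  exact: measurable_funN.
have g10 x : 0 <= g1 x by rewrite mulr_ge0// expR_ge0.
have g20 x : 0 <= g2 x by rewrite mulr_ge0// expR_ge0.
have Eg1 : (E g1 <= E (fun x => 2 * h1 x))%E.
  by apply: expect_bilinear => // k; [exact: Nfa (mem_head _ _)|exact: Nfb (mem_head _ _)].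
have Eg2 : (E g2 <= E (fun x => 2 * h1 x))%E.
  apply: le_trans (expect_bilinear (i := i) (N := fun x => - N x) mh1 h10 _ _ h1a h1b _ _).
  - apply: (expect_le HX) => //.
      apply: measurable_funM => //; apply: measurable_expR_comp; apply: measurable_funM => //.
      by apply: measurable_bform; [exact: mxmeasurableN|exact: mxmeasurable_gvec..].
    by move=> x; rewrite /g2 bformNl.
  - exact: mxmeasurableN.
  - move=> x; apply: le_trans (N1 x); rewrite le_eqVlt; apply/orP; left; apply/eqP.
    by apply: eq_bigr => k _; apply: eq_bigr => l _; rewrite mxE sqrrN.
  - by move=> k x t; rewrite Nfa ?mem_head.
  - by move=> k x t; rewrite Nfb ?mem_head.
apply: (@le_trans _ _ (E (fun x => (1 + 4 * th) * h1 x))).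
  have -> : (E (fun x => h x * \prod_(j <- i :: s) F j x) = E (fun x => h1 x + th * (g1 x + g2 x)))%E.
    congr (expect P X); apply/funext => x; rewrite big_cons /h1 /g1 /g2 /h1 /F; ring.
  rewrite (expectD HX)//; last 2 first.
  - by apply: measurable_funM => //; exact: measurable_funD.
  - by move=> x; rewrite mulr_ge0// addr_ge0.
  rewrite (expectZ HX)//; last 2 first.
  - exact: measurable_funD.
  - by move=> x; rewrite addr_ge0.
  rewrite (expectD HX)//.
  rewrite (expectZ HX)//; last by rewrite addr_ge0// mulr_ge0.
  rewrite EFinD ge0_muleDl ?lee_fin ?mulr_ge0// mul1e.
  apply: leeD => //.
  have e1 := Eg1; have e2 := Eg2; rewrite (expectZ HX)// in e1; rewrite (expectZ HX)// in e2.
  apply: (@le_trans _ _ (th%:E * (2%:E * E h1 + 2%:E * E h1)))%E.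
    by apply: lee_wpmul2l; [rewrite lee_fin|apply: leeD].
  rewrite -ge0_muleDl ?lee_fin// muleA -EFinD -EFinM.
  by rewrite (_ : th * (2 + 2) = 4 * th)//; ring.
pose C := 1 + 4 * th; have C0 : 0 <= C by rewrite addr_ge0// mulr_ge0.
apply: le_trans (le_trans (IH (fun x => C * h x) us _ _ _ _ _ _) _).
- apply: (expect_le HX).
  + exact: measurable_funM.
  + by move=> x; rewrite mulr_ge0.
  + by apply: measurable_funM; [exact: measurable_funM|exact: mP].
  + by move=> x; rewrite /h1 mulrA.
- exact: measurable_funM.
- by move=> x; rewrite mulr_ge0.
- by move=> j k js x t; rewrite hfa ?ins.
- by move=> j k js x t; rewrite hfb ?ins.
- by move=> j k js; apply: Nfa; rewrite ins.
- by move=> j k js; apply: Nfb; rewrite ins.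
apply: (expect_le HX).
- by apply: measurable_funM => //; exact: measurable_funM.
- by move=> x; rewrite mulr_ge0 ?exprn_ge0// mulr_ge0.
- exact: measurable_funM.
- by move=> x; rewrite exprS mulrA -/C (mulrC C).
Qed.

Lemma expect_min_sum (tau : R) (s : seq 'I_m) (N : points I R -> 'M[R]_n) :
  0 < tau -> uniq s -> mxmeasurable N -> (forall x, fro2 (N x) <= 1) ->
  (forall i k, i \in s -> free_of N (ia i k)) ->
  (forall i k, i \in s -> free_of N (ib i k)) ->
  (E (fun x => expR (\sum_(i <- s)
      Num.min (bform (N x) (gvec ia i x) (gvec ib i x) ^+ 2)
              (tau * `|bform (N x) (gvec ia i x) (gvec ib i x)|) / (8 * tau))) <=
   (expR (60 * m%:R / (8 * tau)))%:E)%E.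
Proof.
move=> tau0 us mN N1 Nfa Nfb.
have t80 : 0 < 8 * tau by lra.
pose th := 15 / (8 * tau); have th0 : 0 <= th by rewrite divr_ge0// ltW.
have mY i : measurable_fun setT (fun x => bform (N x) (gvec ia i x) (gvec ib i x)).
  by apply: measurable_bform => //; exact: mxmeasurable_gvec.
apply: le_trans (le_trans (expect_cosh_prod (h := fun=> 1) th0 us _ _ mN N1 _ _ Nfa Nfb) _) => //.
  apply: (expect_le HX).
  - apply: measurable_expR_comp; apply: measurable_sum => i; apply: measurable_funM => //.
    apply: measurable_minr; first exact: measurable_funX.
    by apply: measurable_funM => //; exact: measurableT_comp.
  - by move=> x; exact: expR_ge0.
  - apply: measurable_funM; first exact: measurable_cst.
    apply: measurable_prod => i _; apply: measurable_funD => //.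
    apply: measurable_funM => //; apply: measurable_funD; apply: measurable_expR_comp;
      apply: measurable_funM => //; exact: measurable_funN.
  - move=> x; rewrite mul1r expR_sum; apply: ler_prod => i _.
    by rewrite expR_ge0 expR_min_le.
rewrite expect_cst lee_fin mulr1.
apply: (@le_trans _ _ (expR (4 * th) ^+ size s)).
  by rewrite lerXn2r ?nnegrE ?expR_ge0 ?expR_ge1Dx// addr_ge0// mulr_ge0.
rewrite -expRM_natl ler_expR.
rewrite [leRHS](_ : _ = m%:R * (4 * th)); last by rewrite /th; field; rewrite gt_eqF.
rewrite ler_wpM2r; [by []|by rewrite mulr_ge0|].
rewrite ler_nat -[leqRHS](card_ord m).
by rewrite -(card_uniqP us) max_card.
Qed.

End bilinear_tails.

(** * The Gram matrix of the rank-one matrices *)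

Section frobenius.
Context {R : realType} {p q : nat}.
Implicit Types M N : 'M[R]_(p, q).

Definition ipm M N : R := \sum_k \sum_l M k l * N k l.

Lemma ipmC M N : ipm M N = ipm N M.
Proof. by apply: eq_bigr => k _; apply: eq_bigr => l _; rewrite mulrC. Qed.

Lemma ipmDl M M' N : ipm (M + M') N = ipm M N + ipm M' N.
Proof.
rewrite -big_split; apply: eq_bigr => k _; rewrite -big_split.
by apply: eq_bigr => l _; rewrite mxE mulrDl.
Qed.

Lemma ipmZl a M N : ipm (a *: M) N = a * ipm M N.
Proof.
rewrite mulr_sumr; apply: eq_bigr => k _; rewrite mulr_sumr.
by apply: eq_bigr => l _; rewrite mxE mulrA.
Qed.

Lemma ipmDr M N N' : ipm M (N + N') = ipm M N + ipm M N'.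
Proof. by rewrite ipmC ipmDl !(ipmC M). Qed.

Lemma ipmZr a M N : ipm M (a *: N) = a * ipm M N.
Proof. by rewrite ipmC ipmZl ipmC. Qed.

Lemma ipm0l N : ipm 0 N = 0.
Proof. by rewrite -(scale0r 0) ipmZl mul0r. Qed.

Lemma ipm_suml J (s : seq J) (P : pred J) (F : J -> 'M[R]_(p, q)) N :
  ipm (\sum_(j <- s | P j) F j) N = \sum_(j <- s | P j) ipm (F j) N.
Proof. by elim/big_rec2: _ => [|j x M _ <-]; rewrite ?ipm0l ?ipmDl. Qed.

Lemma fro2E M : fro2 M = ipm M M.
Proof. by apply: eq_bigr => k _; apply: eq_bigr => l _; rewrite expr2. Qed.

Lemma ipm_cauchy M N : ipm M N ^+ 2 <= fro2 M * fro2 N.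
Proof.
have H t : 0 <= fro2 M + 2 * t * ipm M N + t ^+ 2 * fro2 N.
  have := fro2_ge0 (M + t *: N).
  rewrite !fro2E ipmDl !ipmDr !ipmZl !ipmZr (ipmC N M).
  by rewrite (_ : _ + _ = ipm M M + 2 * t * ipm M N + t ^+ 2 * ipm N N)//; ring.
have := fro2_ge0 N; rewrite le_eqVlt => /orP[/eqP c0|c0].
  have [->|b0] := eqVneq (ipm M N) 0; first by rewrite expr0n -c0 mulr0.
  have := H (- (fro2 M + 1) / (2 * ipm M N)).
  rewrite -c0 mulr0 addr0 (_ : _ + _ = - 1); last by field.
  by rewrite oppr_ge0 ler10.
have := H (- ipm M N / fro2 N).
rewrite (_ : _ + _ = (fro2 M * fro2 N - ipm M N ^+ 2) / fro2 N); last by field; rewrite gt_eqF.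
by rewrite pmulr_lge0 ?invr_gt0// subr_ge0.
Qed.

Definition fnorm M := Num.sqrt (fro2 M).

Lemma fnorm_ge0 M : 0 <= fnorm M. Proof. exact: sqrtr_ge0. Qed.

Lemma fnorm2 M : fnorm M ^+ 2 = fro2 M.
Proof. by rewrite sqr_sqrtr// fro2_ge0. Qed.

Lemma fnorm_leP M (c : R) : 0 <= c -> (fnorm M <= c) = (fro2 M <= c ^+ 2).
Proof. by move=> c0; rewrite -fnorm2 ler_pXn2r// nnegrE fnorm_ge0. Qed.

Lemma fnorm_geP M (c : R) : 0 <= c -> (c <= fnorm M) = (c ^+ 2 <= fro2 M).
Proof. by move=> c0; rewrite -fnorm2 ler_pXn2r// nnegrE fnorm_ge0. Qed.

Lemma ipm_le_fnorm M N : `|ipm M N| <= fnorm M * fnorm N.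
Proof.
rewrite -(ler_pXn2r (n := 2))// ?nnegrE ?mulr_ge0 ?fnorm_ge0//.
by rewrite exprMn !fnorm2 real_normK ?num_real// ipm_cauchy.
Qed.

Lemma fnormD M N : fnorm (M + N) <= fnorm M + fnorm N.
Proof.
rewrite fnorm_leP ?addr_ge0 ?fnorm_ge0// fro2E ipmDl !ipmDr (ipmC N) -!fro2E.
rewrite sqrrD !fnorm2; have := ipm_le_fnorm M N; rewrite ler_norml => /andP[_].
by rewrite -mulr_natl; lra.
Qed.

End frobenius.

Section rounding.
Context {R : realType}.

(* Randomised rounding, derandomised: rounding [y i] up with probability its
   fractional part [f] adds [f (1 - f) |w i|^2 <= |w i|^2 / 4] on average. *)
Lemma round_family (m p q : nat) (w : 'I_m -> 'M[R]_(p, q)) (y : 'I_m -> R) :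
  exists z : 'I_m -> int,
    [/\ forall i, `|y i - (z i)%:~R| <= 1,
        forall i, y i = 0 -> z i = 0 &
        fro2 (\sum_i (y i - (z i)%:~R) *: w i) <= \sum_(i | y i != 0) fro2 (w i) / 4].
Proof.
suff [z [z1 z2 z3]] : exists z : 'I_m -> int,
    [/\ forall i, `|y i - (z i)%:~R| <= 1,
        forall i, y i = 0 -> z i = 0 &
        fro2 (\sum_(i <- enum 'I_m) (y i - (z i)%:~R) *: w i) <=
        \sum_(i <- enum 'I_m | y i != 0) fro2 (w i) / 4].
  by exists z; split=> //; move: z3; rewrite big_enum big_enum_cond.
have fl i : 0 <= y i - (Num.floor (y i))%:~R < 1.
  rewrite subr_ge0 floor_le ltrBlDl.
  by have := floorD1_gt (y i); rewrite intrD.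
elim: (enum 'I_m) (enum_uniq 'I_m) => [|i s IH] /=.
  move=> _; exists (fun i => Num.floor (y i)); split.
  - by move=> i; have /andP[h1 h2] := fl i; rewrite ger0_norm// ltW.
  - by move=> i ->; rewrite floor0.
  - by rewrite !big_nil fro2E ipm0l.
move=> /andP[nis us]; have [z [z1 z2 z3]] := IH us.
set f := y i - (Num.floor (y i))%:~R.
have /andP[f0 f1] := fl i; rewrite -/f in f0 f1.
set Y := \sum_(j <- s) (y j - (z j)%:~R) *: w j in z3.
set B := \sum_(j <- s | _) _ in z3.
have wi0 := fro2_ge0 (w i).
pose ze e j : int := if j == i then Num.floor (y i) + e else z j.
have sE e : \sum_(j <- i :: s) (y j - (ze e j)%:~R) *: w j = (f - e%:~R) *: w i + Y.
  rewrite big_cons /ze eqxx intrD opprD addrA -/f; congr (_ + _).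
  apply: eq_big_seq => j js; case: eqP => // ji.
  by rewrite -ji js in nis.
have froE (g : R) : fro2 (g *: w i + Y) = g ^+ 2 * fro2 (w i) + 2 * g * ipm (w i) Y + fro2 Y.
  by rewrite !fro2E ipmDl !ipmDr !ipmZl !ipmZr (ipmC Y); ring.
have BE : \sum_(j <- i :: s | y j != 0) fro2 (w j) / 4 =
          (if y i != 0 then fro2 (w i) / 4 else 0) + B.
  by rewrite big_cons; case: ifP => //; rewrite add0r.
case: (leP (fro2 (f *: w i + Y)) ((if y i != 0 then fro2 (w i) / 4 else 0) + B)) => [H|H].
  exists (ze 0); split.
  - move=> j; rewrite /ze; case: eqP => [->|//]; rewrite addr0 -/f.
    by rewrite ger0_norm// ltW.
  - by move=> j yj; rewrite /ze; case: eqP => [<-|_]; [rewrite yj floor0|exact: z2].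
  - by rewrite sE BE subr0.
have yi0 : y i != 0.
  apply: contraTneq H => yi; rewrite yi eqxx/= add0r -leNgt.
  by rewrite /f yi floor0 subr0 scale0r add0r.
exists (ze 1); split.
- move=> j; rewrite /ze; case: eqP => [->|//]; rewrite intrD opprD addrA -/f.
  by rewrite ler_norml; lra.
- move=> j yj; rewrite /ze; case: eqP => [ji|_]; last exact: z2.
  by move: yi0; rewrite -ji yj eqxx.
- rewrite sE BE; move: H; rewrite yi0 !froE => H.
  set u := ipm (w i) Y in H *.
  have hq : f * (1 - f) * fro2 (w i) <= fro2 (w i) / 4.
    have := mulr_ge0 wi0 (sqr_ge0 (f - 2^-1)); lra.
  (* the two choices average to [fro2 Y + f (1 - f) fro2 (w i)] *)
  set W := fro2 (w i) in H hq wi0 *; set F := fro2 Y in z3 H *.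
  have f0' : 0 < f.
    rewrite lt_def f0 andbT; apply: contraTneq H => ->.
    by rewrite expr0n/= mul0r mulr0 mul0r !add0r -leNgt; lra.
  have : f * ((f - 1) ^+ 2 * W + 2 * (f - 1) * u + F - (W / 4 + B)) <= 0.
    have : 0 < (1 - f) * (f ^+ 2 * W + 2 * f * u + F - (W / 4 + B)).
      by apply: mulr_gt0; lra.
    by lra.
  by rewrite pmulr_rle0// subr_le0.
Qed.

End rounding.

(** * Deterministic lower bound for the Gram matrix *)

Section gram_lower_bound.
Context {R : realType}.
Variables (m n : nat) (a b : 'I_m -> 'cV[R]_n).

Definition rank1 i : 'M[R]_n := a i *m (b i)^T.

Definition mixture (q : 'I_m -> R) : 'M[R]_n := \sum_i q i *: rank1 i.

Lemma rank1E i k l : rank1 i k l = a i k 0 * b i l 0.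
Proof. by rewrite mxE big_ord1 mxE. Qed.

Definition dotv k (u v : 'cV[R]_k) : R := \sum_j u j 0 * v j 0.

Lemma ipm_rank1 i N : ipm (rank1 i) N = bform N (a i) (b i).
Proof.
rewrite bformE; apply: eq_bigr => k _; apply: eq_bigr => l _.
by rewrite rank1E mulrAC.
Qed.

Lemma ipm_rank11 i j : ipm (rank1 i) (rank1 j) = dotv (a i) (a j) * dotv (b i) (b j).
Proof.
rewrite /dotv mulr_suml; apply: eq_bigr => k _; rewrite mulr_sumr.
by apply: eq_bigr => l _; rewrite !rank1E; ring.
Qed.

Lemma fro2_rank1 i : fro2 (rank1 i) = nrm2 (a i) * nrm2 (b i).
Proof.
by rewrite fro2E ipm_rank11; congr (_ * _); apply: eq_bigr => k _; rewrite expr2.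
Qed.

Lemma mixtureB q q' : mixture (fun i => q i - q' i) = mixture q - mixture q'.
Proof. by rewrite /mixture -sumrB; apply: eq_bigr => i _; rewrite scalerBl. Qed.

Lemma mixtureD q q' : mixture (fun i => q i + q' i) = mixture q + mixture q'.
Proof. by rewrite /mixture -big_split; apply: eq_bigr => i _; rewrite scalerDl. Qed.

Lemma mixtureZ c q : mixture (fun i => c * q i) = c *: mixture q.
Proof. by rewrite /mixture scaler_sumr; apply: eq_bigr => i _; rewrite scalerA. Qed.

Lemma ipm_mixture q N : ipm (mixture q) N = \sum_i q i * ipm (rank1 i) N.
Proof. by rewrite ipm_suml; apply: eq_bigr => i _; rewrite ipmZl. Qed.

Lemma fnormN p q (M : 'M[R]_(p, q)) : fnorm (- M) = fnorm M.
Proof.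
congr Num.sqrt; apply: eq_bigr => k _; apply: eq_bigr => l _.
by rewrite mxE sqrrN.
Qed.

Lemma fro2Z p q c (M : 'M[R]_(p, q)) : fro2 (c *: M) = c ^+ 2 * fro2 M.
Proof. by rewrite !fro2E ipmZl ipmZr mulrA -expr2. Qed.

Lemma cauchy_sum (J : finType) (S : {pred J}) (u v : J -> R) :
  (\sum_(i in S) u i * v i) ^+ 2 <= (\sum_(i in S) u i ^+ 2) * (\sum_(i in S) v i ^+ 2).
Proof.
pose M (f : J -> R) : 'M[R]_(1, #|J|) := \row_j (if enum_val j \in S then f (enum_val j) else 0).
have ME f g : ipm (M f) (M g) = \sum_(i in S) f i * g i.
  rewrite /ipm big_ord1 [RHS]big_mkcond/= (reindex (@enum_val J J))/=; last exact/onW_bij/enum_val_bij.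
  by apply: eq_bigr => j _; rewrite !mxE; case: ifP => //; rewrite mul0r.
have := ipm_cauchy (M u) (M v); rewrite !fro2E !ME.
by under [in X in _ <= X * _]eq_bigr do rewrite -expr2;
   under [in X in _ <= _ * X]eq_bigr do rewrite -expr2.
Qed.

Lemma sum_le_card (J : finType) (S : {pred J}) (u : J -> R) :
  (\sum_(i in S) `|u i|) ^+ 2 <= #|S|%:R * \sum_(i in S) u i ^+ 2.
Proof.
have := cauchy_sum S (fun=> 1) (fun i => `|u i|).
rewrite [X in X ^+ 2 <= _](eq_bigr (fun i => `|u i|)) => [|i _]; last by rewrite mul1r.
rewrite [X in _ <= X * _](eq_bigr (fun=> 1)) => [|i _]; last by rewrite expr1n.
rewrite sumr_const => h; apply: (le_trans h).
rewrite le_eqVlt; apply/orP; left; apply/eqP; congr (_ * _).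
by apply: eq_bigr => i _; rewrite real_normK ?num_real.
Qed.

Lemma card_big_le (J : finType) (u : J -> R) (t s : R) : 0 < t ->
  \sum_i u i ^+ 2 <= s -> #|[pred i | t < u i ^+ 2]|%:R <= s / t.
Proof.
move=> t0 us; rewrite ler_pdivlMr//; apply: le_trans us.
rewrite -sum1_card natr_sum mulr_suml [leRHS](bigID [pred i | t < u i ^+ 2])/=.
rewrite -[leLHS]addr0; apply: lerD; last by apply: sumr_ge0 => i _; exact: sqr_ge0.
by apply: ler_sum => i ti; rewrite mul1r ltW.
Qed.

(** Meshes [de0] and [de1] of the fine and coarse grids, bound [rho] on inner products of distinct
    vectors, truncation level [tau], and squared size [s1^-1] above which an entry is a spike. With
    [L = ln n] they become [216 / n], [1 / (72 sqrt n)], [L^2 sqrt n], [32 L^4 sqrt n], and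
    [s1 = L^2]. *)
Variables (de0 de1 rho tau s1 : R).
Hypothesis n0 : (0 < n)%N.
Hypothesis anrm : forall i, n%:R / 2 <= nrm2 (a i) <= 2 * n%:R.
Hypothesis bnrm : forall i, n%:R / 2 <= nrm2 (b i) <= 2 * n%:R.
Hypothesis adot : forall i j, i != j -> `|dotv (a i) (a j)| <= rho.
Hypothesis bdot : forall i j, i != j -> `|dotv (b i) (b j)| <= rho.
Hypotheses (de00 : 0 < de0) (de10 : 0 < de1) (rho0 : 0 <= rho) (tau0 : 0 <= tau) (s10 : 0 < s1).
Hypothesis de0m : m%:R * de0 ^+ 2 <= (36 * 36)^-1.
Hypothesis de0n : n%:R * de0 ^+ 2 <= 1.
Hypothesis de1n : n%:R * de1 ^+ 2 <= (72 * 72)^-1.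
Hypothesis s1rho : 60 * s1 * rho ^+ 2 <= n%:R ^+ 2.
Hypothesis s1rho4 : (100 * 120) * n%:R * s1 * rho ^+ 4 <= n%:R ^+ 4.
Hypothesis taurho : 972 * n%:R * rho ^+ 4 <= tau ^+ 2 * n%:R ^+ 2.

Let scaled (de : R) (z : 'I_m -> int) i : R := de * (z i)%:~R.

Hypothesis flat0 : forall z, let q := scaled de0 z in
  \sum_i q i ^+ 2 <= 3 -> 8^-1 <= \sum_(i | q i ^+ 2 <= 4 / n%:R) q i ^+ 2 ->
  (n%:R / 18) ^+ 2 <= fro2 (mixture q).
Hypothesis flat1 : forall z, let q := scaled de1 z in
  (#|[pred i | z i != 0]| <= n)%N ->
  \sum_i q i ^+ 2 <= 3 -> 8^-1 <= \sum_(i | q i ^+ 2 <= s1^-1) q i ^+ 2 ->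
  (n%:R / 18) ^+ 2 <= fro2 (mixture q).
Hypothesis cross1 : forall z, let q := scaled de1 z in
  (#|[pred i | z i != 0]| <= n)%N -> \sum_i q i ^+ 2 <= 3 ->
  let Y i := bform ((fnorm (mixture q))^-1 *: mixture q) (a i) (b i) in
  \sum_(i | z i == 0) Num.min (Y i ^+ 2) (tau * `|Y i|) <= (n%:R / 72) ^+ 2.

Let nR0 : 0 < n%:R :> R. Proof. by rewrite ltr0n. Qed.

Let fro2_rank1_le i : fro2 (rank1 i) <= 4 * n%:R ^+ 2.
Proof.
rewrite fro2_rank1; have /andP[a1 a2] := anrm i; have /andP[b1 b2] := bnrm i.
rewrite (_ : 4 * _ = 2 * n%:R * (2 * n%:R)); last by ring.
by apply: ler_pM => //; exact: nrm2_ge0.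
Qed.

Let fro2_rank1_ge i : n%:R ^+ 2 / 4 <= fro2 (rank1 i).
Proof.
rewrite fro2_rank1; have /andP[a1 a2] := anrm i; have /andP[b1 b2] := bnrm i.
rewrite (_ : _ / 4 = n%:R / 2 * (n%:R / 2)); last by field.
by apply: ler_pM => //; rewrite divr_ge0.
Qed.

Let ipm_off i j : i != j -> `|ipm (rank1 i) (rank1 j)| <= rho ^+ 2.
Proof.
move=> ij; rewrite ipm_rank11 normrM expr2.
by apply: ler_pM => //; [exact: adot|exact: bdot].
Qed.

(** The factor 1/4 of [round_family] cancels the 4 in [fro2_rank1_le]. Errors add in squares, which
    is what lets a mesh of order [1 / n] serve a number of entries of order [n^2]. *)
Lemma round_mixture de (q : 'I_m -> R) : 0 < de -> exists z : 'I_m -> int,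
  [/\ forall i, `|q i - scaled de z i| <= de,
      forall i, q i = 0 -> z i = 0 &
      fro2 (mixture (fun i => q i - scaled de z i)) <=
      #|[pred i | q i != 0]|%:R * de ^+ 2 * n%:R ^+ 2].
Proof.
move=> de_gt0; have [z [z1 z2 z3]] := round_family rank1 (fun i => q i / de).
have e i : q i - scaled de z i = de * (q i / de - (z i)%:~R).
  by rewrite /scaled; field; rewrite gt_eqF.
exists z; split=> [i|i qi|].
- by rewrite e normrM gtr0_norm// ler_piMr// ltW.
- by apply: z2; rewrite qi mul0r.
- rewrite (_ : mixture _ = de *: \sum_i (q i / de - (z i)%:~R) *: rank1 i); last first.
    by rewrite -mixtureZ; apply: eq_bigr => i _; rewrite e.
  rewrite fro2Z [leRHS]mulrAC [leRHS]mulrC ler_wpM2l ?sqr_ge0//; apply: (le_trans z3).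
  rewrite -sum1_card natr_sum mulr_suml.
  rewrite (eq_bigl (fun i => q i != 0)); last first.
    by move=> i; rewrite mulf_eq0 invr_eq0 (gt_eqF de_gt0) orbF.
  by apply: ler_sum => i _; have := fro2_rank1_le i; lra.
Qed.

Lemma ipm_rank1_mixture (r : 'I_m -> R) i :
  `|ipm (rank1 i) (mixture r) - r i * fro2 (rank1 i)| <= (\sum_j `|r j|) * rho ^+ 2.
Proof.
rewrite ipmC ipm_mixture (bigD1 i)//= -fro2E addrAC subrr add0r.
apply: le_trans (ler_norm_sum _ _ _) _.
rewrite [in leRHS](bigD1 i)//= mulrDl -[leLHS]add0r; apply: lerD.
  by rewrite mulr_ge0// sqr_ge0.
rewrite mulr_suml; apply: ler_sum => j ji; rewrite normrM ler_wpM2l//.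
exact: ipm_off.
Qed.

(* On sparse vectors the Gram matrix is diagonally dominant. *)
Lemma sparse_mixture_ge (p : 'I_m -> R) :
  (#|[pred i | p i != 0%R]| <= n)%N -> \sum_i p i ^+ 2 <= 3 ->
  3 / 40 <= \sum_(i | s1^-1 < p i ^+ 2) p i ^+ 2 ->
  (n%:R / 18) ^+ 2 <= fro2 (mixture p).
Proof.
move=> supp p3 spike; pose S : pred 'I_m := fun i => s1^-1 < p i ^+ 2.
have inS i : (i \in S) = S i by [].
(* [r] keeps the spikes; there are at most [3 s1] of them, as the squares sum to at most 3. *)
pose r i := if S i then p i else 0.
have r2 : \sum_i r i ^+ 2 = \sum_(i in S) p i ^+ 2.
  rewrite [RHS]big_mkcond; apply: eq_bigr => i _; rewrite inS /r.
  by case: ifP => //; rewrite expr0n.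
set e := \sum_(i in S) p i ^+ 2 in r2.
have e1 : 3 / 40 <= e by [].
have cS : #|S|%:R <= 3 * s1.
  by have := @card_big_le _ p s1^-1 3; rewrite invrK invr_gt0; apply.
have sumr : (\sum_i `|r i|) ^+ 2 <= 3 * s1 * e.
  apply: (@le_trans _ _ (#|S|%:R * e)); last by rewrite ler_wpM2r// (le_trans _ e1).
  rewrite (_ : \sum_i `|r i| = \sum_(i in S) `|p i|); first exact: sum_le_card.
  rewrite [RHS]big_mkcond; apply: eq_bigr => i _; rewrite inS /r.
  by case: ifP => //; rewrite normr0.
have sump : (\sum_i `|p i|) ^+ 2 <= n%:R * 3.
  rewrite (_ : \sum_i `|p i| = \sum_(i in [pred i | p i != 0]) `|p i|); last first.
    rewrite [RHS]big_mkcond/=; apply: eq_bigr => i _; rewrite inE.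
    by case: eqP => //= ->; rewrite normr0.
  apply: le_trans (sum_le_card _ _) _; apply: ler_pM => //.
  - by apply: sumr_ge0 => i _; exact: sqr_ge0.
  - by rewrite ler_nat.
  - apply: le_trans p3; rewrite [leRHS](bigID [pred i | p i != 0])/= lerDl.
    by apply: sumr_ge0 => i _; exact: sqr_ge0.
set Rm := mixture r; set A := fro2 Rm.
set sr := \sum_i `|r i| in sumr; set sp := \sum_i `|p i| in sump.
have sr0 : 0 <= sr by apply: sumr_ge0.
have sp0 : 0 <= sp by apply: sumr_ge0.
have rho20 : 0 <= rho ^+ 2 by exact: sqr_ge0.
have rhoE : rho ^+ 4 = rho ^+ 2 * rho ^+ 2 by rewrite -exprD.
have nE : n%:R ^+ 4 = n%:R ^+ 2 * n%:R ^+ 2 :> R by rewrite -exprD.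
have n20 : 0 < n%:R ^+ 2 :> R by rewrite exprn_gt0.
have e0 : 0 <= e by apply: le_trans e1; lra.
have A1 : e * (n%:R ^+ 2 / 5) <= A.
  have : e * (n%:R ^+ 2 / 4) - sr ^+ 2 * rho ^+ 2 <= A.
    rewrite /A fro2E ipm_mixture -r2 mulr_suml.
    rewrite (_ : sr ^+ 2 * rho ^+ 2 = \sum_i `|r i| * (sr * rho ^+ 2)); last first.
      by rewrite -mulr_suml -/sr; ring.
    rewrite -sumrB; apply: ler_sum => i _.
    have := ipm_rank1_mixture r i; rewrite -/Rm -/sr; set z := ipm _ _ => hz.
    have h1 : r i * (r i * fro2 (rank1 i)) - `|r i| * (sr * rho ^+ 2) <= r i * z.
      rewrite lerBlDr -lerBlDl -mulrBr; apply: (le_trans (ler_norm _)).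
      by rewrite normrM ler_wpM2l// distrC.
    apply: le_trans h1; rewrite lerD2r mulrA -expr2 ler_wpM2l ?sqr_ge0//.
  have : sr ^+ 2 * rho ^+ 2 <= 3 * s1 * e * rho ^+ 2 by rewrite ler_wpM2r.
  have : e * (60 * s1 * rho ^+ 2) <= e * n%:R ^+ 2 by rewrite ler_wpM2l.
  lra.
(* Tested against [Rm], the other entries cancel at most half of [A]. Cauchy-Schwarz then gives
   squared norm at least [A / 4], and [A >= (3/40) n^2 / 5] suffices since [3/800 >= 1/18^2]. *)
set c := ipm (mixture p - Rm) Rm.
have cE : ipm (mixture p) Rm = A + c.
  by rewrite /c /A fro2E addrC -ipmDl subrK.
have c1 : `|c| <= sp * (sr * rho ^+ 2).
  rewrite /c -mixtureB ipm_mixture; apply: le_trans (ler_norm_sum _ _ _) _.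
  rewrite /sp mulr_suml; apply: ler_sum => i _; rewrite normrM.
  have [Si|Si] := boolP (S i).
    by rewrite /r Si subrr normr0 mul0r !mulr_ge0.
  rewrite /r (negbTE Si) subr0 ler_wpM2l//.
  have ri : r i = 0 by rewrite /r (negbTE Si).
  by have := ipm_rank1_mixture r i; rewrite ri mul0r subr0.
have c2 : c ^+ 2 <= A ^+ 2 / 4.
  have : c ^+ 2 <= sp ^+ 2 * (sr ^+ 2 * rho ^+ 4).
    rewrite -[c ^+ 2]real_normK ?num_real// (_ : rho ^+ 4 = (rho ^+ 2) ^+ 2); last by rewrite -exprM.
    by rewrite -!exprMn lerXn2r// nnegrE// !mulr_ge0.
  have : sp ^+ 2 * (sr ^+ 2 * rho ^+ 4) <= n%:R * 3 * (3 * s1 * e * rho ^+ 4).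
    have r40 : 0 <= rho ^+ 4 by rewrite exprn_ge0.
    by apply: ler_pM; rewrite ?sqr_ge0 ?mulr_ge0 ?sqr_ge0 ?ler_wpM2r.
  have : e * ((100 * 120) * n%:R * s1 * rho ^+ 4) <= e * n%:R ^+ 4 by rewrite ler_wpM2l.
  have : (e * (n%:R ^+ 2 / 5)) ^+ 2 <= A ^+ 2.
    by rewrite lerXn2r ?nnegrE// ?mulr_ge0 ?divr_ge0 ?(ltW n20)// (le_trans _ A1) ?mulr_ge0 ?divr_ge0 ?(ltW n20).
  have : (3 / 40) * (e * n%:R ^+ 4) <= e * (e * n%:R ^+ 4).
    by rewrite ler_wpM2r// mulr_ge0// exprn_ge0.
  rewrite exprMn [(_ / 5) ^+ 2]exprMn -exprM.
  lra.
have A0 : 0 < A by apply: lt_le_trans A1; apply: mulr_gt0; lra.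
have c3 : A / 2 <= A + c.
  have : `|c| <= A / 2.
    rewrite -(ler_pXn2r (n := 2)) ?nnegrE//; last by lra.
    by rewrite real_normK ?num_real//; lra.
  by rewrite ler_norml => /andP[]; lra.
have h4 : A / 4 <= fro2 (mixture p).
  have := ipm_cauchy (mixture p) Rm; rewrite cE -/A => h.
  rewrite -(ler_pM2r A0); apply: le_trans h.
  rewrite (_ : A / 4 * A = (A / 2) ^+ 2); last by field.
  by rewrite lerXn2r// nnegrE; lra.
apply: le_trans h4.
have : 3 / 40 * n%:R ^+ 2 <= e * n%:R ^+ 2 by rewrite ler_wpM2r// ltW.
by lra.
Qed.

(** Either the flat entries carry 1/8 of the mass and [flat1] applies, or the spikes carry at least
    [1/5 - 1/8 = 3/40]. *)
Lemma sparse_part_ge (z : 'I_m -> int) : let p := scaled de1 z in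
  (#|[pred i | z i != 0%R]| <= n)%N -> \sum_i p i ^+ 2 <= 3 ->
  5^-1 <= \sum_i p i ^+ 2 -> (n%:R / 18) ^+ 2 <= fro2 (mixture p).
Proof.
move=> p supp p3 p5.
have [h|h] := leP 8^-1 (\sum_(i | p i ^+ 2 <= s1^-1) p i ^+ 2).
  exact: flat1.
apply: sparse_mixture_ge => //.
  apply: leq_trans supp; apply: subset_leq_card; apply/fintype.subsetP => i.
  by rewrite !inE; apply: contraNN => /eqP zi; rewrite /p /scaled zi mulr0.
move: p5; rewrite (bigID (fun i => p i ^+ 2 <= s1^-1))/=.
under [X in _ <= _ + X]eq_bigl do rewrite -ltNge.
lra.
Qed.

(** The truncation of [cross1] is inactive: off the support a rank-one matrix meets the mixture in
    at most [sqrt (3 n) rho^2], and division by a norm of at least [n / 18] brings this below [tau].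
    In [taurho], [972 = 3 * 18^2]. *)
Lemma cross_sum_le (z : 'I_m -> int) : let p := scaled de1 z in
  (#|[pred i | z i != 0%R]| <= n)%N -> \sum_i p i ^+ 2 <= 3 ->
  (n%:R / 18) ^+ 2 <= fro2 (mixture p) ->
  \sum_(i | z i == 0%R) ipm (rank1 i) ((fnorm (mixture p))^-1 *: mixture p) ^+ 2
    <= (n%:R / 72) ^+ 2.
Proof.
move=> p supp p3 pn; set F := fnorm _.
have F1 : n%:R / 18 <= F by rewrite fnorm_geP// divr_ge0.
have F0 : 0 < F by apply: lt_le_trans F1; rewrite divr_gt0.
apply: le_trans (cross1 supp p3); rewrite -/p -/F.
apply: ler_sum => i /eqP zi; rewrite ipm_rank1.
set Y := bform _ _ _; rewrite le_min lexx/= -real_normK ?num_real// expr2 ler_wpM2r//.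
rewrite /Y -ipm_rank1 ipmZr normrM ger0_norm ?invr_ge0 ?(ltW F0)// mulrC ler_pdivrMr//.
have pi : p i = 0 by rewrite /p /scaled zi mulr0.
have := ipm_rank1_mixture p i; rewrite pi mul0r subr0 => h.
apply: (le_trans h).
have sump : (\sum_i `|p i|) ^+ 2 <= n%:R * 3.
  rewrite (_ : \sum_i `|p i| = \sum_(j in [pred j | z j != 0%R]) `|p j|); last first.
    rewrite [RHS]big_mkcond/=; apply: eq_bigr => j _; rewrite inE.
    by case: eqP => //= zj; rewrite /p /scaled zj mulr0 normr0.
  apply: le_trans (sum_le_card _ _) _; apply: ler_pM => //.
  - by apply: sumr_ge0 => j _; exact: sqr_ge0.
  - by rewrite ler_nat.
  - apply: le_trans p3; rewrite [leRHS](bigID [pred j | z j != 0%R])/= lerDl.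
    by apply: sumr_ge0 => j _; exact: sqr_ge0.
set sp := \sum_j `|p j| in sump *.
have sp0 : 0 <= sp by apply: sumr_ge0.
apply: (@le_trans _ _ (tau * (n%:R / 18))); last by rewrite ler_wpM2l.
rewrite -(ler_pXn2r (n := 2)) ?nnegrE ?mulr_ge0 ?sqr_ge0 ?divr_ge0//.
rewrite exprMn -exprM [leRHS]exprMn exprMn exprVn.
have : sp ^+ 2 * rho ^+ 4 <= n%:R * 3 * rho ^+ 4 by rewrite ler_wpM2r// exprn_ge0.
have := taurho; rewrite [(2 * 2)%N]/=.
by rewrite -[18 ^+ 2]natrX; lra.
Qed.

(** The budget: a grid point supplies [n / 18]. In the flat case rounding costs [n / 36]; otherwise
    rounding and the discarded entries cost [n / 72] each. *)
Lemma unit_mixture_ge (q : 'I_m -> R) : \sum_i q i ^+ 2 = 1 ->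
  n%:R / 36 <= fnorm (mixture q).
Proof.
move=> q1; pose S : pred 'I_m := fun i => n%:R^-1 < q i ^+ 2.
have inS i : (i \in S) = S i by [].
have qS : \sum_(i | S i) q i ^+ 2 + \sum_(i | ~~ S i) q i ^+ 2 = 1.
  by rewrite -q1 [RHS](bigID S).
have [flat|spiky] := leP 2^-1 (\sum_(i | ~~ S i) q i ^+ 2).
  have [z [z1 z2 z3]] := round_mixture q de00.
  pose q' := scaled de0 z.
  have dq : \sum_i (q i - q' i) ^+ 2 <= (36 * 36)^-1.
    apply: le_trans de0m; rewrite -[m in leRHS]card_ord -sum1_card natr_sum mulr_suml.
    apply: ler_sum => i _; rewrite mul1r -[leLHS]real_normK ?num_real//.
    by rewrite lerXn2r ?nnegrE// ltW.
  have q'3 : \sum_i q' i ^+ 2 <= 3.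
    apply: (@le_trans _ _ (\sum_i (2 * q i ^+ 2 + 2 * (q i - q' i) ^+ 2))).
      by apply: ler_sum => i _; have := sqr_ge0 (2 * q i - q' i); lra.
    by rewrite big_split/= -!mulr_sumr q1; lra.
  (* Rounding keeps small entries small, [q'_i^2 <= 2 q_i^2 + 2 de0^2 <= 4 / n], and retains a mass
     of at least [1/4 - 1/36^2]. *)
  have q'8 : 8^-1 <= \sum_(i | q' i ^+ 2 <= 4 / n%:R) q' i ^+ 2.
    have sub i : ~~ S i -> q' i ^+ 2 <= 4 / n%:R.
      rewrite -leNgt => qi.
      have : de0 ^+ 2 <= n%:R^-1 by rewrite -[leRHS]mul1r ler_pdivlMr// mulrC.
      have : (q i - q' i) ^+ 2 <= de0 ^+ 2.
        by rewrite -[leLHS]real_normK ?num_real// lerXn2r ?nnegrE// ltW.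
      by have := sqr_ge0 (2 * q i - q' i); lra.
    apply: (@le_trans _ _ (\sum_(i | ~~ S i) q' i ^+ 2)); last first.
      rewrite [leRHS]big_mkcond [leLHS]big_mkcond; apply: ler_sum => i _.
      case: ifPn => // Si; first by rewrite sub.
      by case: ifP => // _; exact: sqr_ge0.
    have : \sum_(i | ~~ S i) (q i ^+ 2 / 2 - (q i - q' i) ^+ 2) <= \sum_(i | ~~ S i) q' i ^+ 2.
      by apply: ler_sum => i _; have := sqr_ge0 (q i / 2 - q' i); have := sqr_ge0 (q i - 2 * q' i); lra.
    rewrite sumrB -mulr_suml.
    have : \sum_(i | ~~ S i) (q i - q' i) ^+ 2 <= \sum_i (q i - q' i) ^+ 2.
      by rewrite [leRHS](bigID S)/= lerDr; apply: sumr_ge0 => i _; exact: sqr_ge0.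
    by lra.
  have h1 := flat0 q'3 q'8; rewrite -fnorm_geP ?divr_ge0// in h1.
  have h2 : fnorm (mixture (fun i => q i - q' i)) <= n%:R / 36.
    rewrite fnorm_leP ?divr_ge0//; apply: (le_trans z3).
    have : #|[pred i | q i != 0]|%:R <= m%:R :> R.
      by rewrite ler_nat -[leqRHS](card_ord m) max_card.
    move=> cm; rewrite exprMn exprVn [36 ^+ 2]expr2 mulrC ler_wpM2l ?sqr_ge0//.
    apply: le_trans (le_trans _ de0m) _ => //.
    by rewrite ler_wpM2r ?sqr_ge0.
  have := fnormD (mixture q) (- mixture (fun i => q i - q' i)).
  rewrite fnormN {1}(_ : mixture q - _ = mixture q'); last first.
    by rewrite mixtureB opprB addrC subrK.
  by move: h1 h2; rewrite -/q'; lra.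
pose p i := if S i then q i else 0.
pose u i := if S i then 0 else q i.
have qpu : mixture q = mixture p + mixture u.
  rewrite -mixtureD; apply: eq_bigr => i _; congr (_ *: _); rewrite /p /u.
  by case: ifP; rewrite ?addr0 ?add0r.
have p2 : \sum_i p i ^+ 2 = \sum_(i | S i) q i ^+ 2.
  by rewrite [RHS]big_mkcond; apply: eq_bigr => i _; rewrite /p; case: ifP; rewrite ?expr0n.
have u2 : \sum_i u i ^+ 2 <= 1.
  rewrite -q1; apply: ler_sum => i _; rewrite /u.
  by case: ifP => // _; rewrite expr0n sqr_ge0.
have cS : (#|[pred i | S i]| <= n)%N.
  rewrite -(ler_nat R).
  by have := @card_big_le _ q n%:R^-1 1; rewrite invr_gt0 q1 mul1r invrK; apply.
have [z [z1 z2 z3]] := round_mixture p de10.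
pose p' := scaled de1 z.
have zS i : z i != 0 -> S i.
  by apply: contraNT => Si; rewrite z2// /p (negbTE Si).
have supp : (#|[pred i | z i != 0%R]| <= n)%N.
  apply: leq_trans cS; apply: subset_leq_card; apply/fintype.subsetP => i.
  by rewrite !inE; exact: zS.
have dp : \sum_i (p i - p' i) ^+ 2 <= (72 * 72)^-1.
  apply: le_trans de1n; apply: (@le_trans _ _ (\sum_(i in S) de1 ^+ 2)).
    rewrite [leRHS]big_mkcond; apply: ler_sum => i _; rewrite inS; case: ifPn => Si.
      by rewrite -[leLHS]real_normK ?num_real// lerXn2r ?nnegrE// ltW.
    by rewrite /p' /scaled z2 /p (negbTE Si)// mulr0 subr0 expr0n.
  by rewrite sumr_const -[leLHS]mulr_natl ler_wpM2r ?sqr_ge0// ler_nat.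
have p'3 : \sum_i p' i ^+ 2 <= 3.
  apply: (@le_trans _ _ (\sum_i (2 * p i ^+ 2 + 2 * (p i - p' i) ^+ 2))).
    by apply: ler_sum => i _; have := sqr_ge0 (2 * p i - p' i); lra.
  rewrite big_split/= -!mulr_sumr.
  have : \sum_(i | ~~ S i) q i ^+ 2 >= 0 by apply: sumr_ge0 => i _; exact: sqr_ge0.
  by lra.
have p'5 : 5^-1 <= \sum_i p' i ^+ 2.
  have : \sum_i (p i ^+ 2 / 2 - (p i - p' i) ^+ 2) <= \sum_i p' i ^+ 2.
    by apply: ler_sum => i _; have := sqr_ge0 (p i - 2 * p' i); lra.
  by rewrite sumrB -mulr_suml; lra.
have h1 := sparse_part_ge supp p'3 p'5; rewrite -/p' in h1.
have h2 := cross_sum_le supp p'3 h1; rewrite -/p' in h2.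
rewrite -fnorm_geP ?divr_ge0// in h1.
set F := fnorm (mixture p') in h1 h2.
have F0 : 0 < F by apply: lt_le_trans h1; rewrite divr_gt0.
(* Testing [mixture q] against the direction of [mixture p'] lets the discarded entries enter only
   through inner products with it. They all sit where [z] vanishes, so [cross_sum_le] controls
   them. *)
set N := F^-1 *: mixture p' in h2.
have N1 : fnorm N = 1.
  by rewrite /fnorm fro2Z -fnorm2 -/F -exprMn mulVf ?gt_eqF// expr1n sqrtr1.
have h3 : fnorm (mixture (fun i => p i - p' i)) <= n%:R / 72.
  rewrite fnorm_leP ?divr_ge0//; apply: (le_trans z3).
  have : #|[pred i | p i != 0]|%:R <= n%:R :> R.
    rewrite ler_nat; apply: leq_trans cS; apply: subset_leq_card; apply/fintype.subsetP => i.
    by rewrite !inE /p; case: ifP => //; rewrite eqxx.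
  move=> cm; rewrite exprMn exprVn [72 ^+ 2]expr2 mulrC ler_wpM2l ?sqr_ge0//.
  apply: le_trans (le_trans _ de1n) _ => //.
  by rewrite ler_wpM2r ?sqr_ge0.
have h4 : `|ipm (mixture u) N| <= n%:R / 72.
  rewrite -(ler_pXn2r (n := 2)) ?nnegrE ?divr_ge0// real_normK ?num_real//.
  rewrite ipm_mixture (_ : \sum_i _ = \sum_(i | z i == 0%R) u i * ipm (rank1 i) N); last first.
    rewrite [RHS]big_mkcond/=; apply: eq_bigr => i _; case: ifPn => // /zS Si.
    by rewrite /u Si mul0r.
  apply: (le_trans (cauchy_sum [pred i | z i == 0%R] u _)); apply: (le_trans _ h2).
  rewrite -[leRHS]mul1r ler_wpM2r//; first by apply: sumr_ge0 => i _; exact: sqr_ge0.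
  apply: le_trans u2; rewrite [leRHS](bigID [pred i | z i == 0%R])/= lerDl.
  by apply: sumr_ge0 => i _; exact: sqr_ge0.
have h5 : ipm (mixture q) N = ipm (mixture (fun i => p i - p' i)) N + F + ipm (mixture u) N.
  have e : mixture q = mixture (fun i => p i - p' i) + mixture p' + mixture u.
    by rewrite mixtureB subrK.
  rewrite e !ipmDl; congr (_ + _ + _).
  by rewrite /N ipmZr -fro2E -fnorm2 -/F expr2 mulrA mulVf ?gt_eqF// mul1r.
have h6 : `|ipm (mixture (fun i => p i - p' i)) N| <= n%:R / 72.
  by apply: le_trans (ipm_le_fnorm _ _) _; rewrite N1 mulr1.
have h7 : ipm (mixture q) N <= fnorm (mixture q).
  by apply: le_trans (ler_norm _) _; apply: le_trans (ipm_le_fnorm _ _) _; rewrite N1 mulr1.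
move: h4 h6; rewrite !ler_norml => /andP[h41 h42] /andP[h61 h62].
by apply: le_trans h7; rewrite h5; lra.
Qed.

Lemma mixture_ge (q : 'I_m -> R) :
  (n%:R / 36) ^+ 2 * \sum_i q i ^+ 2 <= fro2 (mixture q).
Proof.
set s := \sum_i _; have s0 : 0 <= s by apply: sumr_ge0 => i _; exact: sqr_ge0.
have [->|sn0] := eqVneq s 0; first by rewrite mulr0 fro2_ge0.
have sp : 0 < s by rewrite lt_def sn0.
pose t := Num.sqrt s; have t0 : 0 < t by rewrite sqrtr_gt0.
have t2 : t ^+ 2 = s by rewrite sqr_sqrtr.
have := @unit_mixture_ge (fun i => t^-1 * q i).
rewrite mixtureZ fnorm_geP ?divr_ge0// fro2Z exprVn t2 => h.
rewrite mulrC -ler_pdivlMl//; apply: h.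
by under eq_bigr do rewrite exprMn exprVn t2; rewrite -mulr_sumr -/s mulVf.
Qed.

End gram_lower_bound.

(** * Grids and nets *)

Section grids.
Context {R : realType}.

(** Bounded integer vectors as a finite type: per entry [None] codes 0 and [Some (s, k)] codes
    [k + 1] with sign bit [s], so that codes are unique. The count below does not involve [B]. *)
Definition grid (m B : nat) := {ffun 'I_m -> option (bool * 'I_B)}.

Definition gridz m B (g : grid m B) (i : 'I_m) : int :=
  if g i is Some (s, k) then (-1) ^+ s * (k.+1)%:Z else 0.

Lemma gridz_surj m B (z : 'I_m -> int) : (forall i, `|z i| <= B%:Z) ->
  exists g : grid m B, gridz g =1 z.
Proof.
move=> zB.
have H i : exists o : option (bool * 'I_B),
    (if o is Some (s, k) then (-1) ^+ s * (k.+1)%:Z else 0) = z i.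
  have [z0|z0] := eqVneq (z i) 0; first by exists None.
  have zp : (0 < `|z i|%N)%N by rewrite absz_gt0.
  have zB' : (`|z i|%N.-1 < B)%N.
    by rewrite prednK//; have := zB i; rewrite -abszE lez_nat.
  exists (Some ((z i < 0)%R, Ordinal zB')) => /=.
  by rewrite prednK// [RHS]intEsign.
have [f Hf] := choice H.
exists [ffun i => f i] => i; rewrite /gridz ffunE; exact: Hf.
Qed.

Lemma sum_geometric_le (B : nat) : \sum_(k < B) expR (- (k.+1%:R ^+ 2)) <= 1 :> R.
Proof.
suff H : \sum_(k < B) expR (- (k.+1%:R ^+ 2)) <= 1 - 2^-1 ^+ B :> R.
  by apply: (le_trans H); rewrite gerBl exprn_ge0.
elim: B => [|B IH]; first by rewrite big_ord0 expr0 subrr.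
rewrite big_ord_recr/=.
have : expR (- (B.+1%:R ^+ 2)) <= 2^-1 ^+ B.+1 :> R.
  apply: (@le_trans _ _ (expR (- (B.+1%:R)))).
    rewrite ler_expR lerN2 expr2 -natrM ler_nat leq_pmulr//.
  rewrite expRN exprVn lef_pV2 ?posrE ?expR_gt0 ?exprn_gt0//.
  rewrite -[B.+1%:R]mulr1 expRM_natl lerXn2r ?nnegrE ?expR_ge0//.
  by have := expR_ge1Dx (1 : R); lra.
move: IH; rewrite (exprS 2^-1); lra.
Qed.

(** Weigh a nonzero entry [z] by [r exp (- z^2)]. The total weight is at most [(1 + 2 r)^m], whereas
    each counted point weighs at least [r^k exp (- K)]. Small [r] suits sparse vectors, [r = 1]
    dense ones. *)
Lemma grid_count m B (k : nat) (K r : R) : 0 < r <= 1 ->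
  #|[pred g : grid m B | (#|[pred i | gridz g i != 0]| <= k)%N &&
      (\sum_i (gridz g i)%:~R ^+ 2 <= K)]|%:R <=
  r^-1 ^+ k * expR K * expR (2 * r * m%:R) :> R.
Proof.
move=> /andP[r0 r1].
pose om (o : option (bool * 'I_B)) : R :=
  if o is Some (s, k) then r * expR (- (k.+1%:R ^+ 2)) else 1.
have om0 o : 0 <= om o.
  by case: o => [[s j]|]//=; rewrite mulr_ge0 ?expR_ge0 ?(ltW r0).
have sum_om : \sum_o om o <= 1 + 2 * r.
  rewrite (bigD1 None)//= lerD2l.
  rewrite (reindex_omap Some id)/=; last by case.
  rewrite (eq_bigl predT); last by move=> j; rewrite eqxx.
  rewrite (eq_bigr (fun p => om (Some (p.1, p.2)))); last by case.
  rewrite -(pair_bigA _ (fun s j => om (Some (s, j))))/=.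
  rewrite big_bool/= -!mulr_sumr -mulr2n -mulr_natl -mulrA.
  have := ler_wpM2l (ltW r0) (sum_geometric_le B); rewrite mulr1; lra.
have prod_om (g : grid m B) : \prod_i om (g i) =
    r ^+ #|[pred i | gridz g i != 0]| * expR (- \sum_i (gridz g i)%:~R ^+ 2).
  rewrite -prodr_const -sumrN expR_sum [X in _ = X * _]big_mkcond -big_split/=; apply: eq_bigr => i _.
  rewrite /om /gridz inE; case: (g i) => [[s j]|]; last first.
    by rewrite eqxx expr0n oppr0 expR0 mulr1.
  rewrite mulf_eq0 signr_eq0/= rmorphM/= rmorphXn/= rmorphN1 exprMn.
  by rewrite -exprM mulnC exprM sqrrN expr1n expr1n mul1r.
rewrite -sum1_card natr_sum.
apply: (@le_trans _ _ (\sum_(g : grid m B) r^-1 ^+ k * expR K * \prod_i om (g i))).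
  rewrite big_mkcond/=; apply: ler_sum => g _; case: ifP => [|_]; last first.
    by rewrite !mulr_ge0 ?exprn_ge0 ?invr_ge0 ?(ltW r0) ?expR_ge0 ?prodr_ge0.
  rewrite inE => /andP[hk hK]; rewrite prod_om mulrACA -expRD.
  rewrite -[leLHS]mulr1; apply: ler_pM => //.
    rewrite exprVn mulrC -ler_pdivrMr ?invr_gt0 ?exprn_gt0// div1r invrK.
    by rewrite ler_wiXn2l// ltW.
  by rewrite -[leLHS]expR0 ler_expR subr_ge0.
rewrite -mulr_sumr ler_wpM2l ?mulr_ge0 ?exprn_ge0 ?invr_ge0 ?(ltW r0) ?expR_ge0//.
have := bigA_distr_bigA (fun (i : 'I_m) o => om o); rewrite /= => <-.
rewrite prodr_const card_ord mulrC expRM_natl lerXn2r ?nnegrE ?expR_ge0//.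
  by apply: sumr_ge0.
by apply: (le_trans sum_om); exact: expR_ge1Dx.
Qed.

End grids.

(** * Operator norm from a net of the unit ball *)

Section operator_norm_net.
Context {R : realType} (n : nat).
Hypothesis n0 : (0 < n)%N.

Definition netv (z : 'I_n -> int) : 'cV[R]_n :=
  \col_k ((z k)%:~R / (4 * Num.sqrt n%:R)).

Let nR0 : 0 < n%:R :> R. Proof. by rewrite ltr0n. Qed.
Let s := 4 * Num.sqrt n%:R : R.
Let s0 : 0 < s. Proof. by rewrite mulr_gt0// sqrtr_gt0. Qed.
Let s2 : s ^+ 2 = 16 * n%:R.
Proof. by rewrite exprMn sqr_sqrtr ?(ltW nR0)// -natrX. Qed.

Lemma netv_sum z : nrm2 (netv z) <= 1 -> \sum_k ((z k)%:~R ^+ 2 : R) <= 16 * n%:R.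
Proof.
rewrite /nrm2; under eq_bigr do rewrite mxE -/s expr_div_n.
by rewrite -mulr_suml ler_pdivrMr ?exprn_gt0// mul1r s2.
Qed.

(** Coordinates are rounded towards zero, so the norm does not grow; [n] errors of at most
    [1 / (4 sqrt n)] make a distance of at most 1/4. *)
Lemma netv_approx (x : 'cV[R]_n) : nrm2 x <= 1 -> exists2 z : 'I_n -> int,
  nrm2 (netv z) <= 1 & nrm2 (4 *: (x - netv z)) <= 1.
Proof.
move=> x1.
have H k : exists z : int, [/\ ((z%:~R / s) ^+ 2 <= x k 0 ^+ 2) & ((x k 0 - z%:~R / s) ^+ 2 <= s ^- 2)].
  have /andP[f1 f2] := floor_itv (`|x k 0| * s).
  set f := Num.floor _ in f1 f2.
  have f0 : 0 <= f%:~R :> R by rewrite ler0z floor_ge0 mulr_ge0// ltW.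
  have g1 : f%:~R / s <= `|x k 0| by rewrite ler_pdivrMr.
  have g2 : `|x k 0| - f%:~R / s <= s^-1.
    rewrite lerBlDr -[X in X + _]mul1r -mulrDl ler_pdivlMr// ltW//; move: f2; rewrite intrD; lra.
  have g0 : 0 <= f%:~R / s by rewrite divr_ge0// ltW.
  have [xk|xk] := leP 0 (x k 0).
    exists f; rewrite ger0_norm// in g1 g2; split.
      by rewrite lerXn2r ?nnegrE.
    by rewrite -exprVn lerXn2r ?nnegrE ?subr_ge0// invr_ge0 ltW.
  exists (- f); rewrite ltr0_norm// in g1 g2; split.
    by rewrite rmorphN/= mulNr sqrrN -[leRHS]sqrrN lerXn2r ?nnegrE// oppr_ge0 ltW.
  rewrite rmorphN/= mulNr opprK -sqrrN opprD -exprVn lerXn2r ?nnegrE ?subr_ge0//.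
  by rewrite invr_ge0 ltW.
have [z Hz] := choice H; exists z.
  apply: le_trans x1; apply: ler_sum => k _; rewrite mxE.
  by have [] := Hz k.
apply: (@le_trans _ _ (\sum_(k < n) 16 * s ^- 2)).
  apply: ler_sum => k _; rewrite !mxE exprMn -natrX ler_wpM2l//.
  by have [] := Hz k.
by rewrite sumr_const card_ord s2 -mulr_natl le_eqVlt; apply/orP; left; apply/eqP; field; rewrite gt_eqF.
Qed.

Lemma bform_le_fnorm (M : 'M[R]_n) x y :
  nrm2 x <= 1 -> nrm2 y <= 1 -> bform M x y <= fnorm M.
Proof.
move=> x1 y1.
have -> : bform M x y = ipm (x *m y^T) M.
  rewrite bformE; apply: eq_bigr => k _; apply: eq_bigr => l _.
  by rewrite mxE big_ord1 mxE mulrAC.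
apply: le_trans (ler_norm _) _; apply: (le_trans (ipm_le_fnorm _ _)).
rewrite ler_piMl ?fnorm_ge0// fnorm_leP// expr1n.
have -> : fro2 (x *m y^T) = nrm2 x * nrm2 y.
  rewrite /fro2 /nrm2 mulr_suml; apply: eq_bigr => k _; rewrite mulr_sumr.
  by apply: eq_bigr => l _; rewrite mxE big_ord1 mxE exprMn.
by rewrite mulr_ile1// nrm2_ge0.
Qed.

(** If [S] is the supremum over the unit balls, moving each argument to the net costs [S / 4], so
    [S <= 1/2 + S/2]. The conclusion says that the operator norm is at most 1, in the form in which
    positivity of a block matrix uses it. *)
Lemma net_bform (M : 'M[R]_n) :
  (forall z z', nrm2 (netv z) <= 1 -> nrm2 (netv z') <= 1 ->
    bform M (netv z) (netv z') <= 2^-1) ->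
  forall x y, 2 * bform M x y <= nrm2 x + nrm2 y.
Proof.
move=> H.
pose S := [set r | exists x y, [/\ nrm2 x <= 1, nrm2 y <= 1 & r = bform M x y]].
have nrm20 : nrm2 (0 : 'cV[R]_n) = 0.
  by rewrite /nrm2 big1// => k _; rewrite mxE expr0n.
have Sub : has_sup S.
  split; first by exists (bform M 0 0), 0, 0; rewrite nrm20.
  by exists (fnorm M) => _ [x [y [x1 y1 ->]]]; exact: bform_le_fnorm.
have SL x y : nrm2 x <= 1 -> nrm2 y <= 1 -> bform M x y <= sup S.
  by move=> x1 y1; apply: ub_le_sup => //; [case: Sub|exists x, y].
have L1 : sup S <= 1.
  suff : sup S <= 2^-1 + 4^-1 * sup S + 4^-1 * sup S by lra.
  apply: sup_le_ub; first by case: Sub.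
  move=> _ [x [y [x1 y1 ->]]].
  have [z z1 zx] := netv_approx x1; have [z' z'1 z'y] := netv_approx y1.
  have e : bform M x y = bform M (netv z) (netv z') + 4^-1 * bform M (4 *: (x - netv z)) y +
      4^-1 * bform M (netv z) (4 *: (y - netv z')).
    have {1}-> : x = (x - netv z) + netv z by rewrite subrK.
    rewrite bformDl bformZl bformZr.
    have {2}-> : y = (y - netv z') + netv z' by rewrite subrK.
    by rewrite bformDr; field.
  have h1 := H _ _ z1 z'1; have h2 := SL _ _ zx y1; have h3 := SL _ _ z1 z'y.
  by rewrite e; lra.
have B1 x y : nrm2 x <= 1 -> nrm2 y <= 1 -> bform M x y <= 1.
  by move=> x1 y1; apply: (le_trans (SL _ _ x1 y1)).
have nz k (x : 'cV[R]_k) : nrm2 x = 0 -> x = 0.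
  move=> x0; apply/colP => j; rewrite mxE.
  have : x j 0 ^+ 2 <= 0.
    by rewrite -x0 /nrm2 (bigD1 j)//= lerDl; apply: sumr_ge0 => i _; exact: sqr_ge0.
  by rewrite le_eqVlt ltNge sqr_ge0 orbF sqrf_eq0 => /eqP.
move=> x y.
have [/eqP/nz ->|x0] := boolP (nrm2 x == 0).
  by rewrite nrm20 add0r -[0 : 'cV[R]_n](scale0r 0) bformZl mul0r mulr0 nrm2_ge0.
have [/eqP/nz ->|y0] := boolP (nrm2 y == 0).
  by rewrite nrm20 addr0 -[0 : 'cV[R]_n](scale0r 0) bformZr mul0r mulr0 nrm2_ge0.
have xp : 0 < nrm2 x by rewrite lt_def x0 nrm2_ge0.
have yp : 0 < nrm2 y by rewrite lt_def y0 nrm2_ge0.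
pose sx := Num.sqrt (nrm2 x); pose sy := Num.sqrt (nrm2 y).
have sx0 : 0 < sx by rewrite sqrtr_gt0.
have sy0 : 0 < sy by rewrite sqrtr_gt0.
have sx2 : sx ^+ 2 = nrm2 x by rewrite sqr_sqrtr ?nrm2_ge0.
have sy2 : sy ^+ 2 = nrm2 y by rewrite sqr_sqrtr ?nrm2_ge0.
have nZ k c (u : 'cV[R]_k) : nrm2 (c *: u) = c ^+ 2 * nrm2 u.
  by rewrite /nrm2 mulr_sumr; apply: eq_bigr => j _; rewrite mxE exprMn.
have := B1 (sx^-1 *: x) (sy^-1 *: y).
rewrite !nZ !exprVn sx2 sy2 !mulVf// => /(_ (lexx _) (lexx _)).
rewrite bformZl bformZr mulrA -invfM ler_pdivrMl ?mulr_gt0// mulr1 => h.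
by have := sqr_ge0 (sx - sy); rewrite -sx2 -sy2; lra.
Qed.

End operator_norm_net.

(** * Measurability of the ellipsoid event *)

Section ellipsoid_measurable.
Context {R : realType}.

Lemma matrix_cluster d (N : R) (u : nat -> 'M[R]_d) :
  (forall k i j, `|u k i j| <= N) ->
  exists p : 'M[R]_d, forall k (e : R), 0 < e ->
    exists2 k', (k <= k')%N & forall i j, `|p i j - u k' i j| < e.
Proof.
move=> uN.
have cA : compact [set v : 'rV[R]_(d * d) | forall i, v ord0 i \in `[(- N), N]].
  apply: (@rV_compact _ _ (fun=> `[(- N), N]%classic)).
  by move=> _; exact: segment_compact.
pose F := (fun k => mxvec (u k)) @ \oo.
have FA : F [set v : 'rV[R]_(d * d) | forall i, v ord0 i \in `[(- N), N]].
  exists 0%N => // k _ /= i; case/mxvec_indexP: i => i j; rewrite mxvecE in_itv/= -ler_norml.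
  exact: uN.
have [r [_ clr]] := cA F _ FA.
exists (vec_mx r) => k e e0.
have FG : F [set v | exists2 k', (k <= k')%N & v = mxvec (u k')].
  by exists k => // k' /= kk'; exists k'.
have [v [[k' kk' ->] [_ Bv]]] := clr _ _ FG (nbhsx_ballx r e e0).
exists k' => // i j; have := Bv ord0 (mxvec_index i j).
by rewrite mxvecE /ball/= mxE.
Qed.

Lemma bform_fnorm d (M : 'M[R]_d) x : `|bform M x x| <= fnorm M * nrm2 x.
Proof.
have -> : bform M x x = ipm (x *m x^T) M.
  rewrite bformE; apply: eq_bigr => k _; apply: eq_bigr => l _.
  by rewrite mxE big_ord1 mxE mulrAC.
apply: (le_trans (ipm_le_fnorm _ _)); rewrite mulrC ler_wpM2l ?fnorm_ge0//.
rewrite fnorm_leP ?nrm2_ge0//.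
rewrite expr2 /fro2 /nrm2 mulr_suml; apply: ler_sum => k _; rewrite mulr_sumr.
by apply: ler_sum => l _; rewrite mxE big_ord1 mxE exprMn.
Qed.

Lemma fnorm_entries d (M : 'M[R]_d) e : 0 <= e ->
  (forall i j, `|M i j| <= e) -> fnorm M <= d%:R * e.
Proof.
move=> e0 Me; rewrite fnorm_leP ?mulr_ge0// exprMn.
apply: (@le_trans _ _ (\sum_(i < d) \sum_(j < d) e ^+ 2)).
  apply: ler_sum => i _; apply: ler_sum => j _.
  by rewrite -[leLHS]real_normK ?num_real// lerXn2r ?nnegrE.
have E (x : R) : x *+ d *+ d = d%:R ^+ 2 * x.
  by rewrite -mulrnA -natrX mulr_natl mulnn.
by rewrite !sumr_const !card_ord E.
Qed.

(** All conditions but symmetry are relaxed by [e], so that rational matrices qualify. *)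
Definition near_ellipsoid d m (v : 'I_m -> 'cV[R]_d) (e : R) (L : 'M[R]_d) :=
  [/\ L^T = L, forall x, - (e * nrm2 x) <= bform L x x &
      forall i, `|bform L (v i) (v i) - 1| <= e].

Lemma rat_near (x e : R) : 0 < e -> exists q : rat, `|ratr q - x| <= e.
Proof.
move=> e0; have [|q] := @rat_in_itvoo R (x - e) (x + e); first by lra.
by rewrite in_itv/= => /andP[q1 q2]; exists q; rewrite ler_norml; lra.
Qed.

(** Replaces a quantifier over real matrices by countable ones. The bound [N] is chosen before [k],
    so the approximations stay in a compact set and a cluster point solves the equations exactly. *)
Lemma ellipsoid_throughP d m (v : 'I_m -> 'cV[R]_d) :
  ellipsoid_through v <->
  exists N : nat, forall k : nat, exists L : 'M[rat]_d,
    (forall i j, `|ratr (L i j)| <= N%:R :> R) /\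
    near_ellipsoid v k.+1%:R^-1 (map_mx ratr L).
Proof.
split=> [[L [[Ls L0] L1]]|[N HN]].
  have L0' x : 0 <= bform L x x by exact: L0.
  pose B := \sum_i \sum_j `|L i j|; exists (Num.bound (B + 1)) => k.
  have LB i j : `|L i j| <= B.
    rewrite /B (bigD1 i)//= (bigD1 j)//= -addrA lerDl addr_ge0//.
      by apply: sumr_ge0.
    by apply: sumr_ge0 => ? _; apply: sumr_ge0.
  set e := k.+1%:R^-1; have e0 : 0 < e by rewrite invr_gt0 ltr0n.
  have e1 : e <= 1 by rewrite invf_le1 ?ltr0n// ler1n.
  pose S := \sum_i nrm2 (v i).
  have S0 : 0 <= S by apply: sumr_ge0 => i _; exact: nrm2_ge0.
  pose D := (d%:R + 1) * (1 + S).
  have D1 : 1 <= D by rewrite /D; have : 0 <= d%:R :> R by []; nra.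
  have D0 : 0 < D by lra.
  pose eta := e / D; have eta0 : 0 < eta by rewrite divr_gt0.
  have eta1 : eta <= 1 by rewrite ler_pdivrMr//; lra.
  have [f Hf] := choice (fun ij : 'I_d * 'I_d => rat_near (L ij.1 ij.2) eta0).
  (* Both entries of a symmetric pair come from the upper triangle, which keeps the rational matrix
     symmetric. *)
  pose L' : 'M[rat]_d := \matrix_(i, j) if (i <= j)%N then f (i, j) else f (j, i).
  have L'L i j : `|ratr (L' i j) - L i j| <= eta.
    rewrite mxE; case: ifP => _; first exact: (Hf (i, j)).
    by rewrite -[in L i j]Ls mxE; exact: (Hf (j, i)).
  exists L'; split=> [i j|].
    apply: ltW; apply: le_lt_trans (ltr_bound _).
    rewrite -[ratr _](subrK (L i j)); apply: le_trans (ler_normD _ _) _.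
    by rewrite addrC lerD// (le_trans (L'L i j)).
  have dx x : `|bform (map_mx ratr L') x x - bform L x x| <= d%:R * eta * nrm2 x.
    rewrite -bformB; apply: (le_trans (bform_fnorm _ _)).
    rewrite ler_wpM2r ?nrm2_ge0//; apply: fnorm_entries; first exact: ltW.
    by move=> i j; rewrite mxE [X in X + _]mxE [X in _ + X]mxE; exact: L'L.
  have deta : d%:R * eta * (1 + S) <= e.
    have d10 : 0 < d%:R + 1 :> R by rewrite ltr_wpDl.
    have S10 : 0 < 1 + S by lra.
    rewrite /eta /D [leLHS](_ : _ = e * (d%:R / (d%:R + 1))); last first.
      by field; rewrite !gt_eqF.
    rewrite -[leRHS]mulr1 ler_wpM2l ?(ltW e0)// ler_pdivrMr// mul1r; lra.
  have de0 : 0 <= d%:R * eta by rewrite mulr_ge0// ltW.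
  split.
  - apply/matrixP => i j; rewrite !mxE; congr ratr.
    by case: ltngtP => // ij; congr (f (_, _)); apply: val_inj.
  - move=> x; have := dx x; rewrite ler_norml => /andP[h _].
    have : d%:R * eta * nrm2 x <= e * nrm2 x.
      rewrite ler_wpM2r ?nrm2_ge0//; nra.
    by have := L0' x; lra.
  - move=> i; have := dx (v i); have -> : bform L (v i) (v i) = 1 by exact: L1.
    move=> h; apply: (le_trans h); apply: le_trans deta; rewrite ler_wpM2l//.
    rewrite /S (bigD1 i)//= addrCA lerDl addr_ge0//.
    by apply: sumr_ge0 => j _; exact: nrm2_ge0.
have [u Hu] := choice HN.
pose U k : 'M[R]_d := map_mx ratr (u k).
have [p Hp] : exists p : 'M[R]_d, forall k (e : R), 0 < e ->
    exists2 k', (k <= k')%N & forall i j, `|p i j - U k' i j| < e.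
  by apply: (@matrix_cluster _ N%:R) => k i j; rewrite mxE; exact: (Hu k).1.
have Hp' (e : R) : 0 < e -> exists q : 'M[R]_d,
    near_ellipsoid v e q /\ forall i j, `|p i j - q i j| <= e.
  move=> e0; have [k' kk' H] := Hp (Num.bound e^-1) e e0.
  exists (U k'); split; last by move=> i j; exact: ltW.
  have ke : k'.+1%:R^-1 <= e.
    rewrite -[leRHS]invrK lef_pV2 ?posrE ?ltr0n ?invr_gt0//.
    apply: (le_trans (ltW (ltr_bound _))); rewrite ler_nat.
    by apply: leq_trans kk' _.
  have [_ [h1 h2 h3]] := Hu k'; split=> //.
  - move=> x; apply: le_trans (h2 x); rewrite lerN2 ler_wpM2r//; exact: nrm2_ge0.
  - by move=> i; apply: le_trans (h3 i) _.
have small (y C : R) : (forall e : R, 0 < e -> y <= C * e) -> y <= 0.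
  move=> h; rewrite leNgt; apply/negP => y0.
  have := h (y / (2 * (`|C| + 1))); rewrite divr_gt0 ?mulr_gt0 ?ltr_wpDl// => /(_ isT).
  have c0 : 0 < 2 * (`|C| + 1) by rewrite mulr_gt0 ?ltr_wpDl.
  rewrite mulrA ler_pdivlMr//; have := ler_norm C; nra.
have dbl (q : 'M[R]_d) (e : R) x : (forall i j, `|p i j - q i j| <= e) -> 0 < e ->
    `|bform p x x - bform q x x| <= d%:R * e * nrm2 x.
  move=> h e0; rewrite -bformB; apply: (le_trans (bform_fnorm _ _)).
  rewrite ler_wpM2r ?nrm2_ge0//; apply: fnorm_entries; first exact: ltW.
  by move=> i j; rewrite 2!mxE.
exists p; split; first split.
- apply/matrixP => i j; rewrite mxE; apply/eqP; rewrite -subr_eq0 -normr_le0.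
  apply: (small _ 2) => e e0; have [q [[qs _ _] pq]] := Hp' e e0.
  have qE : q i j = q j i by rewrite -[in LHS]qs mxE.
  have -> : p j i - p i j = (p j i - q j i) - (p i j - q i j) by rewrite qE; ring.
  apply: (le_trans (ler_normB _ _)); have := pq i j; have := pq j i; lra.
- move=> x; rewrite -oppr_le0 -/(bform p x x).
  apply: (small _ ((d%:R + 1) * nrm2 x)) => e e0.
  have [q [[_ q0 _] pq]] := Hp' e e0.
  have := q0 x; have := dbl q e x pq e0; rewrite ler_norml => /andP[h1 _] h2; lra.
- move=> i; rewrite -/(bform p (v i) (v i)); apply/eqP; rewrite -subr_eq0 -normr_le0.
  apply: (small _ (d%:R * nrm2 (v i) + 1)) => e e0.
  have [q [[_ _ q1] pq]] := Hp' e e0.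
  have h1 := dbl q e (v i) pq e0; have h2 := q1 i.
  rewrite -[bform p _ _](subrK (bform q (v i) (v i))) -addrA.
  by apply: le_trans (ler_normD _ _) _; lra.
Qed.

Lemma measurable_ellipsoid d m d' (T : measurableType d') (v : T -> 'I_m -> 'cV[R]_d) :
  (forall i, mxmeasurable (fun w => v w i)) ->
  measurable [set w | ellipsoid_through (v w)].
Proof.
move=> mv.
pose A (N k : nat) (L : 'M[rat]_d) := [set w |
  (forall i j, `|ratr (L i j)| <= N%:R :> R) /\
  near_ellipsoid (v w) k.+1%:R^-1 (map_mx ratr L)].
rewrite (_ : [set w | _] = \bigcup_N \bigcap_k \bigcup_L A N k L); last first.
  apply/seteqP; split=> w /=.
    by move/ellipsoid_throughP => [N H]; exists N => // k _; have [L HL] := H k; exists L.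
  move=> [N _ H]; apply/ellipsoid_throughP; exists N => k.
  by have [L _ HL] := H k I; exists L.
apply: bigcupT_measurable => N; apply: bigcapT_measurable => k.
apply: countable_bigcupT_measurable => [|L]; first exact: countableP.
(* These conditions do not involve [w]: if they fail the set is empty, otherwise finitely many
   measurable conditions remain. *)
have [H|H] := pselect ((forall i j, `|ratr (L i j)| <= N%:R :> R) /\
  ((map_mx ratr L)^T = map_mx ratr L :> 'M[R]_d /\
   forall x : 'cV[R]_d, - (k.+1%:R^-1 * nrm2 x) <= bform (map_mx ratr L) x x)); last first.
  rewrite (_ : A N k L = set0)//; apply/seteqP; split=> // w /= [h1 [h2 h3 _]].
  by apply: H; split.
rewrite (_ : A N k L = [set w | forall i, `|bform (map_mx ratr L) (v w i) (v w i) - 1| <= k.+1%:R^-1]).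
  apply: measurable_forall_fin => i; rewrite -[X in measurable X]setTI.
  have mf : measurable_fun setT (fun w => `|bform (map_mx ratr L) (v w i) (v w i) - 1|).
    apply: (measurableT_comp (f := fun y : R => `|y|)); first exact: normr_measurable.
    by apply: measurable_funB => //; apply: measurable_bform => //; exact: mxmeasurable_cst.
  by have := measurable_fun_ler mf (measurable_cst (k.+1%:R^-1 : R)) measurableT (Y := [set true]) I; apply.
apply/seteqP; split=> w /=; first by case=> _ [].
by case: H => h1 [h2 h3] h4; split.
Qed.

End ellipsoid_measurable.

(** * Likely events *)

Section likely.
Context d (T : measurableType d) (R : realType) (P : probability T R).
Context (I : finType).
Variable X : T -> points I R.
Hypothesis HX : gaussian_array P X.
Local Notation E f := (expect P X f%R).

(* [G] fails with probability at most [eps], certified by a test function to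
   which Markov's inequality applies; [G] itself need not be measurable. *)
Definition likely (eps : R) (G : points I R -> Prop) :=
  exists F : points I R -> R, [/\ measurable_fun setT F, forall x, 0 <= F x,
    (E F <= eps%:E)%E & forall x, F x < 1 -> G x].

Lemma likely_le eps eps' G G' : likely eps G -> eps <= eps' ->
  (forall x, G x -> G' x) -> likely eps' G'.
Proof.
move=> [F [mF F0 EF FG]] ee GG; exists F; split=> //.
  by apply: (le_trans EF); rewrite lee_fin.
by move=> x /FG/GG.
Qed.

Lemma likely_and e1 e2 G1 G2 : likely e1 G1 -> likely e2 G2 ->
  likely (e1 + e2) (fun x => G1 x /\ G2 x).
Proof.
move=> [F1 [mF1 F10 EF1 FG1]] [F2 [mF2 F20 EF2 FG2]].
exists (fun x => F1 x + F2 x); split.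
- exact: measurable_funD.
- by move=> x; rewrite addr_ge0.
- by rewrite (expectD HX)// EFinD leeD.
- move=> x Fx; split; [apply: FG1|apply: FG2]; apply: le_lt_trans Fx.
    by rewrite lerDl.
  by rewrite lerDr.
Qed.

Lemma likely_seq (J : eqType) (s : seq J) e (G : J -> points I R -> Prop) :
  (forall j, j \in s -> likely e (G j)) ->
  likely ((size s)%:R * e) (fun x => forall j, j \in s -> G j x).
Proof.
elim: s => [|j s IH] H.
  exists (fun=> 0); split; [exact: measurable_cst|by []| |by []].
  by rewrite expect_cst mul0r.
have h1 := H j (mem_head _ _).
have h2 : likely ((size s)%:R * e) (fun x => forall j, j \in s -> G j x).
  by apply: IH => k ks; apply: H; rewrite inE ks orbT.
apply: (likely_le (likely_and h1 h2)).
  by rewrite /= -nat1r mulrDl mul1r.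
by move=> x [g1 g2] k; rewrite inE => /predU1P[->//|]; exact: g2.
Qed.

Lemma likely_pred (J : finType) (A : {pred J}) e (G : J -> points I R -> Prop) :
  (forall j, j \in A -> likely e (G j)) ->
  likely (#|A|%:R * e) (fun x => forall j, j \in A -> G j x).
Proof.
move=> H; have := @likely_seq J (enum A) e G.
rewrite -cardE => h; apply: (likely_le (h _) (lexx _)).
  by move=> j; rewrite mem_enum; exact: H.
by move=> x g j jA; apply: g; rewrite mem_enum.
Qed.

Lemma likely_fin (J : finType) e (G : J -> points I R -> Prop) :
  (forall j, likely e (G j)) -> likely (#|J|%:R * e) (fun x => forall j, G j x).
Proof.
move=> H; apply: (likely_le (@likely_pred J predT e G _) (lexx _)) => [j _|x h j].
  exact: H.
exact: h.
Qed.

(** Chernoff's bound, with test function [exp (S - b)]. *)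
Lemma likely_exp e (S : points I R -> R) (b : R) (G : points I R -> Prop) :
  measurable_fun setT S -> (E (fun x => expR (S x)) <= (expR (b + e))%:E)%E ->
  (forall x, S x < b -> G x) -> likely (expR e) G.
Proof.
move=> mS ES H; exists (fun x => expR (- b) * expR (S x)); split.
- by apply: measurable_funM => //; exact: measurable_expR_comp.
- by move=> x; rewrite mulr_ge0 ?expR_ge0.
- rewrite (expectZ HX); [|exact: expR_ge0|exact: measurable_expR_comp|
    by move=> x; exact: expR_ge0].
  apply: (@le_trans _ _ ((expR (- b))%:E * (expR (b + e))%:E)%E).
    by apply: lee_wpmul2l; rewrite // lee_fin expR_ge0.
  by rewrite -EFinM -expRD addrA addNr add0r.
- move=> x; rewrite -expRD -[ltRHS]expR0 ltr_expR addrC subr_lt0; exact: H.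
Qed.

Lemma likely_chi (J : finType) (c : J -> I) (w : J -> points I R -> R) (b e : R) G :
  injective c -> (forall j, measurable_fun setT (w j)) ->
  (forall j x, `|w j x| <= 8^-1) -> (forall j j', free_of (w j) (c j')) ->
  (forall x, \sum_j 2 * w j x ^+ 2 <= b + e) ->
  (forall x, \sum_j w j x * (1 - x (c j) ^+ 2) < b -> G x) -> likely (expR e) G.
Proof.
move=> cinj mw w8 wf wb; have mchi j : measurable_fun setT
    (fun x : points I R => w j x * (1 - x (c j) ^+ 2)).
  apply: measurable_funM => //; apply: measurable_funB => //.
  by apply: measurable_funX; exact: measurable_coord.
apply: likely_exp; first exact: measurable_sum.
apply: le_trans (le_trans (elim_chi HX (c := c) (h := fun=> 1) (w := w)
  (enum_uniq J) _ _ _ mw w8 _ _) _).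
- apply: (expect_le HX).
  + by apply: measurable_expR_comp; exact: measurable_sum.
  + by move=> x; exact: expR_ge0.
  + apply: measurable_funM; first exact: measurable_cst.
    by apply: measurable_prod => k _; exact: measurable_expR_comp.
  + by move=> x; rewrite mul1r -expR_sum big_enum.
- by move=> j j' _ _; exact: cinj.
- exact: measurable_cst.
- by [].
- by [].
- by move=> j j' _ _; exact: wf.
rewrite -(expect_cst P X); apply: (expect_le HX).
- apply: measurable_funM; first exact: measurable_cst.
  apply: measurable_prod => k _; apply: measurable_expR_comp; apply: measurable_funM => //.
  exact: measurable_funX.
- by move=> x; rewrite mul1r prodr_ge0// => *; exact: expR_ge0.
- exact: measurable_cst.
- by move=> x; rewrite mul1r -expR_sum ler_expR big_enum/=.
Qed.

Variables (m n : nat).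

Lemma likely_short (ia : 'I_m -> 'I_n -> I) i : injective (ia i) ->
  likely (expR (- (n%:R / 32))) (fun x => nrm2 (gvec ia i x) <= 2 * n%:R).
Proof.
move=> inj; apply: (@likely_chi _ (ia i) (fun _ _ => - 8^-1) (n%:R / 8)) => //.
- by move=> _ _; rewrite normrN ger0_norm.
- move=> x; rewrite sumr_const card_ord sqrrN -mulr_natl expr2.
  by have : 0 <= n%:R :> R by []; lra.
- move=> x; rewrite /nrm2 -mulr_sumr sumrB sumr_const card_ord.
  rewrite (eq_bigr (fun k => gvec ia i x k 0 ^+ 2)); last by move=> k _; rewrite mxE.
  by rewrite -[1 *+ n]/(n%:R); lra.
Qed.

Lemma likely_long (ia : 'I_m -> 'I_n -> I) i : injective (ia i) ->
  likely (expR (- (n%:R / 32))) (fun x => n%:R / 2 <= nrm2 (gvec ia i x)).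
Proof.
move=> inj; apply: (@likely_chi _ (ia i) (fun _ _ => 8^-1) (n%:R / 16)) => //.
- by move=> _ _; rewrite ger0_norm.
- move=> x; rewrite sumr_const card_ord -mulr_natl expr2.
  by have : 0 <= n%:R :> R by []; lra.
- move=> x; rewrite /nrm2 -mulr_sumr sumrB sumr_const card_ord.
  rewrite (eq_bigr (fun k => gvec ia i x k 0 ^+ 2)); last by move=> k _; rewrite mxE.
  by rewrite -[1 *+ n]/(n%:R); lra.
Qed.

(** For a short row [i], the inner product is Gaussian in row [j]; at parameter [1 / sqrt n] its
    log-Laplace transform is [|a_i|^2 / (2 n) <= 1]. The two summands are the two tails. *)
Lemma likely_dot (ia : 'I_m -> 'I_n -> I) i j (t : R) : (0 < n)%N -> i != j ->
  (forall i i' k k', ia i k = ia i' k' -> i = i' /\ k = k') ->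
  likely (expR (1 - t) + expR (1 - t)) (fun x => nrm2 (gvec ia i x) <= 2 * n%:R ->
    `|dotv (gvec ia i x) (gvec ia j x)| <= Num.sqrt n%:R * t).
Proof.
move=> n0 ij inj; set s := Num.sqrt n%:R.
have s0 : 0 < s :> R by rewrite sqrtr_gt0 ltr0n.
have s2 : s ^+ 2 = n%:R :> R by rewrite sqr_sqrtr.
have sne : s != 0 by rewrite gt_eqF.
have H (e : R) : e ^+ 2 = 1 -> likely (expR (1 - t))
    (fun x => nrm2 (gvec ia i x) <= 2 * n%:R ->
      e * dotv (gvec ia i x) (gvec ia j x) <= s * t).
  move=> e2; pose w k (x : points I R) := e / s * x (ia i k).
  have mw k : measurable_fun setT (w k).
    by apply: measurable_funM => //; exact: measurable_coord.
  pose h (x : points I R) : R := shortv ia i x.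
  have mh : measurable_fun setT h by exact: measurable_shortv.
  have wij k k' : ia i k != ia j k'.
    by apply/negP => /eqP/inj[ij' _]; rewrite ij' eqxx in ij.
  exists (fun x => expR (- t) * (h x * \prod_(k <- enum 'I_n) expR (w k x * x (ia j k)))).
  have mprod : measurable_fun setT (fun x : points I R => \prod_(k <- enum 'I_n) expR (w k x * x (ia j k))).
    apply: measurable_prod => k _; apply: measurable_expR_comp.
    by apply: measurable_funM => //; exact: measurable_coord.
  split.
  - by apply: measurable_funM => //; exact: measurable_funM.
  - by move=> x; rewrite !mulr_ge0 ?expR_ge0 ?shortv_ge0// prodr_ge0// => *; exact: expR_ge0.
  - rewrite (expectZ HX) ?expR_ge0//; last 2 first.
    + exact: measurable_funM.
    + by move=> x; rewrite !mulr_ge0 ?shortv_ge0// prodr_ge0// => *; exact: expR_ge0.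
    rewrite addrC expRD EFinM; apply: lee_wpmul2l; first by rewrite lee_fin expR_ge0.
    apply: le_trans (elim_lin HX (c := ia j) (enum_uniq _) _ mh _ mw _ _) _.
    + by move=> k k' _ _ /inj[].
    + by move=> x; exact: shortv_ge0.
    + by move=> k _; apply: shortv_free.
    + by move=> k k' _ _ x u; rewrite /w /setc (negbTE (wij _ _)).
    rewrite -(expect_cst P X); apply: (expect_le HX).
    + apply: measurable_funM => //; apply: measurable_prod => k _.
      by apply: measurable_expR_comp; apply: measurable_funM => //; exact: measurable_funX.
    + by move=> x; rewrite mulr_ge0 ?shortv_ge0// prodr_ge0// => *; exact: expR_ge0.
    + exact: measurable_cst.
    + move=> x; rewrite /h /shortv; case: ifP => [sh|_]; last by rewrite mul0r expR_ge0.
      rewrite mul1r -expR_sum ler_expR big_enum/=.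
      rewrite (eq_bigr (fun k => (2 * n%:R)^-1 * gvec ia i x k 0 ^+ 2)); last first.
        move=> k _; rewrite /w mxE !exprMn exprVn s2 e2.
        by field; rewrite pnatr_eq0 -lt0n.
      by rewrite -mulr_sumr ler_pdivrMl ?mulr1// mulr_gt0// ltr0n.
  - move=> x Fx sh; move: Fx; rewrite /h /shortv sh mul1r -expR_sum -expRD.
    rewrite -[ltRHS]expR0 ltr_expR addrC subr_lt0 big_enum/= => Fx.
    rewrite (_ : e * _ = s * \sum_k w k x * x (ia j k)); first by rewrite ler_pM2l// ltW.
    rewrite /dotv !mulr_sumr; apply: eq_bigr => k _; rewrite /w !mxE.
    by field.
have h1 := H 1 (expr1n _ _); have h2 := H (- 1) ltac:(by rewrite sqrrN expr1n).
apply: (likely_le (likely_and h1 h2) (lexx _)) => x [g1 g2] sh.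
by rewrite ler_norml; have := g1 sh; have := g2 sh; rewrite mulN1r mul1r; lra.
Qed.

Variables ia ib : 'I_m -> 'I_n -> I.
Hypothesis ia_inj : forall i i' k k', ia i k = ia i' k' -> i = i' /\ k = k'.
Hypothesis ib_inj : forall i i' k k', ib i k = ib i' k' -> i = i' /\ k = k'.
Hypothesis ia_ib : forall i i' k k', ia i k != ib i' k'.

Let mix (q : 'I_m -> R) x := mixture (gvec ia ^~ x) (gvec ib ^~ x) q.

Lemma mxmeasurable_mix q : mxmeasurable (mix q).
Proof.
apply: mxmeasurable_sum => i; apply: mxmeasurableZ => //; apply: mxmeasurableM.
  exact: mxmeasurable_gvec.
by apply: mxmeasurable_tr; exact: mxmeasurable_gvec.
Qed.

Lemma measurable_fro2 p q d' (T' : measurableType d') (M : T' -> 'M[R]_(p, q)) :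
  mxmeasurable M -> measurable_fun setT (fun x => fro2 (M x)).
Proof.
move=> mM; apply: measurable_sum => i; apply: measurable_sum => j.
by apply: measurable_funX; exact: mM.
Qed.

(** Markov's inequality for the Laplace transform in [gram_lower_tail]; the exponents fit because
    [1/160 - 1/18^2 >= 1/320]. *)
Lemma likely_mixture_ge (q : 'I_m -> R) (la be2 : R) (U : {set 'I_m}) :
  0 < la -> (forall i, i \in U -> q i ^+ 2 <= be2) -> la * be2 * n%:R <= 1 ->
  la <= 24^-1 -> \sum_i q i ^+ 2 <= 3 -> 8^-1 <= \sum_(i in U) q i ^+ 2 ->
  likely (expR (- (la * n%:R ^+ 2 / 320))) (fun x =>
    (forall i, nrm2 (gvec ia i x) <= 2 * n%:R) -> (n%:R / 18) ^+ 2 <= fro2 (mix q x)).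
Proof.
move=> la0 Ube labe la24 q3 qU.
have := gram_lower_tail HX ia_inj ib_inj ia_ib la0 Ube labe la24 q3 qU.
set F := (fun x => _ * _) => EF.
have FE x : F x = (\prod_(i <- enum 'I_m) shortv ia i x) * expR (- (la * fro2 (mix q x))).
  rewrite /F; congr (_ * expR (- (la * _))).
  rewrite /fro2 exchange_big/=; apply: eq_bigr => l _; apply: eq_bigr => k _.
  rewrite /mix /mixture !summxE; congr (_ ^+ 2); apply: eq_bigr => i _.
  by rewrite mxE [in RHS]mxE rank1E !mxE; ring.
have mF : measurable_fun setT F.
  rewrite (_ : F = fun x => (\prod_(i <- enum 'I_m) shortv ia i x) *
    expR (- (la * fro2 (mix q x)))); last by apply/funext => x; rewrite FE.
  apply: measurable_funM.
    by apply: measurable_prod => i _; exact: measurable_shortv.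
  apply: measurable_expR_comp; apply: measurable_funN; apply: measurable_funM => //.
  by apply: measurable_fro2; exact: mxmeasurable_mix.
have F0 x : 0 <= F x.
  rewrite FE mulr_ge0 ?expR_ge0// prodr_ge0// => *; exact: shortv_ge0.
exists (fun x => expR (la * (n%:R / 18) ^+ 2) * F x); split.
- exact: measurable_funM.
- by move=> x; rewrite mulr_ge0 ?expR_ge0.
- rewrite (expectZ HX) ?expR_ge0//.
  apply: (@le_trans _ _ ((expR (la * (n%:R / 18) ^+ 2))%:E * (expR (- (la * n%:R ^+ 2 / 160)))%:E)%E).
    by apply: lee_wpmul2l; rewrite // lee_fin expR_ge0.
  rewrite -EFinM -expRD lee_fin ler_expR exprMn exprVn -[18 ^+ 2]natrX.
  have : 0 <= la * n%:R ^+ 2 by rewrite mulr_ge0 ?sqr_ge0// ltW.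
  by move=> ?; rewrite [(18 ^ 2)%N]/=; lra.
- move=> x + sh; rewrite FE big1_seq ?mul1r; last by move=> i _; rewrite /shortv sh.
  rewrite -expRD -[ltRHS]expR0 ltr_expR subr_lt0 ltr_pM2l// => h; exact: ltW.
Qed.

Lemma likely_min_sum (tau b : R) (s : seq 'I_m) (N : points I R -> 'M[R]_n) :
  0 < tau -> uniq s -> mxmeasurable N -> (forall x, fro2 (N x) <= 1) ->
  (forall i k, i \in s -> free_of N (ia i k)) ->
  (forall i k, i \in s -> free_of N (ib i k)) ->
  likely (expR ((60 * m%:R - b) / (8 * tau))) (fun x =>
    \sum_(i <- s) Num.min (bform (N x) (gvec ia i x) (gvec ib i x) ^+ 2)
              (tau * `|bform (N x) (gvec ia i x) (gvec ib i x)|) <= b).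
Proof.
move=> tau0 us mN N1 Nfa Nfb.
have t80 : 0 < 8 * tau by lra.
have mY i : measurable_fun setT (fun x => bform (N x) (gvec ia i x) (gvec ib i x)).
  by apply: measurable_bform => //; exact: mxmeasurable_gvec.
apply: (@likely_exp _ (fun x => \sum_(i <- s)
      Num.min (bform (N x) (gvec ia i x) (gvec ib i x) ^+ 2)
              (tau * `|bform (N x) (gvec ia i x) (gvec ib i x)|) / (8 * tau)) (b / (8 * tau))).
- apply: measurable_sum => i; apply: measurable_funM => //.
  apply: measurable_minr; first exact: measurable_funX.
  by apply: measurable_funM => //; exact: measurableT_comp.
- rewrite -mulrDl addrCA subrr addr0.
  by apply: expect_min_sum.
- by move=> x; rewrite -mulr_suml ltr_pM2r ?invr_gt0// => /ltW.
Qed.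

(** [N] is built from the rows with [z i != 0] and tested on the others, so it is frozen while these
    are integrated. If [mix q x] vanishes, so does [N], and its norm bound persists. *)
Lemma likely_cross (tau b : R) (z : 'I_m -> int) (de : R) : 0 < tau ->
  let q i := de * (z i)%:~R in
  likely (expR ((60 * m%:R - b) / (8 * tau))) (fun x =>
    let Y i := bform ((fnorm (mix q x))^-1 *: mix q x) (gvec ia i x) (gvec ib i x) in
    \sum_(i | z i == 0) Num.min (Y i ^+ 2) (tau * `|Y i|) <= b).
Proof.
move=> tau0 q; pose N x := (fnorm (mix q x))^-1 *: mix q x.
have mN : mxmeasurable N.
  apply: mxmeasurableZ; last exact: mxmeasurable_mix.
  apply: measurable_inv; apply: measurable_sqrt; apply: measurable_fro2.
  exact: mxmeasurable_mix.
have N1 x : fro2 (N x) <= 1.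
  rewrite /N fro2Z -fnorm2 -exprMn.
  by have [->|f0] := eqVneq (fnorm (mix q x)) 0; rewrite ?mulr0 ?expr0n ?mulVf ?expr1n.
have mixf c : (forall i, z i != 0 -> forall k, ia i k != c /\ ib i k != c) -> free_of N c.
  move=> h x t; have e : mix q (setc x c t) = mix q x.
    apply: eq_bigr => i _; have [zi|zi] := eqVneq (z i) 0.
      by rewrite /q zi mulr0 !scale0r.
    by rewrite /rank1 !gvec_free// => k; have [] := h i zi k.
  by rewrite /N e.
pose s := [seq i <- enum 'I_m | z i == 0].
have := @likely_min_sum tau b s N tau0 (filter_uniq _ (enum_uniq _)) mN N1.
move=> H; apply: (likely_le (H _ _) (lexx _)).
- move=> i k; rewrite mem_filter => /andP[zi _]; apply: mixf => j zj k'; split.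
    by apply/negP => /eqP/ia_inj[ji _]; rewrite ji zi in zj.
  by rewrite eq_sym; exact: ia_ib.
- move=> i k; rewrite mem_filter => /andP[zi _]; apply: mixf => j zj k'; split.
    exact: ia_ib.
  by apply/negP => /eqP/ib_inj[ji _]; rewrite ji zi in zj.
- by move=> x; rewrite big_filter big_enum_cond.
Qed.

(** For short rows each product is at most [2 n] in absolute value, so truncation at [tau = 2 n]
    changes nothing. The exponent is [(8 - 600) n^2 / (16 n) = - 37 n], just below minus the net
    entropy [36 n]. *)
Lemma likely_net (u v : 'cV[R]_n) : (0 < n)%N -> nrm2 u <= 1 -> nrm2 v <= 1 ->
  60 * m%:R <= 8 * n%:R ^+ 2 :> R ->
  likely (expR (- (37 * n%:R))) (fun x =>
    (forall i, nrm2 (gvec ia i x) <= 2 * n%:R) ->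
    (forall i, nrm2 (gvec ib i x) <= 2 * n%:R) ->
    \sum_i (dotv u (gvec ia i x) * dotv v (gvec ib i x)) ^+ 2 <= 600 * n%:R ^+ 2).
Proof.
move=> n0 u1 v1 mn; have nR0 : 0 < n%:R :> R by rewrite ltr0n.
pose N (x : points I R) := u *m v^T.
have N1 x : fro2 (N x) <= 1.
  rewrite (_ : fro2 _ = nrm2 u * nrm2 v); first by rewrite mulr_ile1 ?nrm2_ge0.
  rewrite /fro2 /nrm2 mulr_suml; apply: eq_bigr => k _; rewrite mulr_sumr.
  by apply: eq_bigr => l _; rewrite mxE big_ord1 mxE exprMn.
have NE x a b : bform (N x) a b = dotv u a * dotv v b.
  rewrite bformE /dotv mulr_suml; apply: eq_bigr => k _; rewrite mulr_sumr.
  by apply: eq_bigr => l _; rewrite mxE big_ord1 mxE; ring.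
have tau0 : 0 < 2 * n%:R :> R by rewrite mulr_gt0.
have := @likely_min_sum (2 * n%:R) (600 * n%:R ^+ 2) (enum 'I_m) N tau0 (enum_uniq _)
  (mxmeasurable_cst _) N1 (fun _ _ _ _ _ => erefl) (fun _ _ _ _ _ => erefl).
move=> H; apply: (likely_le H).
  rewrite ler_expR ler_pdivrMr; last by rewrite mulr_gt0.
  by move: mn; rewrite expr2; lra.
move=> x h sa sb; apply: le_trans h; rewrite big_enum/=.
apply: ler_sum => i _; rewrite NE le_min lexx/= -real_normK ?num_real// expr2 ler_wpM2r//.
rewrite -(ler_pXn2r (n := 2)) ?nnegrE ?(ltW tau0)// real_normK ?num_real// exprMn.
have cs (p r : 'cV[R]_n) : dotv p r ^+ 2 <= nrm2 p * nrm2 r.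
  by have := cauchy_sum predT (fun k => p k 0) (fun k => r k 0); exact.
have h1 : dotv u (gvec ia i x) ^+ 2 <= 2 * n%:R.
  apply: (le_trans (cs _ _)); rewrite -[leRHS]mul1r ler_pM ?nrm2_ge0//.
have h2 : dotv v (gvec ib i x) ^+ 2 <= 2 * n%:R.
  apply: (le_trans (cs _ _)); rewrite -[leRHS]mul1r ler_pM ?nrm2_ge0//.
by rewrite expr2 ler_pM ?sqr_ge0.
Qed.

End likely.

(** * Norm of the matrix that interpolates the target *)

Section gram_solution.
Context {R : realType}.
Variables (m n : nat) (a b : 'I_m -> 'cV[R]_n).

Definition gram : 'M[R]_m := \matrix_(i, j) (dotv (a i) (a j) * dotv (b i) (b j)).

Definition rank1_at (u v : 'cV[R]_n) : 'cV[R]_m := \col_i (dotv u (a i) * dotv v (b i)).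

(* [invmx gram *m rank1_at u v], written with the adjugate so that it depends
   measurably on [a] and [b]. *)
Definition gram_sol (u v : 'cV[R]_n) : 'cV[R]_m :=
  (\det gram)^-1 *: (\adj gram *m rank1_at u v).

Lemma gram_sym : gram^T = gram.
Proof.
apply/matrixP => i j; rewrite !mxE /dotv; congr (_ * _);
  by apply: eq_bigr => k _; rewrite mulrC.
Qed.

Lemma bform_gram (q : 'cV[R]_m) : bform gram q q = fro2 (mixture a b (fun i => q i 0)).
Proof.
rewrite fro2E ipm_mixture bformE; apply: eq_bigr => i _.
rewrite ipmC ipm_mixture mulr_sumr; apply: eq_bigr => j _.
by rewrite ipmC mxE ipm_rank11; ring.
Qed.

Variable ka : R.
Hypothesis ka0 : 0 < ka.
Hypothesis gram_ge : forall q : 'I_m -> R, ka * \sum_i q i ^+ 2 <= fro2 (mixture a b q).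

Lemma gram_unit : gram \in unitmx.
Proof.
rewrite -row_free_unit -kermx_eq0; apply/eqP/row_matrixP => i; rewrite row0.
set q := row i _.
have qG : q *m gram = 0.
  by apply/sub_kermxP; rewrite row_sub.
have := gram_ge (fun j => q^T j 0); rewrite -bform_gram /bform trmxK qG mul0mx mxE => h.
have s0 : \sum_j q^T j 0 ^+ 2 <= 0 by rewrite -(pmulr_rle0 _ ka0).
apply/rowP => j; rewrite [RHS]mxE; apply/eqP; rewrite -sqrf_eq0 eq_le sqr_ge0 andbT.
have -> : q 0 j = q^T j 0 by rewrite [RHS]mxE.
apply: le_trans s0; rewrite (bigD1 j)//= lerDl.
by apply: sumr_ge0 => k _; exact: sqr_ge0.
Qed.

Lemma gram_solE u v : gram_sol u v = invmx gram *m rank1_at u v.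
Proof. by rewrite /gram_sol /invmx gram_unit scalemxAl. Qed.

(** If [G w = t] then [ka |w|^2 <= <w, t> <= |w| |t|], hence [|w|^2 <= |t|^2 / ka^2]. *)
Lemma gram_sol_le u v (S2 B : R) : S2 <= ka ^+ 2 * B ->
  \sum_i (dotv u (a i) * dotv v (b i)) ^+ 2 <= S2 ->
  \sum_i gram_sol u v i 0 ^+ 2 <= B.
Proof.
move=> S2B uv; set w := gram_sol u v; set W := \sum_i _.
have W0 : 0 <= W by apply: sumr_ge0 => i _; exact: sqr_ge0.
have Gw : gram *m w = rank1_at u v by rewrite /w gram_solE mulKVmx ?gram_unit.
have h1 : ka * W <= \sum_i w i 0 * rank1_at u v i 0.
  apply: (le_trans (gram_ge _)); rewrite -bform_gram /bform -mulmxA Gw mxE.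
  by apply: ler_sum => i _; rewrite mxE.
have h2 : (\sum_i w i 0 * rank1_at u v i 0) ^+ 2 <= W * S2.
  have := cauchy_sum predT (fun i => w i 0) (fun i => rank1_at u v i 0).
  move=> h; apply: (le_trans h); rewrite ler_wpM2l//.
  by apply: le_trans uv; apply: ler_sum => i _; rewrite mxE.
have h3 : (ka * W) ^+ 2 <= W * S2.
  apply: le_trans h2; rewrite lerXn2r ?nnegrE ?mulr_ge0 ?(ltW ka0)//.
  by apply: le_trans h1; rewrite mulr_ge0// ltW.
have [->|Wn0] := eqVneq W 0.
  have : 0 <= ka ^+ 2 * B.
    apply: le_trans S2B; apply: le_trans uv; apply: sumr_ge0 => i _; exact: sqr_ge0.
  by rewrite pmulr_rge0// exprn_gt0.
have Wp : 0 < W by rewrite lt_def Wn0.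
move: h3; rewrite exprMn expr2 (expr2 W) mulrA [leRHS]mulrC ler_pM2r// => h3.
by rewrite -(ler_pM2l (exprn_gt0 2 ka0)) expr2; apply: le_trans h3 _; rewrite -expr2.
Qed.

(** By symmetry of the Gram matrix, [u^T M v = <G^-1 g, t> = <g, G^-1 t>] with [t = rank1_at u v],
    so only the sums in the last hypothesis have to be bounded at net pairs. *)
Lemma gram_solve (g : 'I_m -> R) (S2 B : R) : (0 < n)%N -> S2 <= ka ^+ 2 * B ->
  (forall z z', nrm2 (netv z : 'cV[R]_n) <= 1 -> nrm2 (netv z' : 'cV[R]_n) <= 1 ->
    \sum_i (dotv (netv z) (a i) * dotv (netv z') (b i)) ^+ 2 <= S2) ->
  (forall z z', nrm2 (netv z : 'cV[R]_n) <= 1 -> nrm2 (netv z' : 'cV[R]_n) <= 1 ->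
    \sum_i gram_sol (netv z) (netv z') i 0 ^+ 2 <= B ->
    \sum_i gram_sol (netv z) (netv z') i 0 * g i <= 2^-1) ->
  exists M : 'M[R]_n, (forall x y, 2 * bform M x y <= nrm2 x + nrm2 y) /\
    forall i, bform M (a i) (b i) = g i.
Proof.
move=> n0 S2B HS Hg; pose q := invmx gram *m \col_i g i.
have Gq : gram *m q = \col_i g i by rewrite mulKVmx ?gram_unit.
pose M := mixture a b (fun i => q i 0); exists M; split; last first.
  move=> i; rewrite -ipm_rank1 ipmC ipm_mixture.
  have /matrixP/(_ i 0) := Gq; rewrite mxE [RHS]mxE => <-; apply: eq_bigr => j _.
  by rewrite ipmC -[ipm _ _]/(ipm (rank1 a b i) (rank1 a b j)) ipm_rank11 mulrC [gram i j]mxE.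
apply: net_bform => // z z' z1 z'1.
apply: le_trans (Hg _ _ z1 z'1 (gram_sol_le S2B (HS _ _ z1 z'1))).
set u := netv z; set v := netv z'.
have ME : bform M u v = (q^T *m rank1_at u v) 0 0.
  rewrite [RHS]mxE bformE.
  have -> : \sum_i \sum_j u i 0 * M i j * v j 0 = ipm M (u *m v^T).
    apply: eq_bigr => k _; apply: eq_bigr => l _.
    by rewrite [X in _ = _ * X]mxE big_ord1 [v^T _ _]mxE; ring.
  rewrite ipm_mixture; apply: eq_bigr => i _; rewrite [q^T _ _]mxE [rank1_at _ _ _ _]mxE; congr (_ * _).
  rewrite /ipm /dotv mulr_suml; apply: eq_bigr => k _; rewrite mulr_sumr.
  by apply: eq_bigr => l _; rewrite rank1E [(u *m _) _ _]mxE big_ord1 [v^T _ _]mxE; ring.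
rewrite ME /q trmx_mul trmx_inv gram_sym -mulmxA -gram_solE [leLHS]mxE.
by apply: ler_sum => i _; rewrite [(\col_j g j)^T _ _]mxE [(\col_j g j) _ _]mxE mulrC.
Qed.

End gram_solution.

Section likely_residual.
Context d (T : measurableType d) (R : realType) (P : probability T R).
Context (I : finType).
Variable X : T -> points I R.
Hypothesis HX : gaussian_array P X.
Variables (m n : nat) (ia ib : 'I_m -> 'I_n -> I).
Variables (J : finType) (c : J -> I) (r : J -> 'I_m) (D sg : R).
Hypothesis c_inj : injective c.
Hypothesis c_ia : forall j i k, ia i k != c j.
Hypothesis c_ib : forall j i k, ib i k != c j.
Hypothesis D0 : 0 <= D.
Hypothesis cardD : forall i, #|[pred j | r j == i]|%:R <= D.

(** The target of one block: [c] enumerates the coordinates of the other blocks and [r] names the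
    vector each of them belongs to. *)
Definition residual (x : points I R) i := sg * \sum_(j | r j == i) (1 - x (c j) ^+ 2).

Lemma measurable_det d' (T' : measurableType d') p (M : T' -> 'M[R]_p) :
  mxmeasurable M -> measurable_fun setT (fun x => \det (M x)).
Proof.
move=> mM; apply: measurable_sum => s; apply: measurable_funM => //.
by apply: measurable_prod => i _; exact: mM.
Qed.

Lemma mxmeasurable_adj d' (T' : measurableType d') p (M : T' -> 'M[R]_p) :
  mxmeasurable M -> mxmeasurable (fun x => \adj (M x)).
Proof.
move=> mM i j.
rewrite (_ : (fun x => _) = fun x => (-1) ^+ (j + i) * \det (row' j (col' i (M x)))); last first.
  by apply/funext => x; rewrite mxE.
apply: measurable_funM => //; apply: measurable_det => k l.
rewrite (_ : (fun x => _) = fun x => M x (lift j k) (lift i l)); first exact: mM.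
by apply/funext => x; rewrite !mxE.
Qed.

Let sol u v (x : points I R) := gram_sol (gvec ia ^~ x) (gvec ib ^~ x) u v.

Lemma measurable_dotv p (f g : points I R -> 'cV[R]_p) : mxmeasurable f -> mxmeasurable g ->
  measurable_fun setT (fun x => dotv (f x) (g x)).
Proof.
move=> mf mg; apply: measurable_sum => k.
by apply: measurable_funM; [exact: mf|exact: mg].
Qed.

Lemma mxmeasurable_sol u v : mxmeasurable (sol u v).
Proof.
have ma i : mxmeasurable (gvec ia i : points I R -> _) by exact: mxmeasurable_gvec.
have mb i : mxmeasurable (gvec ib i : points I R -> _) by exact: mxmeasurable_gvec.
have mG : mxmeasurable (fun x : points I R => gram (gvec ia ^~ x) (gvec ib ^~ x)).
  move=> i j; rewrite (_ : (fun x => _) = fun x : points I R =>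
    dotv (gvec ia i x) (gvec ia j x) * dotv (gvec ib i x) (gvec ib j x)).
    by apply: measurable_funM; exact: measurable_dotv.
  by apply/funext => x; rewrite mxE.
apply: mxmeasurableZ; first by apply: measurable_inv; exact: measurable_det.
apply: mxmeasurableM; first exact: mxmeasurable_adj.
move=> i j; rewrite (_ : (fun x => _) = fun x : points I R =>
    dotv u (gvec ia i x) * dotv v (gvec ib i x)).
  by apply: measurable_funM; apply: measurable_dotv => //; exact: mxmeasurable_cst.
by apply/funext => x; rewrite mxE.
Qed.

Lemma sol_free u v j : free_of (sol u v) (c j).
Proof.
move=> x t; rewrite /sol; congr (gram_sol _ _ u v); apply/funext => i.
  by rewrite gvec_free// => k; exact: c_ia.
by rewrite gvec_free// => k; exact: c_ib.
Qed.

(** [s] is the Chernoff parameter. The solution ignores the coordinates [c j], so this is a centred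
    chi-square combination with frozen weights, each repeated at most [D] times. *)
Lemma likely_residual u v (B s : R) : 0 < s -> 0 <= B -> 0 <= sg ->
  s ^+ 2 * sg ^+ 2 * B <= 64^-1 ->
  likely P X (expR (2 * s ^+ 2 * sg ^+ 2 * D * B - s / 2)) (fun x =>
    \sum_i sol u v x i 0 ^+ 2 <= B -> \sum_i sol u v x i 0 * residual x i <= 2^-1).
Proof.
move=> s0 B0 sg0 sB.
pose W x := \sum_i sol u v x i 0 ^+ 2.
have mW : measurable_fun setT W.
  by apply: measurable_sum => i; apply: measurable_funX; exact: mxmeasurable_sol.
(* Zeroing the coefficients off the event [W x <= B] bounds the weights at every point, as
   [likely_chi] demands; on the event nothing changes. *)
pose wt i (x : points I R) := if W x <= B then sol u v x i 0 else 0.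
have mwt i : measurable_fun setT (wt i).
  apply: measurable_fun_ifT => //; first exact: measurable_fun_ler.
  exact: mxmeasurable_sol.
have wtB x : \sum_i wt i x ^+ 2 <= B.
  have [h|h] := leP (W x) B.
    by apply: le_trans h; apply: ler_sum => i _; rewrite /wt; case: ifP => // _; rewrite expr0n sqr_ge0.
  by rewrite big1// => i _; rewrite /wt leNgt h/= expr0n.
pose w j (x : points I R) := s * sg * wt (r j) x.
have mw j : measurable_fun setT (w j) by apply: measurable_funM.
have w8 j x : `|w j x| <= 8^-1.
  rewrite -(ler_pXn2r (n := 2)) ?nnegrE// real_normK ?num_real// exprVn -[8 ^+ 2]natrX.
  apply: le_trans sB; rewrite /w 2!exprMn; apply: ler_wpM2l; first by apply: mulr_ge0; exact: sqr_ge0.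
  apply: le_trans (wtB x); rewrite (bigD1 (r j))//= lerDl.
  by apply: sumr_ge0 => i _; exact: sqr_ge0.
have wf j j' : free_of (w j) (c j').
  by move=> x t; rewrite /w /wt /W sol_free.
have sumE (F : 'I_m -> J -> R) : \sum_j F (r j) j = \sum_i \sum_(j | r j == i) F i j.
  rewrite (partition_big r predT)//=; apply: eq_bigr => i _.
  by apply: eq_bigr => j /eqP ->.
apply: (likely_chi HX (w := w) (b := s / 2) c_inj mw w8 wf).
- move=> x; rewrite [s / 2 + _]addrC subrK (sumE (fun i j => 2 * (s * sg * wt i x) ^+ 2)).
  apply: (@le_trans _ _ (\sum_i 2 * s ^+ 2 * sg ^+ 2 * D * wt i x ^+ 2)).
    apply: ler_sum => i _; rewrite sumr_const -mulr_natl !exprMn.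
    have := ler_wpM2r (mulr_ge0 (mulr_ge0 (sqr_ge0 s) (sqr_ge0 sg)) (sqr_ge0 (wt i x))) (cardD i).
    lra.
  rewrite -mulr_sumr; apply: ler_wpM2l => //; apply: mulr_ge0 => //.
  by apply: mulr_ge0; [apply: mulr_ge0 => //|]; exact: sqr_ge0.
- move=> x Sx WB; rewrite -(ler_pM2l s0) mulrC; apply: ltW; apply: le_lt_trans Sx.
  rewrite (sumE (fun i j => s * sg * wt i x * (1 - x (c j) ^+ 2))) mulr_suml.
  rewrite le_eqVlt; apply/orP; left; apply/eqP; apply: eq_bigr => i _.
  by rewrite /residual /wt ifT// -mulr_sumr; ring.
Qed.

End likely_residual.

Section lattice.
Context d (T : measurableType d) (R : realType) (P : probability T R).
Context (I : finType).
Variable X : T -> points I R.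
Hypothesis HX : gaussian_array P X.

(** A finite union bound, since integers satisfy [|z_i| <= z_i^2 <= K]. *)
Lemma likely_lattice (m k : nat) (K r e : R) (G : ('I_m -> int) -> points I R -> Prop) :
  0 < r <= 1 -> 0 <= e ->
  (forall z, (#|[pred i | z i != 0%R]| <= k)%N -> \sum_i (z i)%:~R ^+ 2 <= K ->
    likely P X e (G z)) ->
  likely P X (r^-1 ^+ k * expR K * expR (2 * r * m%:R) * e)
    (fun x => forall z, (#|[pred i | z i != 0%R]| <= k)%N ->
      \sum_i (z i)%:~R ^+ 2 <= K -> G z x).
Proof.
move=> r01 e0 H; pose B := Num.bound K.
pose A : {pred grid m B} := [pred g : grid m B |
  (#|[pred i | gridz g i != 0%R]| <= k)%N && (\sum_i (gridz g i)%:~R ^+ 2 <= K)].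
have := @likely_pred _ _ _ P _ X HX _ A e (fun g => G (gridz g)).
move=> h; apply: (likely_le (h _)).
- by move=> g /andP[g1 g2]; exact: H.
- by rewrite ler_wpM2r//; exact: grid_count.
move=> x gx z z1 z2.
have [i|g gz] := @gridz_surj m B z.
  have zz : (`|z i|)%:~R <= (z i)%:~R ^+ 2 :> R.
    rewrite -rmorphXn/= ler_int -[in leRHS]real_normK ?num_real// expr2.
    have [->|zi] := eqVneq (z i) 0; first by rewrite normr0 mulr0.
    by rewrite ler_peMr// -gtz0_ge1 normr_gt0.
  have : (`|z i|)%:~R <= K.
    apply: (le_trans zz); apply: le_trans z2; rewrite (bigD1 i)//= lerDl.
    by apply: sumr_ge0 => *; exact: sqr_ge0.
  move=> zK; rewrite -(@ler_int R); apply: (le_trans zK).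
  by apply: ltW; apply: archi_boundP; apply: le_trans zK; rewrite ler0z.
have gE : gridz g = z by apply/funext.
have := gx g; rewrite gE; apply; rewrite inE gE z1; exact: z2.
Qed.

Variables m n : nat.

Lemma likely_norms (ia : 'I_m -> 'I_n -> I) : (forall i, injective (ia i)) ->
  likely P X (m%:R * (2 * expR (- (n%:R / 32))))
    (fun x => forall i, n%:R / 2 <= nrm2 (gvec ia i x) <= 2 * n%:R).
Proof.
move=> inj; rewrite -[X in X%:R * _](card_ord m); apply: likely_fin => // i.
apply: (likely_le (likely_and HX (likely_long HX (inj i)) (likely_short HX (inj i)))).
  by rewrite mulr2n mulrDl mul1r.
by move=> x [h1 h2]; apply/andP.
Qed.

Lemma likely_dots (ia : 'I_m -> 'I_n -> I) (t : R) : (0 < n)%N ->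
  (forall i i' k k', ia i k = ia i' k' -> i = i' /\ k = k') ->
  likely P X (m%:R ^+ 2 * (2 * expR (1 - t)))
    (fun x => (forall i, nrm2 (gvec ia i x) <= 2 * n%:R) ->
      forall i j, i != j -> `|dotv (gvec ia i x) (gvec ia j x)| <= Num.sqrt n%:R * t).
Proof.
move=> n0 inj; rewrite expr2 -natrM -[X in (X * X)%:R](card_ord m) -card_prod.
pose G (p : 'I_m * 'I_m) (x : points I R) := p.1 != p.2 -> nrm2 (gvec ia p.1 x) <= 2 * n%:R ->
  `|dotv (gvec ia p.1 x) (gvec ia p.2 x)| <= Num.sqrt n%:R * t.
apply: (likely_le (likely_fin HX (G := G) (e := 2 * expR (1 - t)) _) (lexx _)).
  move=> [i j]; rewrite /G/=; have [->|ij] := eqVneq i j.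
    exists (fun=> 0); split; [exact: measurable_cst|by []| |by []].
    by rewrite expect_cst lee_fin mulr_ge0 ?expR_ge0.
  apply: (likely_le (likely_dot HX t n0 ij inj)) => [|x h _]; last exact: h.
  by rewrite mulr2n mulrDl mul1r.
by move=> x Gx sh i j ij; apply: (Gx (i, j)).
Qed.

End lattice.

(** * Solving the equations of one block *)

Section large.
Context {R : realType}.
Implicit Types m n : nat.
Local Notation L n := (ln n%:R : R).
Local Notation Q n := (Num.sqrt n%:R : R).

(* [(72 * 108) ^ 2 = 36 ^ 2 * 216 ^ 2]: moving [m] entries by at most [216 / n]
   moves a vector by at most [1 / 36].  Large numerals are factored because they
   denote unary naturals. *)
Definition large m n : Prop := [/\ (0 < n)%N, 100 * 100 <= L n, L n ^+ 7 <= Q n &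
  m%:R * (72 * 108) * (72 * 108) <= n%:R ^+ 2 :> R].

Lemma large_nat m n : large m n -> (0 < n)%N. Proof. by case. Qed.

Lemma large_gt0 m n : large m n -> 0 < n%:R :> R.
Proof. by case=> *; rewrite ltr0n. Qed.

Lemma large_L m n : large m n -> 100 * 100 <= L n. Proof. by case. Qed.

Lemma large_L0 m n : large m n -> 0 < L n. Proof. by move/large_L; lra. Qed.

Lemma large_Q0 m n : large m n -> 0 < Q n.
Proof. by move/large_gt0; rewrite sqrtr_gt0. Qed.

Lemma large_QE m n : large m n -> Q n ^+ 2 = n%:R.
Proof. by move/large_gt0/ltW => h; rewrite sqr_sqrtr. Qed.

Lemma large_expL m n : large m n -> expR (L n) = n%:R.
Proof. by move/large_gt0 => h; rewrite lnK// posrE. Qed.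

Lemma expr_mul_le (c x : R) k p : 0 <= c -> c <= x -> c ^+ k * x ^+ p <= x ^+ (k + p).
Proof.
move=> c0 cx; have x0 := le_trans c0 cx.
by rewrite exprD ler_wpM2r ?exprn_ge0// lerXn2r ?nnegrE.
Qed.

(** Spends [L^7 <= sqrt n] by trading some powers of [L] for a numerical constant below [L]. *)
Lemma large_QL m n (c : R) k p : (k + p = 7)%N -> large m n -> 0 <= c -> c <= L n ->
  c ^+ k * L n ^+ p <= Q n.
Proof.
move=> kp [_ _ h2 _] c0 cL; apply: le_trans h2; rewrite -kp.
exact: expr_mul_le.
Qed.

Lemma large_Q m n : large m n -> 100 * 100 * (100 * 100) * (100 * 100) * L n <= Q n.
Proof.
move=> h; have c0 : 0 <= 100 * 100 :> R by lra.
have := large_QL (erefl : 6 + 1 = 7)%N h c0 (large_L h); rewrite expr1.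
by have := large_L0 h; lra.
Qed.

Lemma large_N m n : large m n -> 100 * 100 * (100 * 100) * L n <= n%:R.
Proof.
move=> h; have h1 : 1 <= Q n.
  by have := large_Q h; have := large_L h; lra.
have h2 : 1 * Q n <= n%:R.
  by rewrite -[leRHS](large_QE h) expr2 ler_wpM2r//; exact: ltW (large_Q0 h).
by have := large_Q h; have := large_L0 h; lra.
Qed.

Lemma large_NN m n : large m n -> L n <= n%:R ^+ 2 / (100 * 600).
Proof.
move=> h; have h1 : 1 <= n%:R :> R.
  by have := large_N h; have := large_L h; lra.
have h2 : 1 * n%:R <= n%:R ^+ 2 :> R by rewrite expr2 ler_wpM2r.
by have := large_N h; have := large_L0 h; lra.
Qed.

Lemma large_L2 m n : large m n -> L n ^+ 2 / n%:R <= 24^-1.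
Proof.
move=> h; have n0 := large_gt0 h; have Q0 := large_Q0 h; have L0 := large_L0 h.
have LQ : 24 * L n <= Q n by have := large_Q h; lra.
rewrite ler_pdivrMr// -[X in _ * X](large_QE h).
have : (24 * L n) ^+ 2 <= Q n ^+ 2 by rewrite lerXn2r ?nnegrE ?mulr_ge0// ltW.
by have := sqr_ge0 (L n); rewrite exprMn; lra.
Qed.

Lemma large_m m n : large m n -> m%:R * (72 * 108) * (72 * 108) <= n%:R ^+ 2 :> R. Proof. by case. Qed.

End large.

Section group.
Context d (T : measurableType d) (R : realType) (P : probability T R).
Context (I : finType).
Variable X : T -> points I R.
Hypothesis HX : gaussian_array P X.

Lemma likely_true e (G : points I R -> Prop) : 0 <= e -> (forall x, G x) -> likely P X e G.
Proof.
move=> e0 H; exists (fun=> 0); split; [exact: measurable_cst|by []| |by move=> *; exact: H].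
by rewrite expect_cst lee_fin.
Qed.

Variables m n : nat.
Variables ia ib : 'I_m -> 'I_n -> I.
Hypothesis ia_inj : forall i i' k k', ia i k = ia i' k' -> i = i' /\ k = k'.
Hypothesis ib_inj : forall i i' k k', ib i k = ib i' k' -> i = i' /\ k = k'.
Hypothesis ia_ib : forall i i' k k', ia i k != ib i' k'.

Local Notation N := (n%:R : R).
Hypothesis mn : @large R m n.
Local Notation L := (ln N).
Local Notation Q := (Num.sqrt N).
Let mix (q : 'I_m -> R) x := mixture (gvec ia ^~ x) (gvec ib ^~ x) q.
Let N0 := large_gt0 mn.

Let r01 : 0 < (N ^+ 2)^-1 <= 1.
Proof.
have h : 1 <= N by rewrite ler1n; exact: large_nat mn.
rewrite invr_gt0 exprn_gt0//= invf_le1 ?exprn_gt0//.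
by rewrite expr_ge1// ltW.
Qed.

Let count_le : (N ^+ 2)^-1^-1 ^+ n = expR (2 * L * N).
Proof.
rewrite (_ : 2 * L * N = N * (2 * L)); last by rewrite mulrC.
by rewrite invrK !expRM_natl (large_expL mn).
Qed.

Let count_m : (N ^+ 2)^-1 * m%:R <= 1.
Proof.
rewrite ler_pdivrMl ?exprn_gt0// mulr1.
by have := large_m mn; have : 0 <= m%:R :> R by []; lra.
Qed.

(** At mesh [216 / n], counting with [r = 1] gives at most [exp (n^2 / 15552 + 2 m)] points, against
    a failure probability [exp (- n^2 / 7680)] at [la = 1/24]. Here [m] is a tiny multiple of
    [n^2]. *)
Lemma likely_flat0 : likely P X (expR (- L)) (fun x =>
  (forall i, nrm2 (gvec ia i x) <= 2 * N) ->
  forall z : 'I_m -> int, let q i := 216 / N * (z i)%:~R in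
    \sum_i q i ^+ 2 <= 3 -> 8^-1 <= \sum_(i | q i ^+ 2 <= 4 / N) q i ^+ 2 ->
    (N / 18) ^+ 2 <= fro2 (mix q x)).
Proof.
pose q (z : 'I_m -> int) i := 216 / N * (z i)%:~R.
pose G z x := \sum_i q z i ^+ 2 <= 3 -> 8^-1 <= \sum_(i | q z i ^+ 2 <= 4 / N) q z i ^+ 2 ->
    (forall i, nrm2 (gvec ia i x) <= 2 * N) -> (N / 18) ^+ 2 <= fro2 (mix (q z) x).
have := @likely_lattice _ _ _ P _ X HX m m (N ^+ 2 / (72 * 216)) 1
  (expR (- (24^-1 * N ^+ 2 / 320))) G _ (expR_ge0 _) _.
move=> H; apply: (likely_le (H _ _)).
- by rewrite ltr01 lexx.
- move=> z _ _.
  have [q3|/negP h] := boolP (\sum_i q z i ^+ 2 <= 3); last first.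
    by apply: likely_true => [|x /h//]; exact: expR_ge0.
  have [q8|/negP h] := boolP (8^-1 <= \sum_(i | q z i ^+ 2 <= 4 / N) q z i ^+ 2); last first.
    by apply: likely_true => [|x _ /h//]; exact: expR_ge0.
  have := @likely_mixture_ge _ _ _ P _ X HX _ _ _ _ ia_inj ib_inj ia_ib (q z) 24^-1 (4 / N)
    [set i | q z i ^+ 2 <= 4 / N]%SET _ _ _ (lexx _) q3 _.
  move=> h; apply: (likely_le (h _ _ _ _) (lexx _)).
  + by [].
  + by move=> i; rewrite inE.
  + by rewrite -mulrA mulfVK ?gt_eqF//; lra.
  + by under eq_bigl do rewrite inE.
  + by move=> x hx _ _; exact: hx.
- rewrite invr1 expr1n mul1r -!expRD ler_expR mulr1.
  by have := large_NN mn; have := large_m mn; have := large_L0 mn; lra.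
- move=> x h sh z /= q3 q8; apply: (h z) => //.
    by rewrite -[X in (_ <= X)%N](card_ord m); exact: max_card.
  have e : \sum_i q z i ^+ 2 = (216 / N) ^+ 2 * \sum_i (z i)%:~R ^+ 2.
    by rewrite mulr_sumr; apply: eq_bigr => i _; rewrite /q exprMn.
  have c0 : 0 < (216 / N) ^+ 2 by apply: exprn_gt0; apply: divr_gt0 => //; rewrite ltr0n.
  rewrite -(ler_pM2l c0) -e; apply: (le_trans q3).
  rewrite (_ : _ * _ = 3)//; field; exact: lt0r_neq0.
Qed.

(** With [r = n^-2] the choice of the support costs [exp (2 L n)] and the factor [exp (2 r m)] at
    most [exp 2]. At this mesh the squares of the integers sum to at most [72 * 216 n]. *)
Lemma likely_sparse (e : R) (G : ('I_m -> int) -> points I R -> Prop) : 0 <= e ->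
  (forall z : 'I_m -> int, let q i := (72 * Q)^-1 * (z i)%:~R in
    \sum_i q i ^+ 2 <= 3 -> likely P X e (G z)) ->
  likely P X (expR (2 * L * N + 72 * 216 * N + 2) * e) (fun x =>
    forall z : 'I_m -> int, let q i := (72 * Q)^-1 * (z i)%:~R in
      (#|[pred i | z i != 0%R]| <= n)%N -> \sum_i q i ^+ 2 <= 3 -> G z x).
Proof.
move=> e0 HG.
have sE (z : 'I_m -> int) : (\sum_i ((72 * Q)^-1 * (z i)%:~R) ^+ 2 <= 3) =
    (\sum_i (z i)%:~R ^+ 2 <= 72 * 216 * N).
  rewrite (eq_bigr (fun i => (72 * Q)^-1 ^+ 2 * (z i)%:~R ^+ 2)); last first.
    by move=> i _; rewrite exprMn.
  have c0 : 0 < (72 * Q)^-1 ^+ 2.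
    by apply: exprn_gt0; rewrite invr_gt0; apply: mulr_gt0 => //; exact: large_Q0 mn.
  rewrite -mulr_sumr -[in RHS](ler_pM2l c0); congr (_ <= _).
  by rewrite exprVn exprMn (large_QE mn); field; exact: lt0r_neq0.
have := @likely_lattice _ _ _ P _ X HX m n (72 * 216 * N) (N ^+ 2)^-1 e G r01 e0 _.
move=> H; apply: (likely_le (H _)).
- by move=> z _ z2; apply: HG; rewrite sE.
- rewrite count_le -!expRD; apply: ler_wpM2r => //.
  by rewrite ler_expR lerD2l; have := count_m; lra.
- by move=> x h z /= zn q3; apply: (h z) => //; rewrite -sE.
Qed.

Lemma likely_flat1 : likely P X (expR (- L)) (fun x =>
  (forall i, nrm2 (gvec ia i x) <= 2 * N) ->
  forall z : 'I_m -> int, let q i := (72 * Q)^-1 * (z i)%:~R in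
    (#|[pred i | z i != 0%R]| <= n)%N -> \sum_i q i ^+ 2 <= 3 ->
    8^-1 <= \sum_(i | q i ^+ 2 <= (L ^+ 2)^-1) q i ^+ 2 ->
    (N / 18) ^+ 2 <= fro2 (mix q x)).
Proof.
pose q (z : 'I_m -> int) i := (72 * Q)^-1 * (z i)%:~R.
pose G z x := 8^-1 <= \sum_(i | q z i ^+ 2 <= (L ^+ 2)^-1) q z i ^+ 2 ->
    (forall i, nrm2 (gvec ia i x) <= 2 * N) -> (N / 18) ^+ 2 <= fro2 (mix (q z) x).
have L2 : 0 < L ^+ 2 by rewrite exprn_gt0// (large_L0 mn).
have := @likely_sparse (expR (- (L ^+ 2 / N * N ^+ 2 / 320))) G (expR_ge0 _) _.
move=> H; apply: (likely_le (H _)).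
- move=> z /= q3.
  have [q8|/negP h] := boolP (8^-1 <= \sum_(i | q z i ^+ 2 <= (L ^+ 2)^-1) q z i ^+ 2); last first.
    by apply: likely_true => [|x /h//]; exact: expR_ge0.
  have := @likely_mixture_ge _ _ _ P _ X HX _ _ _ _ ia_inj ib_inj ia_ib (q z) (L ^+ 2 / N)
    (L ^+ 2)^-1 [set i | q z i ^+ 2 <= (L ^+ 2)^-1]%SET _ _ _ _ q3 _.
  move=> h; apply: (likely_le (h _ _ _ _ _) (lexx _)).
  + exact: divr_gt0.
  + by move=> i; rewrite inE.
  + by rewrite mulrAC divfK ?gt_eqF// divff// gt_eqF.
  + exact: large_L2 mn.
  + by under eq_bigl do rewrite inE.
  + by move=> x hx _; exact: hx.
- rewrite -!expRD ler_expR.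
  have e : L ^+ 2 / N * N ^+ 2 / 320 = L * (L * N) / 320.
    by field; exact: lt0r_neq0.
  have h0 : 0 <= L - 100 * 100 by rewrite subr_ge0; exact: large_L mn.
  have LN : 0 <= (L - 100 * 100) * N by apply: mulr_ge0 => //; exact: ltW.
  have LLN : 0 <= (L - 100 * 100) * (L * N).
    by apply: mulr_ge0 => //; apply: mulr_ge0; apply: ltW => //; exact: large_L0 mn.
  by rewrite e; have := large_N mn; have := large_L mn; have := large_L0 mn; lra.
- by move=> x h sh z /= zn q3 q8; apply: (h z).
Qed.

(** [tau] is the level required by [cross_sum_le]. The exponent is of order [n^2 / tau], that is
    [n^(3/2) / L^4], and exceeds the entropy [2 L n] because [sqrt n] dominates [L^5]. *)
Lemma likely_spiky : likely P X (expR (- L)) (fun x =>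
  forall z : 'I_m -> int, let q i := (72 * Q)^-1 * (z i)%:~R in
    (#|[pred i | z i != 0%R]| <= n)%N -> \sum_i q i ^+ 2 <= 3 ->
    let Y i := bform ((fnorm (mix q x))^-1 *: mix q x) (gvec ia i x) (gvec ib i x) in
    \sum_(i | z i == 0%R) Num.min (Y i ^+ 2) (32 * Q * L ^+ 4 * `|Y i|) <= (N / 72) ^+ 2).
Proof.
pose tau := 32 * Q * L ^+ 4.
have Q0 := large_Q0 mn; have L0 := large_L0 mn.
have tau0 : 0 < tau by rewrite !mulr_gt0// exprn_gt0.
pose G (z : 'I_m -> int) x := let q i := (72 * Q)^-1 * (z i)%:~R in
    let Y i := bform ((fnorm (mix q x))^-1 *: mix q x) (gvec ia i x) (gvec ib i x) in
    \sum_(i | z i == 0%R) Num.min (Y i ^+ 2) (tau * `|Y i|) <= (N / 72) ^+ 2.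
have H := @likely_sparse (expR ((60 * m%:R - (N / 72) ^+ 2) / (8 * tau))) G (expR_ge0 _) _.
apply: (likely_le (H _)).
- by move=> z /= _; exact: likely_cross.
- rewrite -!expRD ler_expR.
  have e : (60 * m%:R - (N / 72) ^+ 2) / (8 * tau) <= - (4 * (L * N)).
    have h : 0 <= (Q - 100 * 100 * (100 * 100) * L ^+ 5) * (Q * N).
      apply: mulr_ge0; last by apply: mulr_ge0; exact: ltW.
      rewrite subr_ge0; have c0 : 0 <= 100 * 100 :> R by lra.
      have := large_QL (erefl : 2 + 5 = 7)%N mn c0 (large_L mn).
      by rewrite [(100 * 100) ^+ 2]expr2.
    rewrite ler_pdivrMr; last by rewrite mulr_gt0.
    have NNE : N ^+ 2 = Q * (Q * N).
      by rewrite mulrA -expr2 (large_QE mn) expr2.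
    have h1 : 0 <= L ^+ 5 * (Q * N).
      by apply: mulr_ge0; [exact/exprn_ge0/ltW|apply: mulr_ge0; exact: ltW].
    have -> : - (4 * (L * N)) * (8 * tau) = - (4 * 8 * 32 * (L ^+ 5 * (Q * N))).
      by rewrite /tau; ring.
    by have := large_m mn; rewrite exprMn; move: h; rewrite NNE; lra.
  have h0 : 0 <= L - 100 * 100 by rewrite subr_ge0; exact: large_L mn.
  have LN : 0 <= (L - 100 * 100) * N by apply: mulr_ge0 => //; exact: ltW.
  by have := large_N mn; have := large_L mn; have := large_L0 mn; lra.
- by move=> x h z /= zn q3; exact: (h z).
Qed.

Let m_le : m%:R <= expR (2 * L).
Proof.
rewrite expRM_natl (large_expL mn).
by have := large_m mn; have : 0 <= m%:R :> R by []; lra.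
Qed.

Let shell (ic : 'I_m -> 'I_n -> I) x :=
  (forall i, N / 2 <= nrm2 (gvec ic i x) <= 2 * N) /\
  (forall i j, i != j -> `|dotv (gvec ic i x) (gvec ic j x)| <= Q * L ^+ 2).

Let likely_shell (ic : 'I_m -> 'I_n -> I) :
  (forall i i' k k', ic i k = ic i' k' -> i = i' /\ k = k') ->
  likely P X (4 * expR (- L)) (shell ic).
Proof.
move=> inj; have h1 : likely P X (2 * expR (- L))
    (fun x => forall i, N / 2 <= nrm2 (gvec ic i x) <= 2 * N).
  apply: (likely_le (likely_norms HX _) _ (fun _ h => h)) => [i k k' h|]; first by have [] := inj _ _ _ _ h.
  rewrite mulrCA ler_wpM2l//; apply: (@le_trans _ _ (expR (2 * L) * expR (- (N / 32)))).
    by rewrite ler_wpM2r ?expR_ge0.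
  by rewrite -expRD ler_expR; have := large_N mn; have := large_L0 mn; lra.
have h2 : likely P X (2 * expR (- L)) (fun x => (forall i, nrm2 (gvec ic i x) <= 2 * N) ->
      forall i j, i != j -> `|dotv (gvec ic i x) (gvec ic j x)| <= Q * L ^+ 2).
  apply: (likely_le (likely_dots HX (L ^+ 2) (large_nat mn) inj)) => //.
  rewrite mulrCA ler_wpM2l//.
  apply: (@le_trans _ _ (expR (2 * L) ^+ 2 * expR (1 - L ^+ 2))).
    by rewrite ler_wpM2r ?expR_ge0// lerXn2r ?nnegrE ?expR_ge0.
  rewrite -expRM_natl -expRD ler_expR.
  have h0 : 0 <= (L - 100 * 100) * L.
    by apply: mulr_ge0; [rewrite subr_ge0; exact: large_L mn|exact: ltW (large_L0 mn)].
  by have := large_L mn; lra.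
apply: (likely_le (likely_and HX h1 h2)); first by rewrite -mulrDl; lra.
by move=> x [g1 g2]; split=> //; apply: g2 => i; have /andP[] := g1 i.
Qed.

(** [11 = 4 + 4 + 3]: lengths and inner products in each half, then the three lattice events. *)
Lemma likely_gram : likely P X (11 * expR (- L)) (fun x =>
  [/\ forall i, nrm2 (gvec ia i x) <= 2 * N, forall i, nrm2 (gvec ib i x) <= 2 * N &
    forall q, (N / 36) ^+ 2 * \sum_i q i ^+ 2 <= fro2 (mix q x)]).
Proof.
have h1 := likely_and HX (likely_shell ia_inj) (likely_shell ib_inj).
have h2 := likely_and HX likely_flat0 (likely_and HX likely_flat1 likely_spiky).
apply: (likely_le (likely_and HX h1 h2)); first by lra.
move=> x [[[a1 a2] [b1 b2]] [f0 [f1 f2]]].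
have sa i : nrm2 (gvec ia i x) <= 2 * N by have /andP[] := a1 i.
have sb i : nrm2 (gvec ib i x) <= 2 * N by have /andP[] := b1 i.
have Q0 := large_Q0 mn; have L0 := large_L0 mn; have QE := large_QE mn.
have Q4 : Q ^+ 4 = N ^+ 2 by rewrite -[in RHS]QE -exprM.
have N1 : 100 * 100 * (100 * 100) <= N.
  by have := large_N mn; have := large_L mn; lra.
have L10 : 100 * 120 * L ^+ 10 <= N.
  have h : 100 * 120 * L ^+ 5 <= Q.
    have c0 : 0 <= 100 * 100 :> R by lra.
    have := large_QL (erefl : 2 + 5 = 7)%N mn c0 (large_L mn).
    by have : 0 <= L ^+ 5 by [exact/exprn_ge0/ltW]; rewrite [(100 * 100) ^+ 2]expr2; lra.
  have h0 : 0 <= L ^+ 5 by exact/exprn_ge0/ltW.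
  have : (100 * 120 * L ^+ 5) ^+ 2 <= Q ^+ 2.
    by rewrite lerXn2r ?nnegrE ?(ltW Q0)// mulr_ge0// mulr_ge0.
  rewrite QE exprMn -exprM [(100 * 120) ^+ 2]expr2.
  by have : 0 <= L ^+ 10 by [exact/exprn_ge0/ltW]; lra.
have L6 : 60 * L ^+ 6 <= N.
  apply: le_trans L10; have -> : L ^+ 10 = L ^+ 4 * L ^+ 6 by rewrite -exprD.
  rewrite mulrA ler_wpM2r//; first by exact/exprn_ge0/ltW.
  have : 1 ^+ 4 <= L ^+ 4 by rewrite lerXn2r ?nnegrE ?(ltW L0)//; have := large_L mn; lra.
  by rewrite expr1n; lra.
have tauL : 972 * N * (Q * L ^+ 2) ^+ 4 <= (32 * Q * L ^+ 4) ^+ 2 * N ^+ 2.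
  rewrite [leLHS](_ : _ = 972 * N * (Q ^+ 4 * L ^+ 8)); last by ring.
  rewrite [leRHS](_ : _ = 32 * 32 * (Q ^+ 2 * L ^+ 8) * N ^+ 2); last by ring.
  have : 0 <= N ^+ 3 * L ^+ 8 by apply: mulr_ge0; exact/exprn_ge0/ltW.
  by rewrite Q4 QE; lra.
split=> // q; apply: (@mixture_ge R m n _ _ (216 / N) (72 * Q)^-1 (Q * L ^+ 2)
  (32 * Q * L ^+ 4) (L ^+ 2)) => //.
- exact: large_nat mn.
- by apply: divr_gt0 => //; rewrite ltr0n.
- by rewrite invr_gt0 mulr_gt0.
- by rewrite mulr_ge0 ?exprn_ge0// ltW.
- by apply: mulr_ge0; [apply: mulr_ge0 => //; exact: ltW|exact/exprn_ge0/ltW].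
- by rewrite exprn_gt0.
- rewrite expr_div_n mulrA ler_pdivrMr ?exprn_gt0//.
  by have := large_m mn; rewrite [216 ^+ 2]expr2; lra.
- rewrite expr_div_n mulrA ler_pdivrMr ?exprn_gt0// mul1r [216 ^+ 2]expr2 [leLHS]mulrC.
  by rewrite [leRHS]expr2 ler_pM2r//; lra.
- rewrite exprVn exprMn QE [72 ^+ 2]expr2 le_eqVlt; apply/orP; left; apply/eqP.
  by field; exact: lt0r_neq0.
- rewrite exprMn QE [leRHS]expr2 (_ : _ * _ * _ = 60 * L ^+ 6 * N); last by ring.
  by rewrite ler_pM2r.
- rewrite exprMn Q4.
  rewrite (_ : _ * _ * _ * _ = 100 * 120 * L ^+ 10 * N ^+ 3); last by ring.
  by rewrite (exprS N 3) ler_pM2r// exprn_gt0.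
- exact: f0.
- exact: f1.
Qed.

End group.

Section fit.
Context d (T : measurableType d) (R : realType) (P : probability T R).
Context (I : finType).
Variable X : T -> points I R.
Hypothesis HX : gaussian_array P X.
Variables m n : nat.
Variables ia ib : 'I_m -> 'I_n -> I.
Hypothesis ia_inj : forall i i' k k', ia i k = ia i' k' -> i = i' /\ k = k'.
Hypothesis ib_inj : forall i i' k k', ib i k = ib i' k' -> i = i' /\ k = k'.
Hypothesis ia_ib : forall i i' k k', ia i k != ib i' k'.
Hypothesis mn : @large R m n.

Local Notation N := (n%:R : R).
Local Notation L := (ln N).
Let N0 := large_gt0 mn.

(** [likely_lattice] with [K = 16 n] and [r = 1] costs [exp (16 n + 2 n)] for each of the two
    arguments. *)
Lemma likely_nets (e : R) (G : 'cV[R]_n -> 'cV[R]_n -> points I R -> Prop) : 0 <= e ->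
  (forall u v, nrm2 u <= 1 -> nrm2 v <= 1 -> likely P X e (G u v)) ->
  likely P X (expR (36 * N) * e) (fun x => forall z z',
    nrm2 (netv z : 'cV[R]_n) <= 1 -> nrm2 (netv z' : 'cV[R]_n) <= 1 -> G (netv z) (netv z') x).
Proof.
move=> e0 HG.
have one f (H : ('I_n -> int) -> points I R -> Prop) : 0 <= f ->
    (forall z, nrm2 (netv z : 'cV[R]_n) <= 1 -> likely P X f (H z)) ->
    likely P X (expR (18 * N) * f) (fun x => forall z, nrm2 (netv z : 'cV[R]_n) <= 1 -> H z x).
  move=> f0 HH.
  have h := @likely_lattice _ _ _ P _ X HX n n (16 * N) 1 f
    (fun z x => nrm2 (netv z : 'cV[R]_n) <= 1 -> H z x) _ f0 _.
  apply: (likely_le (h _ _)).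
  - by rewrite ltr01 lexx.
  - move=> z _ _; have [z1|_] := boolP (nrm2 (netv z : 'cV[R]_n) <= 1).
      by apply: (likely_le (HH z z1) (lexx _)).
    by apply: likely_true.
  - rewrite invr1 expr1n mul1r mulr1 -expRD le_eqVlt; apply/orP; left; apply/eqP.
    by congr (expR _ * _); ring.
  - move=> x hx z z1; apply: (hx z) => //.
      by rewrite -[X in (_ <= X)%N](card_ord n); exact: max_card.
    exact: (netv_sum (large_nat mn) z1).
have -> : expR (36 * N) * e = expR (18 * N) * (expR (18 * N) * e).
  by rewrite mulrA -expRD; congr (expR _ * _); ring.
have h2 := one (expR (18 * N) * e) (fun z x => forall z', nrm2 (netv z' : 'cV[R]_n) <= 1 ->
  G (netv z) (netv z') x) _ _.
apply: (likely_le (h2 _ _) (lexx _)).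
- by rewrite mulr_ge0 ?expR_ge0.
- by move=> z z1; apply: one => // z' z'1; exact: HG.
- by move=> x hx z z' z1 z'1; exact: hx.
Qed.

Variables (J : finType) (c : J -> I) (r : J -> 'I_m) (W : R).
Hypothesis c_inj : injective c.
Hypothesis c_ia : forall j i k, ia i k != c j.
Hypothesis c_ib : forall j i k, ib i k != c j.
(* [600 * 36 ^ 4 / n ^ 2] bounds the squared norm of [gram_sol] at net points: it is
   the bound of [likely_net] divided by the square of that of [likely_gram]. *)
Hypothesis W_ge : 592 * (600 * (36 * 36) * (36 * 36)) <= W.
Hypothesis cardJ : forall i, #|[pred j | r j == i]|%:R <= 2 * N * W.

(** At Chernoff parameter [148 n] the threshold contributes [- 74 n] and the variance at most
    [37 n], provided [W >= 592 w] with [592 = 148^2 / 37]. Each net pair thus fails with probability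
    at most [exp (- 37 n)], and the net leaves [exp (- n)]. *)
Lemma likely_fit : likely P X (13 * expR (- L)) (fun x => exists M : 'M[R]_n,
  (forall y z, 2 * bform M y z <= nrm2 y + nrm2 z) /\
  forall i, bform M (gvec ia i x) (gvec ib i x) = residual c r (2 * W)^-1 x i).
Proof.
have NL : L <= N by have := large_N mn; have := large_L0 mn; lra.
have [w wE] : exists w : R, w = 600 * (36 * 36) * (36 * 36) by eexists.
have w1 : 1 <= w by rewrite wE; lra.
have Ww := W_ge; rewrite -wE in Ww.
have W0 : 0 < W by lra.
clear W_ge; pose B := w / N ^+ 2.
have N2 : 0 < N ^+ 2 by rewrite exprn_gt0.
have B0 : 0 <= B by rewrite divr_ge0 ?(ltW N2)//; lra.
have D0 : 0 <= 2 * N * W by rewrite !mulr_ge0// ltW.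
have sg0 : 0 <= (2 * W)^-1 by rewrite invr_ge0 mulr_ge0// ltW.
have s0 : 0 < 148 * N by apply: mulr_gt0 => //; rewrite ltr0n.
have wW2 : (592 * w) ^+ 2 <= W ^+ 2 by apply: lerXn2r Ww; rewrite nnegrE; lra.
have ww : w <= w ^+ 2 by rewrite expr2 ler_peMr//; lra.
have sB : (148 * N) ^+ 2 * (2 * W)^-1 ^+ 2 * B <= 64^-1.
  rewrite (_ : _ * B = 148 * 37 * w / W ^+ 2).
    rewrite ler_pdivrMr ?exprn_gt0//; move: wW2; rewrite exprMn [592 ^+ 2]expr2.
    lra.
  by rewrite /B; field; rewrite !gt_eqF.
have hD : 2 * (148 * N) ^+ 2 * (2 * W)^-1 ^+ 2 * (2 * N * W) * B <= 37 * N.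
  rewrite (_ : _ * B = 148 * 148 * w / W * N).
    rewrite ler_pM2r// ler_pdivrMr//; lra.
  by rewrite /B; field; rewrite !gt_eqF.
have m60 : 60 * m%:R <= 8 * N ^+ 2.
  by have := large_m mn; have : 0 <= m%:R :> R by []; lra.
have h1 := likely_gram HX ia_inj ib_inj ia_ib mn.
have h2 := likely_nets (expR_ge0 _)
  (fun u v u1 v1 => likely_net HX ia_inj ib_inj ia_ib (large_nat mn) u1 v1 m60).
have h3 := likely_nets (expR_ge0 _)
  (fun u v _ _ => likely_residual HX c_inj c_ia c_ib D0 cardJ u v s0 B0 sg0 sB).
apply: (likely_le (likely_and HX h1 (likely_and HX h2 h3))).
  rewrite -!expRD (_ : 13 * _ = 11 * expR (- L) + (expR (- L) + expR (- L))); last by ring.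
  by rewrite lerD2l; apply: lerD; rewrite ler_expR; lra.
move=> x [[sa sb G] [S H]].
have ka0 : 0 < (N / 36) ^+ 2 by rewrite exprn_gt0// divr_gt0.
apply: (@gram_solve R m n _ _ _ ka0 G _ (600 * N ^+ 2) B (large_nat mn)).
- rewrite le_eqVlt; apply/orP; left; apply/eqP.
  by rewrite /B wE; field; exact: lt0r_neq0.
- by move=> z z' z1 z'1; exact: S.
- by move=> z z' z1 z'1; exact: H.
Qed.

End fit.

(** * Assembling the blocks *)

Section blocks.
Context {R : realType} (d n W : nat).
Variable pos : 'I_W.+1 -> bool -> 'I_n -> 'I_d.
Hypothesis n0 : (0 < n)%N.
Hypothesis W0 : (0 < W)%N.

Definition block k s (u : 'cV[R]_d) : 'cV[R]_n := \col_l u (pos k s l) 0.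

Definition deficit k (u : 'cV[R]_d) : R :=
  2 * n%:R - nrm2 (block k false u) - nrm2 (block k true u).

Let E k s : 'M[R]_(n, d) := \matrix_(l, j) (j == pos k s l)%:R.

Let EE k s u : E k s *m u = block k s u.
Proof.
apply/matrixP => l j; rewrite (ord1 j) !mxE (bigD1 (pos k s l))//= !mxE eqxx mul1r.
by rewrite big1 ?addr0// => i /negbTE ij; rewrite mxE ij mul0r.
Qed.

(** With deficits [D_k] of sum [S], block [k] contributes [2 n - D_k + (S - D_k) / W]; over the
    [W + 1] blocks the deficits cancel and [2 n (W + 1)] remains, which [c] normalises to 1.
    Coordinates outside the blocks get weight 0. *)
Lemma ellipsoid_of_blocks m (v : 'I_m -> 'cV[R]_d) (M : 'I_W.+1 -> 'M[R]_n) :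
  (forall k y z, 2 * bform (M k) y z <= nrm2 y + nrm2 z) ->
  (forall k i, bform (M k) (block k false (v i)) (block k true (v i)) =
    (2 * W%:R)^-1 * \sum_j deficit (lift k j) (v i)) ->
  ellipsoid_through v.
Proof.
move=> HM Hv; pose c : R := (2 * W.+1%:R * n%:R)^-1.
have c0 : 0 < c by rewrite invr_gt0 !mulr_gt0// ltr0n.
pose Lk k := (E k false)^T *m E k false + (E k true)^T *m E k true +
  ((E k false)^T *m M k *m E k true + (E k true)^T *m (M k)^T *m E k false).
pose L := c *: \sum_k Lk k.
have Lksym k : (Lk k)^T = Lk k.
  rewrite /Lk !linearD/= !trmx_mul !trmxK -!mulmxA; congr (_ + _); exact: addrC.
have uL u : (u^T *m L *m u) 0 0 = c * \sum_k (nrm2 (block k false u) + nrm2 (block k true u) +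
    2 * bform (M k) (block k false u) (block k true u)).
  have addE (A B : 'M[R]_d) : bform (A + B) u u = bform A u u + bform B u u.
    by rewrite /bform mulmxDr mulmxDl mxE.
  have conjE (A B : 'M[R]_(n, d)) (C : 'M[R]_n) :
      bform (A^T *m C *m B) u u = bform C (A *m u) (B *m u).
    by rewrite /bform trmx_mul !mulmxA.
  have idE (y : 'cV[R]_n) : bform 1%:M y y = nrm2 y.
    by rewrite /bform mulmx1 mxE; apply: eq_bigr => l _; rewrite mxE expr2.
  have trE (C : 'M[R]_n) y z : bform C^T y z = bform C z y.
    by rewrite /bform -[in RHS](trmxK (_ *m _)) [RHS]mxE !trmx_mul trmxK mulmxA.
  rewrite -/(bform L u u) bformZ; congr (_ * _).
  have -> : bform (\sum_k Lk k) u u = \sum_k bform (Lk k) u u.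
    by elim/big_rec2: _ => [|k a A _ <-]; [rewrite /bform mulmx0 mul0mx mxE|rewrite addE].
  apply: eq_bigr => k _; rewrite !addE !conjE trE -!EE -[(E k false)^T]mulmx1.
  by rewrite -[(E k true)^T]mulmx1 !conjE !idE; ring.
exists L; split; [split|].
- by rewrite /L linearZ/= linear_sum/=; congr (_ *: _); apply: eq_bigr => k _.
- move=> u; rewrite uL mulr_ge0 ?(ltW c0)//; apply: sumr_ge0 => k _.
  (* A sign change in one half turns the upper bound on [M k] into the lower bound that positivity
     requires. *)
  have := HM k (- block k false u) (block k true u).
  rewrite -scaleN1r bformZl (_ : nrm2 (-1 *: _) = nrm2 (block k false u)); first by lra.
  by apply: eq_bigr => l _; rewrite mxE mulN1r sqrrN.
move=> i; rewrite uL; under eq_bigr do rewrite Hv.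
pose S := \sum_k deficit k (v i).
have Wn : W%:R != 0 :> R by rewrite pnatr_eq0 -lt0n.
rewrite (eq_bigr (fun k => 2 * n%:R + W%:R^-1 * S - (1 + W%:R^-1) * deficit k (v i))); last first.
  move=> k _; have -> : \sum_j deficit (lift k j) (v i) = S - deficit k (v i).
    by rewrite /S (bigD1_ord k)//= addrC addrK.
  by rewrite /deficit; field.
rewrite sumrB -mulr_sumr -/S sumr_const card_ord -mulr_natl /c -natr1.
by field; rewrite Wn nat1r !pnatr_eq0 -lt0n n0.
Qed.

End blocks.

Section probability_space.
Context disp (T : measurableType disp) (R : realType) (P : probability T R).

Lemma gaussian_array_tuples m d (v : 'I_m -> {RV P >-> d.-tuple R}) :
  (forall i, standard_gaussian (v i)) -> mutually_independent P (fun i w => v i w) ->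
  gaussian_array P (fun w (p : 'I_m * 'I_d) => tnth (v p.1 w) p.2).
Proof.
move=> sv iv; split.
  move=> [i k] /=; have mv : measurable_fun setT (v i) by exact: measurable_funPT.
  exact: (measurableT_comp (measurable_tnth k) mv).
move=> A mA.
pose B i : set (d.-tuple R) := [set t | forall k, A (i, k) (tnth t k)].
have mB i : measurable (B i).
  apply: measurable_forall_fin => k.
  by rewrite -[X in measurable X]setTI; exact: measurable_tnth.
have := iv [set: 'I_m]%SET B mB.
rewrite (_ : \bigcap_(i in _) _ = [set w | forall p : 'I_m * 'I_d, A p (tnth (v p.1 w) p.2)]); last first.
  apply/seteqP; split=> w /= h.
    by move=> [i k]; apply: (h i) => /=; rewrite inE.
  by move=> i _ k; exact: (h (i, k)).
move=> ->; rewrite [RHS](_ : _ = \prod_i \prod_k gauss R (A (i, k)))%E; last first.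
  by rewrite pair_bigA /=; apply: eq_bigr => -[].
apply: eq_big => [i|i _]; first by rewrite inE.
have [si gi] := sv i.
have := si [set: 'I_d]%SET (fun k => A (i, k)) (fun k => mA (i, k)).
rewrite (_ : \bigcap_(k in _) _ = v i @^-1` B i); last first.
  apply/seteqP; split=> w /= h; first by move=> k; apply: h => /=; rewrite inE.
  by move=> k _; exact: h.
move=> ->; apply: eq_big => [k|k _]; first by rewrite inE.
exact: (gi k (A (i, k)) (mA _)).
Qed.

(** The indicator of the complement of [S] lies below the test function, because [F (X w) < 1]
    forces [S w]. *)
Lemma likely_prob (I : finType) (X : T -> points I R) e G (S : set T) :
  gaussian_array P X -> likely P X e G -> measurable S ->
  (forall w, G (X w) -> S w) -> ((1 - e)%:E <= P S)%E.
Proof.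
move=> HX [F [mF F0 EF FG]] mS GS.
have PC : (P (~` S) <= e%:E)%E.
  have mC : measurable (~` S) by exact: measurableC.
  have -> : P (~` S) = (\int[P]_w (\1_(~` S) w)%:E)%E by rewrite integral_indic ?setIT.
  apply: le_trans EF; apply: ge0_le_integral => //.
  - by apply/measurable_EFinP; exact: measurable_indic.
  - apply/measurable_EFinP; apply: measurableT_comp => //.
    by apply: measurable_points; exact: HX.1.
  move=> w _; rewrite lee_fin indicE; have [|_] := boolP (w \in _); last exact: F0.
  rewrite inE => /= nS; rewrite leNgt; apply/negP => /FG/GS; exact: nS.
move: PC; rewrite probability_setC// -[P S]fineK ?fin_num_measure// -EFinB !lee_fin.
by lra.
Qed.

End probability_space.

Lemma large_eventually (R : realType) : exists N0 : nat, forall n : nat, (N0 <= n)%N ->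
  (0 < n)%N /\ 100 * 100 <= ln n%:R :> R /\ (ln n%:R : R) ^+ 7 <= Num.sqrt n%:R.
Proof.
(* Once [L >= 15^15], [L^14 <= (L / 15)^15 <= exp L = n], and a square root gives
   [L^7 <= sqrt n]. *)
pose C : R := 100 * 100 + 15 ^+ 15.
have C0 : 0 < 15 ^+ 15 :> R by rewrite exprn_gt0// ltr0n.
have [N0 N0E] : exists N0 : nat, expR C < N0%:R.
  by exists (Num.bound (expR C)); apply: archi_boundP; exact: expR_ge0.
exists N0 => n nN; have nC : expR C < n%:R.
  by apply: lt_le_trans N0E _; rewrite ler_nat.
have n0 : 0 < n%:R :> R by apply: lt_trans nC; exact: expR_gt0.
have LC : C <= ln n%:R.
  by rewrite -[C]expRK ler_ln ?posrE ?expR_gt0// ltW.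
set L := ln _ in LC *.
have L0 : 0 <= L by move: LC; rewrite /C; lra.
split; first by rewrite -(@ltr0n R).
split; first by move: LC; rewrite /C; lra.
have nE : n%:R = expR (L / 15) ^+ 15.
  by rewrite -expRM_natl mulrC divfK// lnK.
have h : L ^+ 14 <= n%:R.
  apply: (@le_trans _ _ ((L / 15) ^+ 15)); last first.
    rewrite nE lerXn2r ?nnegrE ?expR_ge0 ?divr_ge0//.
    by apply: le_trans (expR_ge1Dx _); rewrite lerDr.
  rewrite expr_div_n ler_pdivlMr// (exprS L 14) [leRHS]mulrC; apply: ler_wpM2l.
    exact: exprn_ge0.
  by move: LC; rewrite /C; lra.
by rewrite -[leLHS]ger0_norm ?exprn_ge0// -sqrtr_sqr -exprM ler_wsqrtr.
Qed.

Section ellipsoid.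
Context disp (T : measurableType disp) (R : realType) (P : probability T R).
Variables m d n W : nat.
Variable X : T -> points ('I_m * 'I_d)%type R.
Hypothesis HX : gaussian_array P X.
Hypothesis mn : @large R m n.
Hypothesis W_ge : 592 * (600 * (36 * 36) * (36 * 36)) <= W%:R :> R.
Hypothesis Wnd : (W.+1 * (2 * n) <= d)%N.

Lemma exists_pos : exists pos : 'I_W.+1 -> bool -> 'I_n -> 'I_d,
  forall k s l k' s' l', pos k s l = pos k' s' l' -> [/\ k = k', s = s' & l = l'].
Proof.
have le : (#|{: 'I_W.+1 * (bool * 'I_n)}| <= d)%N.
  by rewrite !card_prod card_bool !card_ord.
exists (fun k s l => widen_ord le (enum_rank (k, (s, l)))) => k s l k' s' l'.
by move/(congr1 val) => /= /val_inj/enum_rank_inj[-> -> ->].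
Qed.

Lemma likely_ellipsoid : likely P X (W.+1%:R * (13 * expR (- ln n%:R)))
  (fun x => ellipsoid_through (fun i => \col_j x (i, j))).
Proof.
have [pos pos_inj] := exists_pos.
have W0 : (0 < W)%N.
  by rewrite -(@ltr0n R); have := W_ge; lra.
pose ic k s (i : 'I_m) l := (i, pos k s l).
pose J := ('I_m * ('I_W * (bool * 'I_n)))%type.
(* [lift k] runs over the blocks other than [k], so the target of block [k] uses none of its own
   coordinates. *)
pose c (k : 'I_W.+1) (j : J) := (j.1, pos (lift k j.2.1) j.2.2.1 j.2.2.2).
have icE k s i (x : points ('I_m * 'I_d)%type R) :
    gvec (ic k s) i x = block pos k s (\col_j x (i, j)).
  by apply/matrixP => l l'; rewrite !mxE.
have resE (k : 'I_W.+1) i sg (x : points ('I_m * 'I_d)%type R) :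
    residual (c k) fst sg x i = sg * \sum_j deficit pos (lift k j) (\col_l x (i, l)).
  rewrite /residual; congr (_ * _).
  rewrite (reindex_onto (fun q => (i, q)) snd)/=; last by move=> [i' q] /eqP /= ->.
  rewrite (eq_bigl predT); last by move=> q; rewrite /= !eqxx.
  rewrite -(pair_bigA _ (fun a b => 1 - x (c k (i, (a, b))) ^+ 2))/=.
  apply: eq_bigr => a _.
  rewrite -(pair_bigA _ (fun s l => 1 - x (c k (i, (a, (s, l)))) ^+ 2))/= big_bool/=.
  rewrite !sumrB !sumr_const card_ord /deficit /nrm2 /c/=.
  under [in RHS]eq_bigr do rewrite !mxE.
  under [X in _ = _ - X]eq_bigr do rewrite !mxE.
  by rewrite -[1 *+ n]/(n%:R); ring.
have H k : likely P X (13 * expR (- ln n%:R)) (fun x => exists M : 'M[R]_n,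
    (forall y z, 2 * bform M y z <= nrm2 y + nrm2 z) /\
    forall i, bform M (gvec (ic k false) i x) (gvec (ic k true) i x) =
      residual (c k) fst (2 * W%:R)^-1 x i).
  apply: (likely_fit HX) => //.
  - by move=> i i' l l' [-> /pos_inj[]].
  - by move=> i i' l l' [-> /pos_inj[]].
  - by move=> i i' l l'; apply/eqP => -[_ /pos_inj[]].
  - by move=> [i [a [s l]]] [i' [a' [s' l']]] [/= -> /pos_inj[/lift_inj -> -> ->]].
  - move=> [i [a [s l]]] i' l'; apply/eqP => -[_ /pos_inj[/eqP]].
    by rewrite (negbTE (neq_lift _ _)).
  - move=> [i [a [s l]]] i' l'; apply/eqP => -[_ /pos_inj[/eqP]].
    by rewrite (negbTE (neq_lift _ _)).
  - move=> i; rewrite (_ : #|_| = (W * (2 * n))%N).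
      by rewrite !natrM mulrC.
    rewrite -sum1_card (reindex_onto (fun q => (i, q)) snd)/=; last by move=> [i' q] /eqP /= ->.
    rewrite (eq_bigl predT); last by move=> q; rewrite /= !inE !eqxx.
    by rewrite sum1_card !card_prod card_bool !card_ord.
have := likely_fin HX H; rewrite card_ord => HH.
apply: (likely_le HH (lexx _)) => x hx.
have [M HM] := choice hx.
apply: (@ellipsoid_of_blocks R d n W pos (large_nat mn) W0 m _ M).
- by move=> k; have [] := HM k.
- by move=> k i; have [_ /(_ i)] := HM k; rewrite resE !icE.
Qed.

End ellipsoid.

Theorem theorem1p2 (R : realType) :
  exists2 c : R, 0 < c &
  forall m : nat -> nat,
  exists2 eps : nat -> R, eps n @[n --> \oo] --> (0 : R) &
  forall d : nat, (0 < m d)%N -> (m d)%:R <= c * d%:R ^+ 2 ->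
  forall (disp : measure_display) (T : measurableType disp)
    (P : probability T R) (v : 'I_(m d) -> {RV P >-> d.-tuple R}),
  (forall i, standard_gaussian (v i)) ->
  mutually_independent P (fun i w => v i w) ->
  ((1 - eps d)%:E <=
    P [set w | ellipsoid_through (fun i => tuple_cV (v i w))])%E.
Proof.
have [W W_ge] : exists W : nat, 592 * (600 * (36 * 36) * (36 * 36)) <= W%:R :> R.
  by eexists; apply: ltW; apply: archi_boundP; lra.
have [N0 HN0] := large_eventually R.
pose K : R := W.+1%:R; have K1 : 1 <= K by rewrite ler1n.
(* Since [d <= 4 K n], the bound [m <= d^2 / b] becomes the condition of [large] on [m]. *)
pose b : R := 72 * 108 * (72 * 108) * (4 * K) ^+ 2.
have b0 : 0 < b.
  by rewrite /b; apply: mulr_gt0; [lra|apply: exprn_gt0; lra].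
exists b^-1; first by rewrite invr_gt0.
(* The second summand makes the claim void for small [d], where [C / (d + 1) >= 1]; the first
   dominates the failure probability, as [13 K / n <= 52 K^2 / (d + 1)]. *)
move=> m; pose C : R := 52 * K ^+ 2 + (W.+1 * (2 * N0.+1))%:R.
exists (fun n => C * harmonic n).
  by rewrite -(mulr0 C); apply: cvgMr; exact: cvg_harmonic.
move=> d m0 mc disp T P v sv iv.
have hd : harmonic d = d.+1%:R^-1 :> R by [].
have d1 : 0 < d.+1%:R :> R by rewrite ltr0n.
set S := [set w | _].
have [dsmall|dbig] := ltnP d (W.+1 * (2 * N0.+1)).
  apply: (@le_trans _ _ 0%E); last exact: measure_ge0.
  rewrite lee_fin subr_le0 hd ler_pdivlMr// mul1r /C.
  have : d.+1%:R <= (W.+1 * (2 * N0.+1))%:R :> R by rewrite ler_nat.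
  by have := sqr_ge0 K; lra.
(* The largest [n] for which [W + 1] blocks of size [2 n] fit into [d] coordinates. *)
pose n := (d %/ (W.+1 * 2))%N.
have q0 : (0 < W.+1 * 2)%N by [].
have nN : (N0.+1 <= n)%N by rewrite leq_divRL// mulnC -mulnA.
have nd : (W.+1 * (2 * n) <= d)%N by rewrite mulnA mulnC leq_trunc_div.
have dn : (d < n.+1 * (W.+1 * 2))%N by rewrite -ltn_divLR.
have [n0 [nL nQ]] := HN0 n (ltnW nN).
have n1 : 1 <= n%:R :> R by rewrite ler1n.
have dK : d.+1%:R <= 4 * K * n%:R.
  have : d.+1%:R <= (n.+1 * (W.+1 * 2))%:R :> R by rewrite ler_nat.
  rewrite !natrM -natr1 -/K => h; apply: (le_trans h).
  by have : 0 <= K * (n%:R - 1) by [rewrite mulr_ge0 ?subr_ge0//; lra]; lra.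
have mn : @large R (m d) n.
  split=> //; apply: (@le_trans _ _ (72 * 108 * (72 * 108) * (b^-1 * d%:R ^+ 2))).
    by move: mc; lra.
  have dd : d%:R ^+ 2 <= (4 * K * n%:R) ^+ 2.
    by rewrite lerXn2r ?nnegrE ?mulr_ge0//; lra.
  rewrite mulrCA ler_pdivrMl// /b -[leRHS]mulrA -exprMn; apply: ler_wpM2l dd.
  lra.
have HX := gaussian_array_tuples sv iv.
have H := likely_ellipsoid HX mn W_ge nd.
have h := likely_prob (S := S) HX H; apply: le_trans (h _ _).
- rewrite lee_fin lerD2l lerN2 hd ler_pdivlMr// expRN (large_expL mn).
  rewrite -/K [leLHS](_ : _ = 13 * K * d.+1%:R / n%:R); last by ring.
  rewrite ler_pdivrMr ?ltr0n//; apply: (@le_trans _ _ (52 * K ^+ 2 * n%:R)).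
    by have : 0 <= K * (4 * K * n%:R - d.+1%:R); [rewrite mulr_ge0 ?subr_ge0//; lra|lra].
  by rewrite ler_wpM2r// /C lerDl.
- apply: measurable_ellipsoid => i k j.
  rewrite (_ : (fun w => _) = (fun t => tnth t k) \o v i); last by apply/funext => w; rewrite mxE.
  by apply: measurableT_comp; [exact: measurable_tnth|exact: measurable_funPT].
- by move=> w; congr ellipsoid_through; apply/funext => i; apply/matrixP => k j; rewrite !mxE.
Qed.
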